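(* Let $2n\ge 4$ and let $\omega_t$, $t\in[0,1]$, be a symplectic isotopy on $\mathbb{R}^{2n}$. If there exist $C>0$ and $R>1$ such that $$\|\omega_t^{-1}\|_r\,\|\dot\omega_t\|_r\le C\log r\qquad\text{for all } r\ge R,\ t\in[0,1],$$ where $\|\cdot\|_r$ is the uniform Euclidean norm over the sphere of radius $r$, then $\omega_t$, $t\in[0,1]$, is a strong isotopy.
   Context: A symplectic isotopy on a manifold $M$ is a smooth path $\omega_t$, $t\in[0,1]$, of symplectic forms on $M$ all having the same cohomology class in $H^2(M,\mathbb{R})$; $\dot\omega_t$ denotes its $t$-derivative. It is a strong isotopy if there is a smooth path $\varphi_t$, $t\in[0,1]$, of diffeomorphisms of $M$ with $\varphi_t^*\omega_t=\omega_0$ for all $t$. For a symplectic form $\omega$, regarded as a bundle isomorphism $TM\to T^*M$, $\omega^{-1}:T^*M\to TM$ is its inverse. Here $\|\cdot\|_r$ is the supremum over $\{x\in\mathbb{R}^{2n}:|x|=r\}$ of the pointwise (operator) norm with respect to the Euclidean metric. *)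

(* Defs.v *)
From HB Require Import structures.
From mathcomp Require Import all_boot all_order all_algebra.
From mathcomp Require Import all_classical all_reals all_analysis.

Set Implicit Arguments.
Unset Strict Implicit.
Unset Printing Implicit Defensive.

Import Order.TTheory GRing.Theory Num.Theory.
Import numFieldNormedType.Exports.

Local Open Scope classical_set_scope.
Local Open Scope ring_scope.

(* Tangent vectors, points and covectors are row vectors.  A 2-form w is stored
   as its matrix of components w (e_i, e_j); as a bundle map TM -> T*M,
   u |-> w (u, -), it is therefore u |-> u *m w, and its inverse T*M -> TM is
   a |-> a *m invmx w. *)

Section Smooth.
Context {R : realType} {V W : normedModType R}.

(* On a finite-dimensional V this is the usual C^k: the Fréchet differential
   exists and its evaluation at each fixed v is C^(k-1). *)
Fixpoint Ck (k : nat) (f : V -> W) : Prop :=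
  match k with
  | 0 => continuous f
  | k'.+1 => (forall x, differentiable f x) /\ forall v, Ck k' ('D_v f)
  end.

Definition smooth (f : V -> W) : Prop := forall k, Ck k f.

End Smooth.

Section TimeDerivative.
Context {R : realType} {W : normedModType R}.

(* Difference quotients only involve times in [0, 1], so the derivative is
   one-sided at 0 and 1. *)
Definition time_quotient (c : R -> W) (t s : R) : W := (s - t)^-1 *: (c s - c t).

Definition time_derivable (c : R -> W) (t : R) : Prop :=
  cvg (time_quotient c t s @[s --> within `[0, 1] t^']).

Definition time_derive (c : R -> W) (t : R) : W :=
  lim (time_quotient c t s @[s --> within `[0, 1] t^']).

End TimeDerivative.

Definition path_dot {R : realType} {V W : normedModType R} (F : R -> V -> W) :
  R -> V -> W := fun t x => time_derive (F ^~ x) t.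

Section SmoothPath.
Context {R : realType} {V W : normedModType R}.

(* C^k up to the boundary on the manifold with boundary [0, 1] x V: all mixed
   partial derivatives of order at most k exist on [0, 1] x V (one-sidedly in
   time at the endpoints) and are jointly continuous there.  Values of F at
   times outside [0, 1] are irrelevant. *)
Fixpoint Ck_path (k : nat) (F : R -> V -> W) : Prop :=
  {within `[0, 1] `*` [set: V], continuous (fun p : R * V => F p.1 p.2)} /\
  match k with
  | 0 => True
  | k'.+1 =>
    [/\ forall t : R, t \in `[0, 1] -> forall x,
          differentiable (F t) x /\ time_derivable (F ^~ x) t,
        Ck_path k' (path_dot F) &
        forall v, Ck_path k' (fun t => 'D_v (F t))]
  end.

Definition smooth_path (F : R -> V -> W) : Prop := forall k, Ck_path k F.

Definition diffeomorphism (f : V -> V) : Prop :=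
  smooth f /\ exists g : V -> V, [/\ smooth g, cancel f g & cancel g f].

End SmoothPath.

Section Forms.
Context {R : realType} {m : nat}.
Implicit Types (w : 'rV[R]_m -> 'M[R]_m) (a : 'rV[R]_m -> 'rV[R]_m).

Definition pairing (b u : 'rV[R]_m) : R := (b *m u^T) 0 0.

Definition form2 w (x u v : 'rV[R]_m) : R := pairing (u *m w x) v.

(* d a (u, v) and d w (u, v, z), evaluated on constant vector fields, whose Lie
   brackets vanish. *)
Definition d1 a (x u v : 'rV[R]_m) : R :=
  'D_u (fun y => pairing (a y) v) x - 'D_v (fun y => pairing (a y) u) x.

Definition d2 w (x u v z : 'rV[R]_m) : R :=
  'D_u (fun y => form2 w y v z) x + 'D_v (fun y => form2 w y z u) x
  + 'D_z (fun y => form2 w y u v) x.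

Definition symplectic_form w : Prop :=
  [/\ smooth w,
      forall x, (w x)^T = - w x,
      forall x u v z, d2 w x u v z = 0 &
      forall x, w x \in unitmx].

(* Equality of de Rham classes of closed 2-forms. *)
Definition cohomologous w w' : Prop :=
  exists a, smooth a /\ forall x u v, form2 w x u v - form2 w' x u v = d1 a x u v.

Definition symplectic_isotopy (w : R -> 'rV[R]_m -> 'M[R]_m) : Prop :=
  [/\ smooth_path w,
      forall t : R, t \in `[0, 1] -> symplectic_form (w t) &
      forall s t : R, s \in `[0, 1] -> t \in `[0, 1] -> cohomologous (w s) (w t)].

(* f^* w = w' *)
Definition pullback_eq (f : 'rV[R]_m -> 'rV[R]_m) w w' : Prop :=
  forall x u v, form2 w (f x) ('d f x u) ('d f x v) = form2 w' x u v.

Definition strong_isotopy (w : R -> 'rV[R]_m -> 'M[R]_m) : Prop :=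
  symplectic_isotopy w /\
  exists phi : R -> 'rV[R]_m -> 'rV[R]_m,
    [/\ smooth_path phi,
        forall t : R, t \in `[0, 1] -> diffeomorphism (phi t) &
        forall t : R, t \in `[0, 1] -> pullback_eq (phi t) (w t) (w 0)].

(* The library norm `|x| on row vectors is the sup norm. *)
Definition enorm (u : 'rV[R]_m) : R := Num.sqrt (\sum_i u 0 i ^+ 2).

Definition opnorm (A : 'M[R]_m) : R :=
  sup [set enorm (u *m A) | u in [set u : 'rV[R]_m | enorm u <= 1]].

Definition sphere_norm (r : R) (A : 'rV[R]_m -> 'M[R]_m) : R :=
  sup [set opnorm (A x) | x in [set x : 'rV[R]_m | enorm x = r]].

End Forms.

(* Main.v *)
(* Moser's method.  The derivative s of w_t is closed, and it is enough to find a primitive al of s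
   with |al| <= C r |s|_r on the sphere of radius r: the field X with i_X w = - al is then
   O(r log r), so the Lyapunov function log (1 + log (1 + r^2)) grows at most linearly along its
   trajectories, its flow exists up to time 1, and the flow pulls w_t back to w_0.

   The primitive starts from the Poincaré primitive a of s for the radial contraction; it vanishes
   on radial vectors, but is not bounded by |s|_r.  On a sphere without one pole, integrating a
   along the projections to the sphere of the straight segments from the opposite pole gives a
   function g such that |a - dg| <= C r |s|_r.  Normalize the two functions obtained from the two
   poles to vanish at the same point of the equator.  On a belt around the equator the differential
   of their difference is O(r |s|_r), and since every point of the belt is joined to the base point
   by two quarter circles inside the belt, the difference itself is O(r^2 |s|_r).  A partition of
   unity whose gradient is O(1/r) therefore glues them to a function G, and al = a - dG away from the
   origin. *)
Require Import Defs.
From HB Require Import structures.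
From mathcomp Require Import all_boot all_order all_algebra.
From mathcomp Require Import all_classical all_reals all_analysis.
From mathcomp Require Import ring lra.

Set Implicit Arguments.
Unset Strict Implicit.
Unset Printing Implicit Defensive.

Import Order.TTheory GRing.Theory Num.Theory.
Import numFieldNormedType.Exports.

Local Open Scope classical_set_scope.
Local Open Scope ring_scope.

(** * Partial derivatives on [0, 1] x V, one-sided in time *)

(** The Poincaré primitive at a point of norm r integrates s along the whole ray from the origin, so
    it depends on s on all inner spheres, whereas the hypothesis controls a product of norms on one
    and the same sphere. Correcting it by a gradient can work because the sphere has no first
    cohomology; on a circle the period of a is the flux of s through the disc, which the values of s
    on the circle do not control. The projected segments stay on one sphere, and the term of the
    homotopy formula at their starting point vanishes since a annihilates radial vectors. Their
    derivatives blow up only near the missing pole. The analysis is done for scalar functions on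
    [0, 1] x V, with time as one more direction of differentiation. The time derivative of w then
    commutes with spatial derivatives by the same lemma as two spatial ones do, and compositions,
    integrals with a parameter and flows are all treated by induction on the order of
    differentiability. *)

Section Clamp.
Context {R : realType}.
Implicit Types t : R.

(* Functions on [0, 1] x V are represented by total functions of time; their values outside
   [0, 1] are discarded by precomposing with [clamp01]. *)
Definition clamp01 t : R := Num.max 0 (Num.min 1 t).

Lemma clamp01_itv t : clamp01 t \in `[0, 1].
Proof.
by rewrite in_itv /= /clamp01 le_max lexx /= ge_max ler01 ge_min lexx.
Qed.

Lemma clamp01_id t : t \in `[0, 1] -> clamp01 t = t.
Proof. by rewrite in_itv /= /clamp01 => /andP[t0 t1]; rewrite min_r ?max_r. Qed.

Lemma clamp01_continuous : continuous (@clamp01).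
Proof.
move=> t; apply: (@continuous_max R R (cst 0) (fun t => Num.min 1 t)).
  exact: cst_continuous.
apply: (@continuous_min R R (cst 1) id); first exact: cst_continuous.
exact: cvg_id.
Qed.

End Clamp.

Section Directions.
Context {R : realType} {m : nat}.
Local Notation V := 'rV[R]_m.
Implicit Types (F G : R -> V -> R) (U : set V) (d : option 'I_m) (t h : R).
Implicit Types (x : V) (p : R * V).

Definition evec (i : 'I_m) : V := delta_mx 0 i.

Definition move d h p : R * V :=
  if d is Some i then (p.1, p.2 + h *: evec i) else (p.1 + h, p.2).

Definition at_pair F p : R := F p.1 p.2.

Definition admissible d t : set R :=
  if d is Some _ then setT else [set h | t + h \in `[0, 1]].

(* Carathéodory's form of "v is the partial derivative of F along d". *)
Definition is_pd d F t x (v : R) : Prop :=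
  exists q : R -> R, q h @[h --> within (admissible d t) (nbhs 0)] --> v /\
    forall h, admissible d t h -> at_pair F (move d h (t, x)) = F t x + h * q h.

Definition jcont F t x : Prop :=
  F (clamp01 p.1) p.2 @[p --> ((t, x) : R * V)] --> F (clamp01 t) x.

(* Equal to 0 when the partial derivative does not exist. *)
Definition pd d F t x : R := xget 0 [set v | is_pd d F t x v].

(** At the ends of [0, 1] only one sign of h is admissible in time; stepping forward up to time 1/2
    and backward after it gives a step everywhere. This is what makes one-sided derivatives
    unique. *)
Lemma admissible_small d t e : t \in `[0, 1] -> 0 < e ->
  exists h, [/\ h != 0, `|h| < e & admissible d t h].
Proof.
move=> tI e0; pose k := Num.min (e / 2) (1 / 2).
have k0 : 0 < k by rewrite lt_min !divr_gt0.
have ke : k < e by rewrite gt_min; apply/orP; left; lra.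
have k2 : k <= 1 / 2 by rewrite ge_min lexx orbT.
case: d => [i|] /=.
  by exists k; rewrite gt_eqF // gtr0_norm.
have [t2|t2] := leP t (1 / 2).
  exists k; rewrite gt_eqF // gtr0_norm //; split => //.
  by move: tI; rewrite !in_itv /=; lra.
exists (- k); rewrite oppr_eq0 gt_eqF // normrN gtr0_norm //; split => //.
by move: tI; rewrite !in_itv /=; lra.
Qed.

Lemma is_pd_unique d F t x u v : t \in `[0, 1] ->
  is_pd d F t x u -> is_pd d F t x v -> u = v.
Proof.
move=> tI [q [qu Fq]] [r [rv Fr]].
apply/eqP; rewrite -subr_eq0 -normr_le0; apply/ler_addgt0Pr => e e0.
rewrite add0r.
have e20 : 0 < e / 2 by rewrite divr_gt0.
move/cvgrPdist_lt : qu => /(_ _ e20) Hu; move/cvgrPdist_lt : rv => /(_ _ e20) Hv.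
have /nbhs_ballP[de de0 Hde] : nbhs (0 : R) [set h | admissible d t h ->
    `|u - q h| < e / 2 /\ `|v - r h| < e / 2].
  rewrite !near_withinE in Hu Hv.
  by near=> h => /= ah; split; [apply: (near Hu h)|apply: (near Hv h)].
have [h [h0 hde ah]] := admissible_small d tI de0.
have hb : ball (0 : R) de h by rewrite -ball_normE /= sub0r normrN.
have [] := Hde h hb ah.
have -> : r h = q h.
  by apply: (mulfI h0); apply: (addrI (F t x)); rewrite -Fq // -Fr.
move=> h1 h2; rewrite -(subrKA (q h)) (le_trans (ler_normD _ _)) //.
rewrite (splitr e) lerD // ltW // distrC; exact: h2.
Unshelve. all: by end_near. Qed.

Lemma pdE d F t x v : t \in `[0, 1] -> is_pd d F t x v -> pd d F t x = v.
Proof.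
move=> tI Fv; apply: (is_pd_unique tI _ Fv).
by rewrite /pd; case: xgetP => [y -> //|/(_ v)].
Qed.

Lemma pdP d F t x v : is_pd d F t x v -> is_pd d F t x (pd d F t x).
Proof. by move=> Fv; rewrite /pd; case: xgetP => [y -> //|/(_ v)]. Qed.

Lemma is_pd_cst d (c : R) t x : is_pd d (fun _ _ => c) t x 0.
Proof. by exists (cst 0); split => [|h _]; [exact: cvg_cst|rewrite mulr0 addr0]. Qed.

Lemma is_pdD d F G t x u v : is_pd d F t x u -> is_pd d G t x v ->
  is_pd d (fun t x => F t x + G t x) t x (u + v).
Proof.
move=> [q [qu Fq]] [r [rv Gr]]; exists (fun h => q h + r h); split.
  exact: cvgD.
by move=> h ah; rewrite {1}/at_pair -/(at_pair F _) -/(at_pair G _) Fq // Gr //; ring.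
Qed.

Lemma is_pdN d F t x u : is_pd d F t x u -> is_pd d (fun t x => - F t x) t x (- u).
Proof.
move=> [q [qu Fq]]; exists (fun h => - q h); split; first exact: cvgN.
by move=> h ah; rewrite {1}/at_pair -/(at_pair F _) Fq //; ring.
Qed.

Lemma is_pdB d F G t x u v : is_pd d F t x u -> is_pd d G t x v ->
  is_pd d (fun t x => F t x - G t x) t x (u - v).
Proof. by move=> dF dG; exact: is_pdD dF (is_pdN dG). Qed.

Lemma is_pd_cvg d F t x u : is_pd d F t x u ->
  at_pair F (move d h (t, x)) @[h --> within (admissible d t) (nbhs 0)] --> F t x.
Proof.
move=> [q [qu Fq]].
have : F t x + h * q h @[h --> within (admissible d t) (nbhs 0)] --> F t x + 0 * u.
  apply: cvgD; first exact: cvg_cst.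
  apply: cvgM => //; apply: cvg_within_filter; exact: cvg_id.
rewrite mul0r addr0; apply: cvg_trans; apply: near_eq_cvg.
by rewrite near_withinE; near=> h => ah; rewrite Fq.
Unshelve. all: by end_near. Qed.

Lemma is_pdM d F G t x u v : is_pd d F t x u -> is_pd d G t x v ->
  is_pd d (fun t x => F t x * G t x) t x (u * G t x + F t x * v).
Proof.
move=> Fu Gv; have cG := is_pd_cvg Gv; move: Fu Gv => [q [qu Fq]] [r [rv Gr]].
exists (fun h => q h * at_pair G (move d h (t, x)) + F t x * r h); split.
  by apply: cvgD; apply: cvgM => //; exact: cvg_cst.
move=> h ah; rewrite {1}/at_pair -/(at_pair F _) -/(at_pair G _) Fq // Gr //; ring.
Qed.

Lemma is_pd_comp d (f : R -> R) F t x u v : is_pd d F t x u ->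
  is_derive (F t x) 1 f v -> is_pd d (fun t x => f (F t x)) t x (v * u).
Proof.
move=> Fu /is_derive1_caratheodory[g [fg cg gv]].
have cF := is_pd_cvg Fu; case: Fu => q [qu Fq].
exists (fun h => g (at_pair F (move d h (t, x))) * q h); split.
  apply: cvgM => //; rewrite -gv.
  exact: (@cvg_comp _ _ _ (fun h => at_pair F (move d h (t, x))) g _ _ _ cF cg).
move=> h ah; rewrite {1}/at_pair -/(at_pair F _).
have := fg (at_pair F (move d h (t, x))); rewrite Fq // => fE.
by apply/eqP; rewrite -subr_eq0 opprD addrA fE; apply/eqP; ring.
Qed.

Lemma jcont_cst (c : R) t x : jcont (fun _ _ => c) t x.
Proof. exact: cvg_cst. Qed.

Lemma jcontD F G t x : jcont F t x -> jcont G t x ->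
  jcont (fun t x => F t x + G t x) t x.
Proof. by move=> cF cG; apply: cvgD. Qed.

Lemma jcontM F G t x : jcont F t x -> jcont G t x ->
  jcont (fun t x => F t x * G t x) t x.
Proof. by move=> cF cG; apply: cvgM. Qed.

Lemma jcont_comp (f : R -> R) F t x : jcont F t x ->
  {for F (clamp01 t) x, continuous f} -> jcont (fun t x => f (F t x)) t x.
Proof. by move=> cF cf; apply: (cvg_comp _ _ cF cf). Qed.

Lemma jcont_ext U F G t x : open U -> U x ->
  (forall t x, t \in `[0, 1] -> U x -> F t x = G t x) ->
  jcont F t x -> jcont G t x.
Proof.
move=> oU Ux FG; rewrite /jcont -FG //; last exact: clamp01_itv.
apply: cvg_trans; apply: near_eq_cvg.
have : \forall p \near (t, x), U p.2.
  have cs : (p.2 : V) @[p --> ((t, x) : R * V)] --> x by exact: cvg_snd.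
  exact: (cs U (open_nbhs_nbhs (conj oU Ux))).
by apply: filterS => p Up; rewrite FG //; exact: clamp01_itv.
Qed.

Lemma move_continuous d p : continuous (fun h => move d h p).
Proof.
move=> h; case: p => t x; case: d => [i|] /=.
  apply: (@cvg_pair _ _ _ (nbhs h) (nbhs t) (nbhs _)); first exact: cvg_cst.
  by apply: cvgD; [exact: cvg_cst|by apply: cvgZr_tmp; exact: cvg_id].
apply: (@cvg_pair _ _ _ (nbhs h) (nbhs _) (nbhs x)); last exact: cvg_cst.
by apply: cvgD; [exact: cvg_cst|exact: cvg_id].
Qed.

Lemma move0 d p : move d 0 p = p.
Proof. by case: p => t x; case: d => [i|] /=; rewrite ?scale0r ?addr0. Qed.

Lemma move_cvg d p : move d h p @[h --> (0 : R)] --> p.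
Proof. by have := @move_continuous d p 0; rewrite /continuous_at move0. Qed.

Lemma move_time d h t x : t \in `[0, 1] -> admissible d t h ->
  (move d h (t, x)).1 \in `[0, 1].
Proof. by case: d. Qed.

Lemma moveD d h k p : move d (h + k) p = move d k (move d h p).
Proof. by case: d => [i|]; rewrite /move /= ?addrA // scalerDl addrA. Qed.

Lemma moveC d e h k p : move d h (move e k p) = move e k (move d h p).
Proof. by case: d => [i|]; case: e => [j|]; rewrite /move //= addrAC. Qed.

Lemma is_pd_ext U d F G t x v : open U -> U x -> t \in `[0, 1] ->
  (forall t x, t \in `[0, 1] -> U x -> F t x = G t x) ->
  is_pd d F t x v -> is_pd d G t x v.
Proof.
move=> oU Ux tI FG [q [qv Fq]].
pose P h := U (move d h (t, x)).2.
have nP : \forall h \near 0, P h.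
  have : (move d h (t, x)).2 @[h --> (0 : R)] --> x.
    by apply: (cvg_comp _ _ (@move_cvg d (t, x))); exact: cvg_snd.
  by move=> /(_ U (open_nbhs_nbhs (conj oU Ux))).
(* Only small h keep the point in U. Elsewhere the factor is the plain difference quotient of G, so
   that the factorization holds for every admissible h while the limit at 0 is that of q. *)
exists (fun h => if `[< P h >] then q h else (at_pair G (move d h (t, x)) - G t x) / h).
split.
  apply: cvg_trans qv; apply: near_eq_cvg; apply: cvg_within.
  by near do [rewrite asboolT //].
move=> h ah; case: asboolP => Ph.
  by rewrite -FG // -Fq // /at_pair FG //; exact: move_time.
have h0 : h != 0.
  apply: contra_notN Ph => /eqP ->; rewrite /P.
  by case: (d) => [i|] /=; rewrite ?scale0r ?addr0.
by rewrite mulrC divfK // subrKC.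
Unshelve. all: by end_near. Qed.

(** Where every small increment is admissible, in space or at interior times, the one-sided notion
    becomes an ordinary derivative, and the usual mean value theorem can be applied. *)
Lemma is_pd_is_derive d F t x h v :
  (\forall k \near 0, admissible d (move d h (t, x)).1 k) ->
  is_pd d F (move d h (t, x)).1 (move d h (t, x)).2 v ->
  is_derive h 1 (fun s => at_pair F (move d s (t, x))) v.
Proof.
move=> na [q [qv Fq]].
have qv' : q k @[k --> (0 : R)] --> v.
  move=> A nA; have nq : \forall k \near (0 : R), admissible d (move d h (t, x)).1 k -> A (q k).
    exact: (qv A nA).
  by apply: filterS2 na nq => k ak; apply.
have H : (fun k : R => k^-1 *: (((fun s => at_pair F (move d s (t, x))) \o shift h) (k *: 1)
     - at_pair F (move d h (t, x)))) @ 0^' --> v.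
  apply: cvg_trans (@cvg_within_filter _ _ _ _ _ _ [set k : R | k != 0] qv').
  apply: near_eq_cvg; rewrite near_withinE; near=> k => k0.
  rewrite /= /GRing.scale /= mulr1 (addrC k h) moveD.
  have ak : admissible d (move d h (t, x)).1 k by near: k.
  have := Fq k ak; rewrite -surjective_pairing => ->.
  by rewrite /at_pair addrAC subrr add0r mulKf.
by split; [apply/cvg_ex; exists v|apply/cvg_lim].
Unshelve. all: by end_near. Qed.

End Directions.

(** * Calculus of C^k functions on [0, 1] x U *)

Section Smoothness.
Context {R : realType} {m : nat}.
Local Notation V := 'rV[R]_m.
Implicit Types (F G : R -> V -> R) (U : set V) (d : option 'I_m) (t h : R).
Implicit Types (x : V) (p : R * V) (k : nat).

Lemma is_derive_scale (c : R -> R) (h s v : R) :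
  is_derive (s * h) 1 c v -> is_derive s 1 (fun s => c (s * h)) (h * v).
Proof.
move=> cv; have H : is_derive s 1 (fun s : R => s * h) h.
  have -> : (fun s : R => s * h) = h \*: (@idfun R).
    by apply/funext => u /=; rewrite mulrC.
  by apply: is_derive_eq; rewrite /GRing.scale /= mulr1.
by have := @is_derive1_comp R c (fun s => s * h) s v h cv H; rewrite mulrC.
Qed.

(** These are the two assumptions of the mean value theorem for F on the segment from (t, x) to its
    translate. Derivatives are claimed only at interior parameters: the segment may end at time 0 or
    1, where F has only a one-sided derivative in time. *)
Lemma pd_line d F (D : R -> V -> R) t x h : t \in `[0, 1] -> h != 0 -> admissible d t h ->
  (forall s, s \in `[0, 1] -> jcont F (move d (s * h) (t, x)).1 (move d (s * h) (t, x)).2) ->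
  (forall s, s \in `[0, 1] -> is_pd d F (move d (s * h) (t, x)).1 (move d (s * h) (t, x)).2
     (at_pair D (move d (s * h) (t, x)))) ->
  {within `[0, 1], continuous (fun s => at_pair F (move d (s * h) (t, x)))} /\
  forall s : R, s \in `]0, 1[ -> is_derive s 1 (fun s => at_pair F (move d (s * h) (t, x)))
    (h * at_pair D (move d (s * h) (t, x))).
Proof.
move=> tI h0 ah cF dF.
have as_ s : s \in `[0, 1] -> admissible d t (s * h).
  case: (d) ah => [i|] //=; rewrite !in_itv /= in tI * => /andP[? ?] /andP[? ?].
  by move: tI => /andP[? ?]; apply/andP; split; nra.
pose c s := at_pair F (move d s (t, x)); split.
  have eqc s : s \in `[0, 1] -> c (s * h) =
      F (clamp01 (move d (s * h) (t, x)).1) (move d (s * h) (t, x)).2.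
    by move=> sI; rewrite clamp01_id //; exact: (move_time _ tI (as_ _ sI)).
  apply/subspace_continuousP => s sI.
  suff : c (u * h) @[u --> within [set` `[0, 1]] (nbhs s)] --> c (s * h) by [].
  rewrite eqc //.
  have : F (clamp01 (move d (u * h) (t, x)).1) (move d (u * h) (t, x)).2
     @[u --> s] --> F (clamp01 (move d (s * h) (t, x)).1) (move d (s * h) (t, x)).2.
    apply: (@cvg_comp _ _ _ (fun u => move d (u * h) (t, x))
      (fun p => F (clamp01 p.1) p.2) _ (nbhs (move d (s * h) (t, x)))).
      apply: (@cvg_comp _ _ _ (fun u => u * h) (fun u => move d u (t, x)) _ (nbhs (s * h))).
        by apply: cvgM; [exact: cvg_id|exact: cvg_cst].
      exact: move_continuous.
    by have := cF s sI; rewrite /jcont -surjective_pairing.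
  move=> H; apply: cvg_trans (@cvg_within_filter _ _ _ _ _ _ [set` `[0, 1]] H).
  by apply: near_eq_cvg; rewrite near_withinE; near=> u => /= uI; rewrite -eqc.
move=> s s01; apply: (@is_derive_scale c).
have sI : s \in `[0, 1] by apply: subset_itv_oo_cc.
apply: is_pd_is_derive; last exact: dF.
case: (d) ah => [i|] ah; first exact: (@filterE _ _ (nbhs_filter (0 : R))).
have : t + s * h \in `]0, 1[.
  have {}ah : t + h \in `[0, 1] by exact: ah.
  move: s01 tI ah; rewrite !in_itv /= => /andP[s0 s1] /andP[t0 t1] /andP[t2 t3].
  move: h0; rewrite neq_lt => /orP[h0|h0]; apply/andP.
  - have : s * h < 0 by rewrite pmulr_rlt0.
    have : 1 * h < s * h by rewrite ltr_nM2r.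
    by rewrite mul1r => ? ?; split; lra.
  - have : 0 < s * h by rewrite mulr_gt0.
    have : s * h < 1 * h by rewrite ltr_pM2r.
    by rewrite mul1r => ? ?; split; lra.
move=> tsI; have : \forall u \near (t + s * h), u \in `]0, 1[.
  have := @near_in_itvoo R 0 1 (t + s * h) tsI.
  exact: filterS.
rewrite (near_shift 0) /= => H; apply: filterS H => k.
by rewrite /= subr0 addrC => /subset_itv_oo_cc.
Unshelve. all: by end_near. Qed.

Lemma pd_mvt d F (D : R -> V -> R) t x h : t \in `[0, 1] -> admissible d t h ->
  (forall s, s \in `[0, 1] -> jcont F (move d (s * h) (t, x)).1 (move d (s * h) (t, x)).2) ->
  (forall s, s \in `[0, 1] -> is_pd d F (move d (s * h) (t, x)).1 (move d (s * h) (t, x)).2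
     (at_pair D (move d (s * h) (t, x)))) ->
  exists2 s, s \in `[0, 1] &
    at_pair F (move d h (t, x)) - F t x = h * at_pair D (move d (s * h) (t, x)).
Proof.
move=> tI ah cF dF.
have [->|h0] := eqVneq h 0.
  exists 0; first by rewrite in_itv /= lexx ler01.
  by rewrite move0 /at_pair /= subrr mul0r.
have [cc dc] := pd_line tI h0 ah cF dF.
have [s sI] := MVT_segment ler01 dc cc.
rewrite mul1r mul0r subr0 mulr1 => E.
by exists s => //; rewrite -E move0.
Qed.

(* C^k on [0, 1] x U: partial derivatives of order at most k exist in all directions, time
   included, and are jointly continuous. *)
Fixpoint ck U k F : Prop :=
  (forall t x, U x -> jcont F t x) /\
  if k is k'.+1 then
    forall d, (forall t x, t \in `[0, 1] -> U x -> is_pd d F t x (pd d F t x)) /\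
      ck U k' (pd d F)
  else True.

Definition smooth_on U F := forall k, ck U k F.

Lemma ck_jcont U k F t x : ck U k F -> U x -> jcont F t x.
Proof. by case: k => [|k] [cF _] Ux; exact: cF. Qed.

Lemma ck_is_pd U k F d t x : ck U k.+1 F -> t \in `[0, 1] -> U x ->
  is_pd d F t x (pd d F t x).
Proof. by move=> [_ /(_ d)[dF _]]; exact: dF. Qed.

Lemma ck_pd U k F d : ck U k.+1 F -> ck U k (pd d F).
Proof. by move=> [_ /(_ d)[]]. Qed.

Lemma smooth_pd U F d : smooth_on U F -> smooth_on U (pd d F).
Proof. by move=> sF k; exact: ck_pd (sF k.+1). Qed.

Lemma smooth_is_pd U F d t x : smooth_on U F -> t \in `[0, 1] -> U x ->
  is_pd d F t x (pd d F t x).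
Proof. by move=> sF; exact: ck_is_pd (sF 1%N). Qed.

Lemma smooth_jcont U F t x : smooth_on U F -> U x -> jcont F t x.
Proof. by move=> sF; exact: ck_jcont (sF 0%N). Qed.

Lemma ckS U k F : ck U k.+1 F -> ck U k F.
Proof.
elim: k F => [|k IH] F [cF dF]; split => //.
by move=> d; have [iF kF] := dF d; split => //; exact: IH.
Qed.

Lemma ck_le U j k F : (j <= k)%N -> ck U k F -> ck U j F.
Proof.
by elim: k => [|k IH]; [case: j|rewrite leq_eqVlt => /predU1P[->//|jk] /ckS; exact: IH].
Qed.

Lemma ck_sub U U' k F : U' `<=` U -> ck U k F -> ck U' k F.
Proof.
move=> UU; elim: k F => [|k IH] F [cF dF]; split => //.
- by move=> t x /UU; exact: cF.
- by move=> t x /UU; exact: cF.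
- move=> d; have [iF kF] := dF d; split; last exact: IH.
  by move=> t x tI /UU; exact: iF.
Qed.

Lemma ck_ext U k F G : open U ->
  (forall t x, t \in `[0, 1] -> U x -> F t x = G t x) -> ck U k F -> ck U k G.
Proof.
move=> oU; elim: k F G => [|k IH] F G FG [cF dF]; split => //.
- by move=> t x Ux; exact: (jcont_ext oU Ux FG (cF t x Ux)).
- by move=> t x Ux; exact: (jcont_ext oU Ux FG (cF t x Ux)).
- have dG d t x : t \in `[0, 1] -> U x -> is_pd d G t x (pd d F t x).
    by move=> tI Ux; exact: (is_pd_ext oU Ux tI FG ((dF d).1 t x tI Ux)).
  move=> d; split; first by move=> t x tI Ux; exact: pdP (dG d t x tI Ux).
  apply: (IH (pd d F)); last exact: (dF d).2.
  by move=> t x tI Ux; rewrite (pdE tI (dG d t x tI Ux)).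
Qed.

(** As [pd] is defined by choice, its values are known only through uniqueness. Here regularity
    follows from explicit formulas [D] for the partial derivatives, which is how most inductions on
    k below run. *)
Lemma ck_intro U k F (D : option 'I_m -> R -> V -> R) : open U ->
  (forall t x, U x -> jcont F t x) ->
  (forall d t x, t \in `[0, 1] -> U x -> is_pd d F t x (D d t x)) ->
  (forall d, ck U k (D d)) -> ck U k.+1 F.
Proof.
move=> oU cF dF kD; split => // d; split.
  by move=> t x tI Ux; exact: pdP (dF d t x tI Ux).
apply: (ck_ext oU _ (kD d)) => t x tI Ux.
by rewrite (pdE tI (dF d t x tI Ux)).
Qed.

(** Regularity is local in space; this serves to glue functions given by different formulas on an
    open cover. *)
Lemma ck_near U k F : open U ->
  (forall x, U x -> exists U', [/\ open U', U' x & ck U' k F]) -> ck U k F.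
Proof.
move=> oU; elim: k F => [|k IH] F H; split => //.
- by move=> t x /H[U' [_ U'x [cF _]]]; exact: cF.
- by move=> t x /H[U' [_ U'x [cF _]]]; exact: cF.
- move=> d; split.
    by move=> t x tI /H[U' [_ U'x kF]]; exact: (ck_is_pd d kF tI U'x).
  by apply: IH => x /H[U' [oU' U'x kF]]; exists U'; split => //; exact: ck_pd.
Qed.

Lemma ck_cst U k (c : R) : open U -> ck U k (fun _ _ => c).
Proof.
move=> oU; elim: k c => [|k IH] c.
  by split => // t x _; exact: jcont_cst.
apply: (@ck_intro _ _ _ (fun _ _ _ => 0)) => //.
- by move=> t x _; exact: jcont_cst.
- by move=> d t x _ _; exact: is_pd_cst.
Qed.

Lemma ckD U k F G : open U -> ck U k F -> ck U k G -> ck U k (fun t x => F t x + G t x).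
Proof.
move=> oU; elim: k F G => [|k IH] F G kF kG.
  split => // t x Ux; apply: jcontD; [exact: ck_jcont kF Ux|exact: ck_jcont kG Ux].
apply: (@ck_intro _ _ _ (fun d t x => pd d F t x + pd d G t x)) => //.
- by move=> t x Ux; apply: jcontD; [exact: ck_jcont kF Ux|exact: ck_jcont kG Ux].
- by move=> d t x tI Ux; apply: is_pdD; [exact: ck_is_pd kF tI Ux|exact: ck_is_pd kG tI Ux].
- by move=> d; apply: IH; exact: ck_pd.
Qed.

Lemma ckM U k F G : open U -> ck U k F -> ck U k G -> ck U k (fun t x => F t x * G t x).
Proof.
move=> oU; elim: k F G => [|k IH] F G kF kG.
  split => // t x Ux; apply: jcontM; [exact: ck_jcont kF Ux|exact: ck_jcont kG Ux].
apply: (@ck_intro _ _ _ (fun d t x => pd d F t x * G t x + F t x * pd d G t x)) => //.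
- by move=> t x Ux; apply: jcontM; [exact: ck_jcont kF Ux|exact: ck_jcont kG Ux].
- by move=> d t x tI Ux; apply: is_pdM; [exact: ck_is_pd kF tI Ux|exact: ck_is_pd kG tI Ux].
- by move=> d; apply: ckD => //; apply: IH; do ?[exact: ck_pd|exact: ckS].
Qed.

Lemma ckZ U k (c : R) F : open U -> ck U k F -> ck U k (fun t x => c * F t x).
Proof. by move=> oU kF; apply: ckM => //; exact: ck_cst. Qed.

Lemma ckN U k F : open U -> ck U k F -> ck U k (fun t x => - F t x).
Proof.
move=> oU kF; apply: (ck_ext oU _ (ckZ (-1) oU kF)) => t x _ _; exact: mulN1r.
Qed.

Lemma ckB U k F G : open U -> ck U k F -> ck U k G -> ck U k (fun t x => F t x - G t x).
Proof. by move=> oU kF kG; apply: ckD => //; exact: ckN. Qed.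

Lemma ck_sum U k (I : Type) (r : seq I) (P : pred I) (F : I -> R -> V -> R) :
  open U -> (forall i, P i -> ck U k (F i)) ->
  ck U k (fun t x => \sum_(i <- r | P i) F i t x).
Proof.
move=> oU kF; elim: r => [|a r IH].
  by apply: (ck_ext oU _ (ck_cst k 0 oU)) => t x _ _; rewrite big_nil.
case Pa: (P a); last first.
  by apply: (ck_ext oU _ IH) => t x _ _; rewrite big_cons Pa.
by apply: (ck_ext oU _ (ckD oU (kF a Pa) IH)) => t x _ _; rewrite big_cons Pa.
Qed.

Lemma ck_prod U k (I : Type) (r : seq I) (P : pred I) (F : I -> R -> V -> R) :
  open U -> (forall i, P i -> ck U k (F i)) ->
  ck U k (fun t x => \prod_(i <- r | P i) F i t x).
Proof.
move=> oU kF; elim: r => [|a r IH].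
  by apply: (ck_ext oU _ (ck_cst k 1 oU)) => t x _ _; rewrite big_nil.
case Pa: (P a); last first.
  by apply: (ck_ext oU _ IH) => t x _ _; rewrite big_cons Pa.
by apply: (ck_ext oU _ (ckM oU (kF a Pa) IH)) => t x _ _; rewrite big_cons Pa.
Qed.

(** The derivative is quantified existentially because its values outside [O] are irrelevant; [O] is
    the domain on which division or square root is smooth. *)
Fixpoint ck_real (O : set R) k (f : R -> R) : Prop :=
  (forall u, O u -> {for u, continuous f}) /\
  if k is k'.+1 then
    exists f', (forall u, O u -> is_derive u 1 f (f' u)) /\ ck_real O k' f'
  else True.

Lemma ck_real_continuous O k f u : ck_real O k f -> O u -> {for u, continuous f}.
Proof. by case: k => [|k] [cf _]; exact: cf. Qed.

Lemma ck_comp1 U O k f F : open U -> ck_real O k f -> ck U k F ->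
  (forall t x, t \in `[0, 1] -> U x -> O (F t x)) -> ck U k (fun t x => f (F t x)).
Proof.
move=> oU kf kF OF.
have cfF t x : U x -> jcont (fun t x => f (F t x)) t x.
  move=> Ux; apply: jcont_comp; first exact: ck_jcont kF Ux.
  by apply: ck_real_continuous kf _; apply: OF => //; exact: clamp01_itv.
elim: k f F kf kF OF cfF => [|k IH] f F kf kF OF cfF; first by split.
have [_ [f' [df kf']]] := kf.
have cf' t x : U x -> jcont (fun t x => f' (F t x)) t x.
  move=> Ux; apply: jcont_comp; first exact: ck_jcont kF Ux.
  by apply: ck_real_continuous kf' _; apply: OF => //; exact: clamp01_itv.
apply: (@ck_intro _ _ _ (fun d t x => f' (F t x) * pd d F t x)) => //.
- move=> d t x tI Ux; apply: is_pd_comp; first exact: ck_is_pd kF tI Ux.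
  exact/df/OF.
- move=> d; apply: ckM => //; last exact: ck_pd.
  by apply: IH => //; exact: ckS.
Qed.

Lemma is_pd_coord d (j : 'I_m) t x :
  is_pd d (fun _ x => x 0 j) t x (d == Some j)%:R.
Proof.
exists (cst (d == Some j)%:R); split => [|h _]; first exact: cvg_cst.
case: d => [i|]; rewrite /at_pair /= ?mulr0 ?addr0 // !mxE eqxx /= eq_sym.
by congr (_ + _ * _%:R); congr nat_of_bool; apply/eqP/eqP => [->|[->]].
Qed.

Lemma jcont_coord (j : 'I_m) t x : jcont (fun _ x => x 0 j) t x.
Proof.
apply: (@cvg_comp _ _ _ (fun p : R * V => p.2) (fun x : V => x 0 j) _ (nbhs x)).
  exact: cvg_snd.
exact: coord_continuous.
Qed.

Lemma ck_coord U k (j : 'I_m) : open U -> ck U k (fun _ x => x 0 j).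
Proof.
move=> oU; case: k => [|k]; first by split => // t x _; exact: jcont_coord.
apply: (@ck_intro _ _ _ (fun d _ _ => (d == Some j)%:R)) => //.
- by move=> t x _; exact: jcont_coord.
- by move=> d t x _ _; exact: is_pd_coord.
- by move=> d; exact: ck_cst.
Qed.

End Smoothness.

(** * Differentiability and the chain rule *)

Section RowConvergence.
Context {R : realType} {T : Type}.

Lemma cvg_row n (A : set_system T) {FA : Filter A} (g : T -> 'rV[R]_n) (l : 'rV[R]_n) :
  (forall j, g x 0 j @[x --> A] --> l 0 j) -> g x @[x --> A] --> l.
Proof.
move=> gl; apply/cvg_ballP => e e0.
have H : \forall x \near A, forall j, ball (l 0 j) e (g x 0 j).
  by apply: filter_forall => j; exact: ((cvg_ballP _ _).1 (gl j) e e0).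
by apply: filterS H => x Hx; split => // i j; rewrite !ord1.
Qed.

Lemma cvg_sum (A : set_system T) {FA : Filter A} (I : Type) (r : seq I) (P : pred I)
    (f : I -> T -> R) (l : I -> R) : (forall i, P i -> f i x @[x --> A] --> l i) ->
  \sum_(i <- r | P i) f i x @[x --> A] --> \sum_(i <- r | P i) l i.
Proof.
move=> fl; elim: r => [|a r IH].
  by under eq_fun do rewrite big_nil; rewrite big_nil; exact: cvg_cst.
under eq_fun do rewrite big_cons; rewrite big_cons; case Pa: (P a) => //.
by apply: cvgD => //; exact: fl.
Qed.

End RowConvergence.

Section Expansion.
Context {R : realType} {m : nat}.
Local Notation V := 'rV[R]_m.
Implicit Types (F G : R -> V -> R) (U : set V) (d : option 'I_m) (t h : R).
Implicit Types (x y : V) (p : R * V) (k : nat).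

Definition times01 : set (R * V) := [set p | p.1 \in `[0, 1]].

Definition splice y (k : nat) x : V := \row_i (if (i < k)%N then x 0 i else y 0 i).

Lemma spliceS y (j : 'I_m) x :
  splice y j.+1 x = splice y j x + (x 0 j - y 0 j) *: evec j.
Proof.
apply/rowP => i; rewrite !mxE ltnS leq_eqVlt eqxx /= -val_eqE /=.
case: (eqVneq (i : nat) j) => [ij|_] /=; last by rewrite mulr0 addr0.
have -> : i = j by apply: val_inj.
by rewrite ltnn mulr1 subrKC.
Qed.

(* Difference quotients along the broken line from [(t, y)] to [p] that moves one coordinate at a
   time; they are continuous at [(t, y)], which yields total differentiability and the chain rule. *)
Definition increment F t y d p : R :=
  if d is Some j then
    if p.2 0 j == y 0 j then pd (Some j) F t y
    else (F p.1 (splice y j.+1 p.2) - F p.1 (splice y j p.2)) / (p.2 0 j - y 0 j)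
  else if p.1 == t then pd None F t y else (F p.1 y - F t y) / (p.1 - t).

(** The identity is exact and needs no regularity: the value chosen by [increment] at a vanishing
    step is multiplied by zero, and the other terms telescope along the broken line. *)
Lemma incrementE F t y p : at_pair F p - F t y =
  (p.1 - t) * increment F t y None p +
  \sum_j (p.2 0 j - y 0 j) * increment F t y (Some j) p.
Proof.
have -> : (p.1 - t) * increment F t y None p = F p.1 y - F t y.
  rewrite /=; case: eqVneq => [->|pt]; first by rewrite !subrr mul0r.
  by rewrite mulrC divfK // subr_eq0.
have -> : \sum_j (p.2 0 j - y 0 j) * increment F t y (Some j) p =
  \sum_(j < m) (F p.1 (splice y j.+1 p.2) - F p.1 (splice y j p.2)).
  apply: eq_bigr => j _ /=; case: eqVneq => [py|py].
    by rewrite spliceS py subrr scale0r addr0 subrr mul0r.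
  by rewrite mulrC divfK // subr_eq0.
rewrite -(big_mkord predT (fun j => F p.1 (splice y j.+1 p.2) - F p.1 (splice y j p.2))).
rewrite telescope_sumr //.
have -> : splice y 0 p.2 = y by apply/rowP => i; rewrite mxE.
have -> : splice y m p.2 = p.2 by apply/rowP => i; rewrite mxE ltn_ord.
by rewrite /at_pair; ring.
Qed.

(** The mean value theorem turns each quotient into a partial derivative at an intermediate point of
    the broken line. Balls of the sup norm are products, so these points stay in the ball around (t,
    y) that contains the end point. *)
Lemma increment_cvg U F t y d : open U -> ck U 1 F -> t \in `[0, 1] -> U y ->
  increment F t y d p @[p --> within times01 (nbhs ((t, y) : R * V))] --> pd d F t y.
Proof.
move=> oU kF tI Uy; apply/cvgrPdist_le => e e0.
have cp : jcont (pd d F) t y by exact: (@ck_jcont _ _ U 0 _ t y (ck_pd d kF) Uy).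
have H1 : \forall p \near ((t, y) : R * V),
    `|pd d F t y - pd d F (clamp01 p.1) p.2| <= e.
  by move: cp; rewrite /jcont (clamp01_id tI) => /cvgrPdist_le /(_ e e0).
have H2 : \forall p \near ((t, y) : R * V), U p.2.
  have cs : (p.2 : V) @[p --> ((t, y) : R * V)] --> y by exact: cvg_snd.
  exact: (cs U (open_nbhs_nbhs (conj oU Uy))).
have [r /= r0 Hr] : nbhs_ball ((t, y) : R * V)
    [set p | `|pd d F t y - pd d F (clamp01 p.1) p.2| <= e /\ U p.2].
  by apply/nbhs_ballP; exact: filterI H1 H2.
rewrite near_withinE; apply/nbhs_ballP; exists r => //= p [pt py] pI.
have yr s i : s \in `[0, 1] -> ball (y 0 i) r (y 0 i + s * (p.2 0 i - y 0 i)).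
  rewrite in_itv /= => /andP[s0 s1]; have := py.2 0 i.
  rewrite -!ball_normE /= => py'.
  rewrite opprD addrA subrr sub0r normrN normrM (ger0_norm s0) -normrN opprB.
  by apply: le_lt_trans py'; rewrite ler_piMl.
have tr s : s \in `[0, 1] -> ball t r (t + s * (p.1 - t)).
  rewrite in_itv /= => /andP[s0 s1]; move: pt.
  rewrite -!ball_normE /= => pt'.
  rewrite opprD addrA subrr sub0r normrN normrM (ger0_norm s0) -normrN opprB.
  by apply: le_lt_trans pt'; rewrite ler_piMl.
case: d cp H1 Hr => [j|] _ _ Hr /=.
  case: eqVneq => [_|pyj]; first by rewrite subrr normr0 ltW.
  have inb s : s \in `[0, 1] ->
      ball ((t, y) : R * V) r (p.1, splice y j p.2 + (s * (p.2 0 j - y 0 j)) *: evec j).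
    move=> sI; split => //=; split => // i0 i; rewrite ord1 !mxE eqxx /= eq_sym.
    case: (eqVneq j i) => [<-|ji]; first by rewrite ltnn mulr1; exact: yr.
    rewrite mulr0 addr0; case: ifP => _; first exact: py.2.
    exact: ballxx.
  have [||s sI] := @pd_mvt R m (Some j) F (pd (Some j) F) p.1 (splice y j p.2)
    (p.2 0 j - y 0 j) pI I.
  - by move=> s /inb /Hr[_ Us]; exact: (ck_jcont kF Us).
  - by move=> s /inb /Hr[_ Us]; exact: (ck_is_pd (Some j) kF pI Us).
  rewrite /at_pair /= -spliceS => ->; rewrite mulrC mulKf ?subr_eq0 //.
  by have [] := Hr _ (inb s sI); rewrite /= clamp01_id.
case: eqVneq => [_|ptt]; first by rewrite subrr normr0 ltW.
have inb s : s \in `[0, 1] -> ball ((t, y) : R * V) r (t + s * (p.1 - t), y).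
  by move=> sI; split; [exact: tr|exact: ballxx].
have tsI s : s \in `[0, 1] -> t + s * (p.1 - t) \in `[0, 1].
  move: tI pI; rewrite /times01 /= !in_itv /=.
  by move=> /andP[? ?] /andP[? ?] /andP[? ?]; apply/andP; split; nra.
have [|||s sI] := @pd_mvt R m None F (pd None F) t y (p.1 - t) tI.
- by rewrite /admissible /= subrKC.
- by move=> s /inb /Hr[_ Us]; exact: (ck_jcont kF Us).
- by move=> s sI; have /Hr[_ Us] := inb s sI; apply: (ck_is_pd None kF _ Us); exact: tsI.
rewrite /at_pair /= subrKC => ->; rewrite mulrC mulKf ?subr_eq0 //.
by have [] := Hr _ (inb s sI); rewrite /= clamp01_id // tsI.
Qed.

End Expansion.

Section Differential.
Context {R : realType} {m : nat}.
Local Notation V := 'rV[R]_m.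

Definition linear_form (c : 'I_m -> R) (v : V) : R := \sum_j v 0 j * c j.

Fact linear_form_is_linear c : linear (linear_form c).
Proof.
move=> a u v; rewrite /linear_form /GRing.scale /= mulr_sumr -big_split /=.
by apply: eq_bigr => j _; rewrite !mxE mulrDl mulrA.
Qed.

HB.instance Definition _ c :=
  GRing.isLinear.Build R V R _ (linear_form c) (linear_form_is_linear c).

Lemma linear_form_continuous c : continuous (linear_form c).
Proof.
move=> v; apply: (@cvg_sum _ _ (nbhs v) (nbhs_filter v)) => j _.
apply: (@cvgM _ _ _ (nbhs_filter v)); last exact: cvg_cst.
exact: coord_continuous.
Qed.

Lemma mx_norm_coord (v : V) j : `|v 0 j| <= `|v|.
Proof.
by rewrite [leRHS]/Num.Def.normr /= mx_normrE (le_bigmax _ (fun i => `|v i.1 i.2|) (0, j)).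
Qed.

Lemma ck_differentiable U (F : R -> V -> R) t x : open U -> ck U 1 F ->
  t \in `[0, 1] -> U x ->
  differentiable (F t) x /\ 'd (F t) x = linear_form (fun j => pd (Some j) F t x) :> (V -> R).
Proof.
move=> oU kF tI Ux; set L := linear_form _.
have H : F t \o shift x = cst (F t x) + L +o_ (0 : V) id.
  apply/eqaddoP => _/posnumP[e].
  (* The tolerance is shared among the m coordinates; dividing by m + 1 also covers m = 0. *)
  have e0 : 0 < e%:num / m.+1%:R by rewrite divr_gt0.
  have c0 : forall j, \forall v \near (0 : V),
      `|pd (Some j) F t x - increment F t x (Some j) (t, v + x)| <= e%:num / m.+1%:R.
    move=> j.
    have : increment F t x (Some j) (t, v + x) @[v --> (0 : V)] --> pd (Some j) F t x.
      apply: (@cvg_comp _ _ _ (fun v : V => (t, v + x)) (increment F t x (Some j)) _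
        (within times01 (nbhs ((t, x) : R * V)))); last exact: increment_cvg kF tI Ux.
      have H : (t, v + x) @[v --> (0 : V)] --> ((t, x) : R * V).
        apply: (@cvg_pair _ _ _ (nbhs (0 : V)) (nbhs t) (nbhs x)); first exact: cvg_cst.
        have : continuous (fun v : V => v + x).
          by move=> v; apply: continuousD; [exact: cvg_id|exact: cst_continuous].
        by move=> /(_ 0); rewrite /continuous_at add0r.
      move=> A wA.
      have {}H : \forall v \near (0 : V), times01 (t, v + x) -> A (t, v + x) by exact: (H _ wA).
      by apply: (@filterS _ (nbhs (0 : V)) (nbhs_filter _) _ _ _ H) => v; apply.
    by move=> /cvgrPdist_le; exact.
  have {}c0 : \forall v \near (0 : V), forall j,
      `|pd (Some j) F t x - increment F t x (Some j) (t, v + x)| <= e%:num / m.+1%:R.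
    exact: (@filter_forall _ _ _ (nbhs (0 : V)) (nbhs_filter _) c0).
  apply: (@filterS _ (nbhs (0 : V)) (nbhs_filter _) _ _ _ c0) => v Hv.
  rewrite !fctE /= opprD addrA.
  have -> : F t (v + x) - F t x = \sum_j v 0 j * increment F t x (Some j) (t, v + x).
    have := incrementE F t x (t, v + x); rewrite /at_pair /= subrr mul0r add0r => ->.
    by apply: eq_bigr => j _; rewrite mxE addrK.
  rewrite /L /linear_form -sumrB (le_trans (ler_norm_sum _ _ _)) //.
  have : \sum_(j < m) (e%:num / m.+1%:R * `|v|) <= e%:num * `|v|.
    rewrite sumr_const card_ord -[_ *+ m]mulr_natr -!mulrA ler_pM2l //.
    by rewrite ler_pdivrMl ?ltr0n // mulrC ler_wpM2r // ler_nat.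
  apply: le_trans; apply: ler_sum => j _.
  rewrite -mulrBr normrM mulrC distrC.
  by apply: ler_pM => //; exact: mx_norm_coord.
have cL : continuous L by exact: linear_form_continuous.
have E := diff_unique cL H; split => //.
by apply/diff_locallyP; rewrite E; split.
Qed.

Lemma ck_derive U (F : R -> V -> R) t x v : open U -> ck U 1 F ->
  t \in `[0, 1] -> U x -> 'D_v (F t) x = \sum_j v 0 j * pd (Some j) F t x.
Proof.
move=> oU kF tI Ux; have [dF E] := ck_differentiable oU kF tI Ux.
by rewrite deriveE // E.
Qed.

Lemma is_derive_line U (F : R -> V -> R) t x v (s : R) : open U -> ck U 1 F ->
  t \in `[0, 1] -> U (x + s *: v) ->
  is_derive s 1 (fun s => F t (x + s *: v)) (\sum_j v 0 j * pd (Some j) F t (x + s *: v)).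
Proof.
move=> oU kF tI Ux; rewrite -(ck_derive _ oU kF tI Ux).
have [dF _] := ck_differentiable oU kF tI Ux.
have := diff_derivable (v := v) dF; rewrite /derivable => dv.
have E : (fun h : R => h^-1 *: (((fun s => F t (x + s *: v)) \o shift s) (h *: 1) - F t (x + s *: v)))
  = (fun h => h^-1 *: ((F t \o shift (x + s *: v)) (h *: v) - F t (x + s *: v))).
  apply/funext => h /=; congr (_ *: (F t _ - _)).
  by rewrite (_ : h *: (1 : R) = h) ?scalerDl 1?addrCA //; exact: mulr1.
by split; rewrite /derivable /derive E.
Qed.

End Differential.

Section Composition.
Context {R : realType} {m n : nat}.
Local Notation V := 'rV[R]_m.
Local Notation W := 'rV[R]_n.

(** Evaluating [incrementE] of F along the moved point yields Carathéodory's factor of the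
    composition directly, so no remainder is estimated. The term with [d == None] is the explicit
    dependence of F on time. *)
Lemma is_pd_chain d (U : set W) (F : R -> W -> R) (G : 'I_n -> R -> V -> R)
    (g : 'I_n -> R) t (x : V) : open U -> ck U 1 F -> t \in `[0, 1] ->
  U (\row_j G j t x) -> (forall j, is_pd d (G j) t x (g j)) ->
  is_pd d (fun t x => F t (\row_j G j t x)) t x
    ((d == None)%:R * pd None F t (\row_j G j t x)
     + \sum_j g j * pd (Some j) F t (\row_j G j t x)).
Proof.
move=> oU kF tI UG dG; set y := \row_j G j t x.
have [q Hq] := choice dG.
pose P h : R * W := ((move d h (t, x)).1, \row_j at_pair (G j) (move d h (t, x))).
have cP : P h @[h --> within (admissible d t) (nbhs 0)] -->
    within times01 (nbhs ((t, y) : R * W)).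
  have cP' : P h @[h --> within (admissible d t) (nbhs 0)] --> ((t, y) : R * W).
    apply: (@cvg_pair _ _ _ (within (admissible d t) (nbhs 0)) (nbhs t) (nbhs y)).
      apply: cvg_within_filter.
      by apply: (@cvg_comp _ _ _ (fun h => move d h (t, x)) fst _ _ _ (@move_cvg _ _ d (t, x))); exact: cvg_fst.
    by apply: cvg_row => j; under eq_fun do rewrite mxE; rewrite mxE; exact: is_pd_cvg (dG j).
  move=> A nA.
  have := cP' _ nA; rewrite /within /=; rewrite !nbhs_filterE /=.
  apply: filterS => h Ph ah; apply: Ph => //.
  by rewrite /times01 /P /=; exact: move_time.
exists (fun h => (d == None)%:R * increment F t y None (P h)
   + \sum_j q j h * increment F t y (Some j) (P h)); split.
  apply: cvgD.
    apply: cvgM; first exact: cvg_cst.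
    have H := increment_cvg (d := None) oU kF tI UG.
    exact: (@cvg_comp _ _ _ P (increment F t y None) _ _ _ cP H).
  apply: cvg_sum => j _; apply: cvgM; first exact: (Hq j).1.
  have H := increment_cvg (d := Some j) oU kF tI UG.
  exact: (@cvg_comp _ _ _ P (increment F t y (Some j)) _ _ _ cP H).
move=> h ah; apply/eqP; rewrite [X in _ == X]addrC -subr_eq -/y; apply/eqP.
have -> : at_pair (fun t x => F t (\row_j G j t x)) (move d h (t, x)) - F t y
  = at_pair F (P h) - F t y by [].
rewrite incrementE mulrDr mulr_sumr; congr (_ + _).
  by rewrite mulrA /P /=; case: (d) => [i|] /=; rewrite ?subrr ?mulr0 ?mul0r // mulr1 addrAC subrr add0r.
apply: eq_bigr => j _; rewrite mulrA; congr (_ * _).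
by rewrite !mxE (Hq j).2 // addrAC subrr add0r.
Qed.

Lemma jcont_chain (F : R -> W -> R) (G : 'I_n -> R -> V -> R) t (x : V) :
  jcont F t (\row_j G j (clamp01 t) x) -> (forall j, jcont (G j) t x) ->
  jcont (fun t x => F t (\row_j G j t x)) t x.
Proof.
move=> cF cG.
apply: (@cvg_comp _ _ _ (fun p : R * V => (p.1, \row_j G j (clamp01 p.1) p.2) : R * W)
  (fun q : R * W => F (clamp01 q.1) q.2) _ (nbhs ((t, \row_j G j (clamp01 t) x) : R * W))) => //.
apply: (@cvg_pair _ _ _ (nbhs ((t, x) : R * V)) (nbhs t) (nbhs _)).
  exact: cvg_fst.
by apply: cvg_row => j; under eq_fun do rewrite mxE; rewrite mxE; exact: cG.
Qed.

Lemma ck_chain k (U' : set V) (U : set W) (F : R -> W -> R) (G : 'I_n -> R -> V -> R) :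
  open U -> open U' -> ck U k F -> (forall j, ck U' k (G j)) ->
  (forall t x, t \in `[0, 1] -> U' x -> U (\row_j G j t x)) ->
  ck U' k (fun t x => F t (\row_j G j t x)).
Proof.
move=> oU oU' kF kG UG.
have cFG (H : R -> W -> R) t x : ck U 0 H -> U' x ->
    jcont (fun t x => H t (\row_j G j t x)) t x.
  move=> kH U'x; apply: jcont_chain => [|j]; last exact: ck_jcont (kG j) U'x.
  by apply: ck_jcont kH _; apply: UG => //; exact: clamp01_itv.
elim: k F kF kG => [|k IH] F kF kG; first by split => // t x; exact: cFG.
apply: (@ck_intro _ _ _ _ _ (fun d t x => (d == None)%:R * pd None F t (\row_j G j t x)
     + \sum_j pd d (G j) t x * pd (Some j) F t (\row_j G j t x))) => //.
- by move=> t x; apply: cFG; exact: ck_le kF.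
- move=> d t x tI U'x; apply: is_pd_chain => //.
  + exact: oU.
  + exact: ck_le kF.
  + exact: UG.
  + by move=> j; exact: ck_is_pd (kG j) tI U'x.
- move=> d; apply: ckD => //.
    apply: ckZ => //; apply: IH => //; first exact: ck_pd.
    by move=> j; exact: ckS.
  apply: ck_sum => // j _; apply: ckM => //; first exact: ck_pd.
  apply: IH => //; first exact: ck_pd.
  by move=> i; exact: ckS.
Qed.

End Composition.

(** * Symmetry of second derivatives and integrals with a parameter *)

Section Clairaut.
Context {R : realType} {m : nat}.
Local Notation V := 'rV[R]_m.
Implicit Types (F G : R -> V -> R) (U : set V) (d e : option 'I_m) (t h : R).

Lemma ball_move d (p : R * V) r h : `|h| < r -> ball p r (move d h p).
Proof.
move=> hr; have r0 : 0 < r by exact: le_lt_trans hr.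
case: p => t x; case: d => [i|]; split => /=; do ?exact: ballxx.
  split => // i0 j; rewrite ord1 !mxE eqxx /= -ball_normE /= opprD addrA subrr sub0r normrN.
  by case: (j == i); rewrite ?mulr1 // mulr0 normr0.
by rewrite -ball_normE /= opprD addrA subrr sub0r normrN.
Qed.

Lemma admissible_scale d t h s : t \in `[0, 1] -> s \in `[0, 1] ->
  admissible d t h -> admissible d t (s * h).
Proof.
case: d => [i|] //=; rewrite !in_itv /= => /andP[? ?] /andP[? ?] /andP[? ?].
by apply/andP; split; nra.
Qed.

(** The mean value theorem is applied along d to the difference of F over a step in direction e,
    then along e to [pd d F]. As the directions differ, moving along one of them does not change
    which increments are admissible for the other. *)
Lemma second_difference U F d e t x h k : open U -> ck U 2 F -> d != e ->
  t \in `[0, 1] -> h != 0 -> k != 0 -> admissible d t h -> admissible e t k ->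
  (forall s s', s \in `[0, 1] -> s' \in `[0, 1] ->
    U (move e (s' * k) (move d (s * h) (t, x))).2) ->
  exists s s', [/\ s \in `[0, 1], s' \in `[0, 1] &
    at_pair F (move d h (move e k (t, x))) - at_pair F (move d h (t, x))
      - (at_pair F (move e k (t, x)) - at_pair F (t, x)) =
    h * k * at_pair (pd e (pd d F)) (move e (s' * k) (move d (s * h) (t, x)))].
Proof.
move=> oU kF de tI h0 k0 ah ak HU.
have I0 : (0 : R) \in `[0, 1] by rewrite in_itv /= lexx ler01.
have I1 : (1 : R) \in `[0, 1] by rewrite in_itv /= lexx ler01.
have td s : s \in `[0, 1] -> (move d (s * h) (t, x)).1 \in `[0, 1].
  by move=> sI; apply: move_time => //; exact: admissible_scale.
have te s : s \in `[0, 1] -> (move e (s * k) (t, x)).1 \in `[0, 1].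
  by move=> sI; apply: move_time => //; exact: admissible_scale.
have ade s : admissible e (move d (s * h) (t, x)).1 k.
  by case: (d) (e) de ak => [i|] [j|].
have aed : admissible d (move e k (t, x)).1 h by case: (d) (e) de ah => [i|] [j|].
have HU1 s : s \in `[0, 1] -> U (move d (s * h) (move e k (t, x))).2.
  by move=> sI; have := HU s 1 sI I1; rewrite mul1r moveC.
have HU0 s : s \in `[0, 1] -> U (move d (s * h) (t, x)).2.
  by move=> sI; have := HU s 0 sI I0; rewrite mul0r move0.
have kF1 := ckS kF.
have tdk s : s \in `[0, 1] -> (move d (s * h) (move e k (t, x))).1 \in `[0, 1].
  move=> sI; rewrite moveC.
  have := @move_time _ _ e k (move d (s * h) (t, x)).1 (move d (s * h) (t, x)).2
     (td s sI) (ade s).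
  by rewrite -surjective_pairing.
have [||c0 d0] := @pd_line R m d F (pd d F) t x h tI h0 ah.
- by move=> s sI; exact: ck_jcont kF (HU0 s sI).
- by move=> s sI; apply: ck_is_pd kF1 (td s sI) (HU0 s sI).
have [|||c1 d1] := @pd_line R m d F (pd d F) (move e k (t, x)).1 (move e k (t, x)).2 h _ h0 aed.
- by have := te 1 I1; rewrite mul1r.
- by move=> s sI; rewrite -surjective_pairing; exact: ck_jcont kF (HU1 s sI).
- by move=> s sI; rewrite -surjective_pairing; apply: ck_is_pd kF1 (tdk s sI) (HU1 s sI).
rewrite -surjective_pairing in c1 d1.
have [||s sI] := @MVT_segment R
  (fun s => at_pair F (move d (s * h) (move e k (t, x))) - at_pair F (move d (s * h) (t, x)))
  (fun s => h * at_pair (pd d F) (move d (s * h) (move e k (t, x)))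
            - h * at_pair (pd d F) (move d (s * h) (t, x))) 0 1 ler01.
- by move=> s sI; apply: is_deriveB; [exact: d1|exact: d0].
- by move=> s; apply: cvgB; [exact: c1|exact: c0].
rewrite !mul1r !mul0r !move0 subr0 mulr1 => E1.
have [||s' s'I] := @pd_mvt R m e (pd d F) (pd e (pd d F)) (move d (s * h) (t, x)).1
   (move d (s * h) (t, x)).2 k (td s sI) (ade s).
- move=> s' s'I; rewrite -surjective_pairing.
  exact: ck_jcont (ck_pd d kF) (HU s s' sI s'I).
- move=> s' s'I; rewrite -surjective_pairing; apply: ck_is_pd (ck_pd d kF) _ (HU s s' sI s'I).
  have := @move_time _ _ e (s' * k) (move d (s * h) (t, x)).1 (move d (s * h) (t, x)).2
     (td s sI) (admissible_scale (td s sI) s'I (ade s)).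
  by rewrite -surjective_pairing.
rewrite -surjective_pairing => E2; exists s, s'; split => //.
by rewrite E1 -mulrA -E2 [move e k (move d _ _)]moveC mulrBr.
Qed.

(** The second difference is symmetric in the two directions, so arbitrarily close to (t, x) the two
    mixed derivatives take a common value; continuity concludes. One of the directions may be time,
    also at times 0 and 1. *)
Lemma pdC U F d e t x : open U -> ck U 2 F -> t \in `[0, 1] -> U x ->
  pd d (pd e F) t x = pd e (pd d F) t x.
Proof.
move=> oU kF tI Ux; have [->//|de] := eqVneq d e.
apply/eqP; rewrite -subr_eq0 -normr_le0; apply/ler_addgt0Pr => eps e0; rewrite add0r.
have e20 : 0 < eps / 2 by rewrite divr_gt0.
have cde : jcont (pd d (pd e F)) t x by exact: (ck_jcont (ck_pd d (ck_pd e kF)) Ux).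
have ced : jcont (pd e (pd d F)) t x by exact: (ck_jcont (ck_pd e (ck_pd d kF)) Ux).
rewrite /jcont !(clamp01_id tI) in cde ced.
move/cvgrPdist_lt : cde => /(_ _ e20) Hde; move/cvgrPdist_lt : ced => /(_ _ e20) Hed.
have H2 : \forall p \near ((t, x) : R * V), U p.2.
  have cs : (p.2 : V) @[p --> ((t, x) : R * V)] --> x by exact: cvg_snd.
  exact: (cs U (open_nbhs_nbhs (conj oU Ux))).
have [r /= r0 Hr] : nbhs_ball ((t, x) : R * V)
    [set p | [/\ `|pd d (pd e F) t x - pd d (pd e F) (clamp01 p.1) p.2| < eps / 2,
       `|pd e (pd d F) t x - pd e (pd d F) (clamp01 p.1) p.2| < eps / 2 & U p.2]].
  apply/nbhs_ballP; near=> p; split; near: p => //.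
have r20 : 0 < r / 2 by rewrite divr_gt0.
have [h [h0 hr ah]] := admissible_small d tI r20.
have [k [k0 kr ak]] := admissible_small e tI r20.
have sm s a : s \in `[0, 1] -> `|a| < r / 2 -> `|s * a| < r / 2.
  rewrite in_itv /= => /andP[s0 s1]; rewrite normrM (ger0_norm s0).
  by apply: le_lt_trans; rewrite ler_piMl.
have inb f g a b s s' : `|a| < r / 2 -> `|b| < r / 2 -> s \in `[0, 1] -> s' \in `[0, 1] ->
    ball ((t, x) : R * V) r (move f (s' * b) (move g (s * a) (t, x))).
  move=> ar br sI s'I; rewrite (splitr r).
  by apply: (@ball_triangle _ _ (move g (s * a) (t, x))); apply: ball_move; exact: sm.
have tt f g a b s s' : f != g -> admissible f t b -> admissible g t a ->
    s \in `[0, 1] -> s' \in `[0, 1] ->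
    (move f (s' * b) (move g (s * a) (t, x))).1 \in `[0, 1].
  move=> fg fb ga sI s'I.
  have ga' := admissible_scale tI sI ga; have fb' := admissible_scale tI s'I fb.
  by case: (f) (g) fg ga' fb' => [i|] [j|].
have [s [s' [sI s'I E1]]] := second_difference oU kF de tI h0 k0 ah ak
  (fun s s' sI s'I => let: And3 _ _ H := Hr _ (inb e d h k s s' hr kr sI s'I) in H).
have ed : e != d by rewrite eq_sym.
have [u [u' [uI u'I E2]]] := second_difference oU kF ed tI k0 h0 ak ah
  (fun s s' sI s'I => let: And3 _ _ H := Hr _ (inb d e k h s s' kr hr sI s'I) in H).
have E : at_pair (pd e (pd d F)) (move e (s' * k) (move d (s * h) (t, x))) =
         at_pair (pd d (pd e F)) (move d (u' * h) (move e (u * k) (t, x))).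
  apply: (mulfI (mulf_neq0 h0 k0)); rewrite -E1 [h * k]mulrC -E2.
  by rewrite moveC; ring.
have [_ B1 _] := Hr _ (inb e d h k s s' hr kr sI s'I).
have [B2 _ _] := Hr _ (inb d e k h u u' kr hr uI u'I).
rewrite (clamp01_id (tt e d h k s s' ed ak ah sI s'I)) in B1.
rewrite (clamp01_id (tt d e k h u u' de ah ak uI u'I)) in B2.
rewrite /at_pair in E; rewrite E in B1.
set z := pd d (pd e F) (move d _ _).1 _ in B1 B2.
rewrite -(subrKA z) (le_trans (ler_normD _ _)) //.
by rewrite (splitr eps) lerD // ltW // distrC.
Unshelve. all: by end_near. Qed.

End Clairaut.

(** * Integrals over [0, 1] *)

Section UnitIntegral.
Context {R : realType}.
Implicit Types f g F : R -> R.

(** Continuity is assumed inside the sig type so that [antiderivative] is defined for every f.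
    Integrating from -1 puts 0 in the interior, where the derivative is two-sided. *)
Lemma antiderivative_exists f : {F : R -> R | continuous f ->
  forall t : R, -1 < t -> is_derive t 1 F (f t)}.
Proof.
exists (fun t => Rintegral lebesgue_measure `[-1, t] f) => cf t t1.
have tu : t < t + 1 by rewrite ltrDl.
have fi : lebesgue_measure.-integrable `[-1, t + 1] (EFin \o f).
  apply: continuous_compact_integrable; first exact: segment_compact.
  exact: continuous_subspaceT.
have [dF E] := continuous_FTC1_closed tu fi t1 (cf t).
by split; [exact: dF|rewrite -derive1E; exact: E].
Qed.

Definition antiderivative f : R -> R := sval (antiderivative_exists f).

Lemma antiderivativeP f (t : R) : continuous f -> -1 < t ->
  is_derive t 1 (antiderivative f) (f t).
Proof. by move=> cf; exact: (svalP (antiderivative_exists f) cf). Qed.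

Definition int01 f : R := antiderivative f 1 - antiderivative f 0.

Lemma FTC01 f F : continuous f -> (forall s : R, s \in `[0, 1] -> is_derive s 1 F (f s)) ->
  int01 f = F 1 - F 0.
Proof.
move=> cf dF.
have dH (s : R) : s \in `[0, 1] -> is_derive s 1 (fun s => antiderivative f s - F s) 0.
  move=> sI; rewrite -(subrr (f s)); apply: is_deriveB; last exact: dF.
  by apply: antiderivativeP => //; move: sI; rewrite in_itv /=; lra.
pose H (s : R) : R := antiderivative f s - F s.
have d0 (s : R) : s \in `]0, 1[ -> is_derive s 1 H ((fun=> 0) s).
  by move=> /subset_itv_oo_cc; exact: dH.
have cH : {within `[0, 1], continuous H}.
  by apply: derivable_within_continuous => s /dH[].
have [s _] := MVT_segment ler01 d0 cH.
by rewrite mul0r /int01 /H => /eqP; rewrite subr_eq0 => /eqP; lra.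
Qed.

Lemma int01_derive f (s : R) : continuous f -> s \in `[0, 1] -> is_derive s 1 (antiderivative f) (f s).
Proof. by move=> cf sI; apply: antiderivativeP => //; move: sI; rewrite in_itv /=; lra. Qed.

Lemma int01D f g : continuous f -> continuous g ->
  int01 (fun s => f s + g s) = int01 f + int01 g.
Proof.
move=> cf cg.
rewrite (_ : _ + _ = (antiderivative f 1 + antiderivative g 1)
  - (antiderivative f 0 + antiderivative g 0)); last by rewrite /int01; ring.
apply: (@FTC01 _ (fun s => antiderivative f s + antiderivative g s)).
  by move=> s; apply: cvgD; [exact: cf|exact: cg].
by move=> s sI; apply: is_deriveD; exact: int01_derive.
Qed.

Lemma int01Z (c : R) f : continuous f -> int01 (fun s => c * f s) = c * int01 f.
Proof.
move=> cf; rewrite /int01 mulrBr; apply: (@FTC01 _ (fun s => c * antiderivative f s)).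
  by move=> s; apply: cvgM; [exact: cvg_cst|exact: cf].
by move=> s sI; apply: (@is_deriveZ _ _ _ (antiderivative f) c s 1 (f s)); exact: int01_derive.
Qed.

Lemma int01B f g : continuous f -> continuous g ->
  int01 (fun s => f s - g s) = int01 f - int01 g.
Proof.
move=> cf cg; have E : (fun s => f s - g s) = (fun s => f s + (-1) * g s).
  by apply/funext => s; rewrite mulN1r.
rewrite E int01D // ?int01Z // ?mulN1r //.
by move=> s; apply: cvgM; [exact: cvg_cst|exact: cg].
Qed.

Lemma int01_le f (M : R) : continuous f -> (forall s, s \in `[0, 1] -> `|f s| <= M) ->
  `|int01 f| <= M.
Proof.
move=> cf fM.
have [||s sI] := @MVT_segment R (antiderivative f) f 0 1 ler01.
- by move=> s /subset_itv_oo_cc sI; exact: int01_derive.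
- apply: derivable_within_continuous => s sI.
  by have := int01_derive cf sI => - [].
by rewrite /int01 subr0 mulr1 => ->; exact: fM.
Qed.

End UnitIntegral.

Section Tube.
Context {R : realType} {T : topologicalType}.

(** By compactness of [0, 1], continuity at the points of [0, 1] x {p0} gives a neighbourhood of p0
    that works for all s at once. This replaces uniform continuity when passing to a limit under the
    integral or along a trajectory. *)
Lemma tube (Phi : R -> T -> R) (p0 : T) (e : R) : 0 < e ->
  (forall s, s \in `[0, 1] -> Phi q.1 q.2 @[q --> ((s, p0) : R * T)] --> Phi s p0) ->
  \forall p \near p0, forall s, s \in `[0, 1] -> `|Phi s p0 - Phi s p| <= e.
Proof.
move=> e0 cPhi.
have := @compact_near_coveringP R `[0, 1]; move=> -[/(_ (@segment_compact R 0 1)) + _].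
move=> /(_ T (nbhs p0) (fun p s => `|Phi s p0 - Phi s p| <= e) _); apply.
move=> s sI.
have e20 : 0 < e / 2 by rewrite divr_gt0.
move/cvgrPdist_le : (cPhi s sI) => /(_ _ e20) H.
have H0 : \forall q \near ((s, p0) : R * T), `|Phi s p0 - Phi q.1 p0| <= e / 2.
  have : Phi q.1 p0 @[q --> ((s, p0) : R * T)] --> Phi s p0.
    apply: (@cvg_comp _ _ _ (fun q : R * T => (q.1, p0)) (fun q => Phi q.1 q.2) _
      (nbhs ((s, p0) : R * T))); last exact: cPhi.
    apply: (@cvg_pair _ _ _ (nbhs ((s, p0) : R * T)) (nbhs s) (nbhs p0)).
      exact: cvg_fst.
    exact: cvg_cst.
  by move=> /cvgrPdist_le /(_ _ e20).
near=> q.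
have h1 : `|Phi s p0 - Phi q.1 q.2| <= e / 2 by near: q.
have h2 : `|Phi s p0 - Phi q.1 p0| <= e / 2 by near: q.
rewrite -(subrKA (Phi s p0)) (le_trans (ler_normD _ _)) //.
by rewrite (splitr e) lerD // distrC.
Unshelve. all: by end_near. Qed.

End Tube.

Section ParameterIntegral.
Context {R : realType} {m : nat}.
Local Notation V := 'rV[R]_m.
Local Notation W := 'rV[R]_(1 + m).
Implicit Types (F : R -> W -> R) (U : set V) (d : option 'I_m) (t h s : R) (x : V).

(** The parameter is stored as a first coordinate, so that differentiating in the parameter or in x
    is in both cases a partial derivative on R^(1 + m). *)
Definition pt s x : W := row_mx (const_mx s) x.

Definition cylinder U : set W := [set z | U (rsubmx z)].

Definition int_first F t x : R := int01 (fun s => F t (pt s x)).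

Definition shift_dir d : option 'I_(1 + m) := omap (@rshift 1 m) d.

Lemma rsubmx_continuous : continuous (@rsubmx R 1 1 m).
Proof.
move=> z; apply: (@cvg_row _ _ _ (nbhs z) (nbhs_filter z)) => j.
under eq_fun do rewrite mxE; rewrite mxE; exact: coord_continuous.
Qed.

Lemma open_cylinder U : open U -> open (cylinder U).
Proof.
by move=> oU; apply: open_comp => // z _; exact: rsubmx_continuous.
Qed.

Lemma pt_move d h s t x :
  move (shift_dir d) h (t, pt s x) = ((move d h (t, x)).1, pt s (move d h (t, x)).2).
Proof.
case: d => [i|] //=; congr pair; apply/rowP => j; rewrite !mxE.
case: splitP => k jk; rewrite !mxE; last first.
  by rewrite -!val_eqE /= jk eqn_add2l.
by rewrite -!val_eqE /= jk [k]ord1 /= mulr0 addr0.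
Qed.

Lemma pt_continuous (p : R * V) : {for p, continuous (fun p => pt p.1 p.2)}.
Proof.
apply: cvg_row => j; rewrite mxE; under eq_fun do rewrite mxE.
case: (splitP j) => k _; rewrite ?mxE; under eq_fun do rewrite ?mxE.
  exact: cvg_fst.
by apply: (@cvg_comp _ _ _ snd (fun x : V => x 0 k) _ (nbhs p.2));
  [exact: cvg_snd|exact: coord_continuous].
Qed.

Lemma pt_jcont U F (s t : R) x : (forall t z, cylinder U z -> jcont F t z) -> U x ->
  F (clamp01 q.2.1) (pt q.1 q.2.2) @[q --> ((s, (t, x)) : R * (R * V))]
    --> F (clamp01 t) (pt s x).
Proof.
move=> cF Ux.
have Uz : cylinder U (pt s x) by rewrite /cylinder /= row_mxKr.
apply: (@cvg_comp _ _ _ (fun q : R * (R * V) => (q.2.1, pt q.1 q.2.2))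
   (fun p : R * W => F (clamp01 p.1) p.2) _ (nbhs ((t, pt s x) : R * W))); last exact: cF.
apply: (@cvg_pair _ _ _ (nbhs ((s, (t, x)) : R * (R * V))) (nbhs t) (nbhs (pt s x))).
  apply: (@cvg_comp _ _ _ snd fst _ (nbhs ((t, x) : R * V))); first exact: cvg_snd.
  exact: cvg_fst.
apply: (@cvg_comp _ _ _ (fun q : R * (R * V) => (q.1, q.2.2)) (fun p : R * V => pt p.1 p.2) _
  (nbhs ((s, x) : R * V))); last exact: (@pt_continuous (s, x)).
apply: (@cvg_pair _ _ _ (nbhs ((s, (t, x)) : R * (R * V))) (nbhs s) (nbhs x)).
  exact: cvg_fst.
apply: (@cvg_comp _ _ _ snd snd _ (nbhs ((t, x) : R * V))); first exact: cvg_snd.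
exact: cvg_snd.
Qed.

Lemma pt_continuous1 U F t x : (forall t z, cylinder U z -> jcont F t z) -> U x ->
  continuous (fun s => F (clamp01 t) (pt s x)).
Proof.
move=> cF Ux s.
apply: (@cvg_comp _ _ _ (fun s : R => (s, (t, x)))
  (fun q : R * (R * V) => F (clamp01 q.2.1) (pt q.1 q.2.2)) _
  (nbhs ((s, (t, x)) : R * (R * V)))); last exact: pt_jcont cF Ux.
apply: (@cvg_pair _ _ _ (nbhs s) (nbhs s) (nbhs ((t, x) : R * V))).
  exact: cvg_id.
exact: cvg_cst.
Qed.

Lemma int_first_jcont U F t x : open U -> (forall t z, cylinder U z -> jcont F t z) -> U x ->
  jcont (int_first F) t x.
Proof.
move=> oU cF Ux; apply/cvgrPdist_le => e e0.
have H2 : \forall p \near ((t, x) : R * V), U p.2.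
  have cs : (p.2 : V) @[p --> ((t, x) : R * V)] --> x by exact: cvg_snd.
  exact: (cs U (open_nbhs_nbhs (conj oU Ux))).
have := @tube R (R * V)%type (fun s p => F (clamp01 p.1) (pt s p.2)) (t, x) e e0.
move=> /(_ (fun s _ => @pt_jcont U F s t x cF Ux)) H1.
near=> p; have Hp := near H1 p; have Up := near H2 p.
rewrite /int_first -int01B; last 2 first.
- exact: pt_continuous1 cF Ux.
- by apply: pt_continuous1 cF _; exact: Up.
apply: int01_le => [s|s sI]; last exact: Hp.
apply: cvgB; [exact: (@pt_continuous1 U F t x cF Ux s)|].
by apply: (@pt_continuous1 U F p.1 p.2 cF _ s); exact: Up.
Unshelve. all: by end_near. Qed.

(** For fixed s the difference quotient of the integrand is the partial derivative at an
    intermediate increment, and [tube] makes its convergence uniform in s. *)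
Lemma is_pd_int_first U F d t x : open U -> ck (cylinder U) 1 F -> t \in `[0, 1] -> U x ->
  is_pd d (int_first F) t x (int_first (pd (shift_dir d) F) t x).
Proof.
move=> oU kF tI Ux; set D := pd (shift_dir d) F.
have cF t' z : cylinder U z -> jcont F t' z by exact: ck_jcont kF.
have cD t' z : cylinder U z -> jcont D t' z by exact: ck_jcont (ck_pd (shift_dir d) kF).
pose Phi s h := D (clamp01 (move d h (t, x)).1) (pt s (move d h (t, x)).2).
exists (fun h => if h == 0 then int_first D t x else
  (at_pair (int_first F) (move d h (t, x)) - int_first F t x) / h); split; last first.
  move=> h ah; case: eqVneq => [->|h0]; first by rewrite move0 mul0r addr0.
  by rewrite mulrC divfK // subrKC.
apply/cvgrPdist_le => e e0.
have H1 : \forall h \near (0 : R), forall s, s \in `[0, 1] -> `|Phi s 0 - Phi s h| <= e.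
  apply: tube => // s _; rewrite /Phi move0.
  apply: (@cvg_comp _ _ _ (fun q : R * R => (q.1, move d q.2 (t, x)))
   (fun q : R * (R * V) => D (clamp01 q.2.1) (pt q.1 q.2.2)) _ (nbhs ((s, (t, x)) : R * (R * V))));
    last exact: (@pt_jcont U D s t x cD Ux).
  apply: (@cvg_pair _ _ _ (nbhs ((s, 0) : R * R)) (nbhs s) (nbhs ((t, x) : R * V))).
    exact: cvg_fst.
  apply: (@cvg_comp _ _ _ snd (fun h => move d h (t, x)) _ (nbhs (0 : R))).
    exact: cvg_snd.
  exact: move_cvg.
have H2 : \forall h \near (0 : R), U (move d h (t, x)).2.
  have : (move d h (t, x)).2 @[h --> (0 : R)] --> x.
    by apply: (cvg_comp _ _ (@move_cvg _ _ d (t, x))); exact: cvg_snd.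
  by move=> /(_ U (open_nbhs_nbhs (conj oU Ux))).
have [r /= r0 Hr] : nbhs_ball (0 : R) [set h | U (move d h (t, x)).2 /\
    forall s, s \in `[0, 1] -> `|Phi s 0 - Phi s h| <= e].
  by apply/nbhs_ballP; near=> h; split; near: h.
rewrite near_withinE; apply/nbhs_ballP; exists r => //= h hr ah.
case: eqVneq => [_|h0]; first by rewrite subrr normr0 ltW.
have hs s : s \in `[0, 1] -> ball (0 : R) r (s * h).
  move: hr; rewrite in_itv /= -!ball_normE /= !sub0r !normrN => hr /andP[s0 s1].
  by rewrite normrM (ger0_norm s0); apply: le_lt_trans hr; rewrite ler_piMl.
have tI' s : s \in `[0, 1] -> (move d (s * h) (t, x)).1 \in `[0, 1].
  by move=> sI; apply: move_time => //; exact: admissible_scale.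
have Us s : s \in `[0, 1] -> U (move d (s * h) (t, x)).2 by move=> /hs /Hr[].
have I1 : (1 : R) \in `[0, 1] by rewrite in_itv /= lexx ler01.
pose K s := h^-1 * (F (move d h (t, x)).1 (pt s (move d h (t, x)).2) - F t (pt s x)).
have ctD : continuous (fun s => D t (pt s x)).
  by rewrite -{1}(clamp01_id tI); exact: pt_continuous1 cD Ux.
have ctF : continuous (fun s => F t (pt s x)).
  by rewrite -{1}(clamp01_id tI); exact: pt_continuous1 cF Ux.
have ctF' : continuous (fun s => F (move d h (t, x)).1 (pt s (move d h (t, x)).2)).
  have := tI' 1 I1; rewrite mul1r => /clamp01_id <-.
  by apply: pt_continuous1 cF _; have := Us 1 I1; rewrite mul1r.
have cK : continuous K.
  by move=> s; apply: cvgM; [exact: cvg_cst|apply: cvgB; [exact: ctF'|exact: ctF]].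
have -> : (at_pair (int_first F) (move d h (t, x)) - int_first F t x) / h = int01 K.
  rewrite int01Z; last by move=> s; apply: cvgB; [exact: ctF'|exact: ctF].
  by rewrite int01B // mulrC.
rewrite /int_first -int01B //.
apply: int01_le => [s|s sI]; first by apply: cvgB; [exact: ctD|exact: cK].
have as_ : admissible (shift_dir d) t h by case: (d) ah.
have [||u uI] := @pd_mvt R _ (shift_dir d) F D t (pt s x) h tI as_.
- by move=> u uI; rewrite pt_move /=; apply: cF; rewrite /cylinder /= row_mxKr; exact: Us.
- move=> u uI; rewrite pt_move /=; apply: ck_is_pd kF (tI' u uI) _.
  by rewrite /cylinder /= row_mxKr; exact: Us.
rewrite !pt_move /at_pair /= => E.
rewrite /K E mulKf //.
have [_ /(_ s sI)] := Hr _ (hs u uI).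
by rewrite /Phi move0 /= !clamp01_id //; exact: tI'.
Unshelve. all: by end_near. Qed.

Lemma ck_int_first U k F : open U -> ck (cylinder U) k F -> ck U k (int_first F).
Proof.
move=> oU; elim: k F => [|k IH] F kF.
  by split => // t x Ux; apply: int_first_jcont oU _ Ux => t' z; exact: ck_jcont kF.
apply: (@ck_intro _ _ _ _ _ (fun d => int_first (pd (shift_dir d) F))) => //.
- by move=> t x Ux; apply: int_first_jcont oU _ Ux => t' z; exact: ck_jcont kF.
- move=> d t x tI Ux; apply: is_pd_int_first oU _ tI Ux.
  by elim: k kF {IH} => // k IH /ckS.
- by move=> d; apply: IH; exact: ck_pd.
Qed.

End ParameterIntegral.

(** * Ordinary differential equations *)

Section ScalarBounds.
Context {R : realType}.
Implicit Types (f g : R -> R) (s t : R).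

Lemma itv01P t : t \in `[0, 1] <-> 0 <= t /\ t <= 1.
Proof. by rewrite in_itv /=; split => [/andP|[-> ->]]. Qed.

Lemma mvt0 f f' t : (forall s, s \in `[0, 1] -> is_derive s 1 f (f' s)) -> t \in `[0, 1] ->
  exists2 s, s \in `[0, 1] & f t - f 0 = f' s * t.
Proof.
move=> df /[dup] tI /itv01P[t0 t1].
have st s : s \in `[0, t] -> s \in `[0, 1].
  by rewrite !in_itv /= => /andP[-> st] /=; exact: le_trans t1.
have d0 s : s \in `]0, t[ -> is_derive s 1 f (f' s).
  by move=> /subset_itv_oo_cc /st; exact: df.
have c0 : {within `[0, t], continuous f}.
  by apply: derivable_within_continuous => s /st /df[].
have [s sI E] := MVT_segment t0 d0 c0.
by exists s; [exact: st|rewrite E subr0].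
Qed.

Lemma derive_bound f g f' g' t :
  (forall s, s \in `[0, 1] -> is_derive s 1 f (f' s)) ->
  (forall s, s \in `[0, 1] -> is_derive s 1 g (g' s)) ->
  (forall s, s \in `[0, 1] -> `|f' s| <= g' s) -> t \in `[0, 1] ->
  `|f t - f 0| <= g t - g 0.
Proof.
move=> df dg fg tI.
have dB s : s \in `[0, 1] -> is_derive s 1 (fun s => g s - f s) (g' s - f' s).
  by move=> sI; apply: is_deriveB; [exact: dg|exact: df].
have dD s : s \in `[0, 1] -> is_derive s 1 (fun s => g s + f s) (g' s + f' s).
  by move=> sI; apply: is_deriveD; [exact: dg|exact: df].
have /itv01P[t0 t1] := tI.
have [s sI E] := mvt0 dB tI; have [u uI E'] := mvt0 dD tI.
have := fg s sI; have := fg u uI; rewrite !ler_norml => /andP[h1 h2] /andP[h3 h4].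
have E1 : 0 <= (g' s - f' s) * t by apply: mulr_ge0 => //; rewrite subr_ge0.
have E2 : 0 <= (g' u + f' u) * t by apply: mulr_ge0 => //; lra.
by apply/andP; split; lra.
Qed.

Lemma derivable_clamp_continuous f f' :
  (forall s, s \in `[0, 1] -> is_derive s 1 f (f' s)) -> continuous (fun s => f (clamp01 s)).
Proof.
move=> df s.
have [dfs _] := df _ (clamp01_itv s).
apply: (@cvg_comp _ _ _ clamp01 f _ (nbhs (clamp01 s))).
  exact: clamp01_continuous.
have /derivable1_diffP := dfs; exact: differentiable_continuous.
Qed.

Lemma expR_lin_derive (c s : R) : is_derive s 1 (fun s => expR (c * s)) (c * expR (c * s)).
Proof.
have H : is_derive s 1 (fun s : R => c * s) c.
  by apply: is_derive_eq; rewrite /GRing.scale /= mulr1.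
by have := @is_derive1_comp R expR (fun s => c * s) s _ _ (is_derive_expR _) H; rewrite mulrC.
Qed.

Lemma half_expn_lt (C e : R) : 0 < e -> exists n, C * (1 / 2) ^+ n < e.
Proof.
move=> e0; have h : `|1 / 2 : R| < 1 by rewrite ger0_norm; lra.
have := @cvg_geometric R C (1 / 2) h.
move=> /cvgrPdist_lt /(_ e e0)[n _ /(_ n (leqnn n))].
by rewrite /geometric /= sub0r normrN => H; exists n; exact: le_lt_trans (ler_norm _) H.
Qed.

(** The tail of the geometric series is 2 A (1/2)^n, so subtracting or adding it to [u n] gives a
    nondecreasing and a nonincreasing sequence; the supremum of the former is a limit with an
    explicit rate. *)
Lemma summable_limit (u : nat -> R) (A : R) :
  (forall n, `|u n.+1 - u n| <= A * (1 / 2) ^+ n) ->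
  exists l, forall n, `|l - u n| <= 2 * A * (1 / 2) ^+ n.
Proof.
move=> uA; pose b n := 2 * A * (1 / 2 : R) ^+ n.
have bS n : b n = b n.+1 + A * (1 / 2) ^+ n by rewrite /b exprS; field.
have A0 : 0 <= A by have := le_trans (normr_ge0 _) (uA 0%N); rewrite expr0 mulr1.
have b0 n : 0 <= b n by rewrite /b !mulr_ge0 ?exprn_ge0 //; lra.
have vS : nondecreasing_seq (fun n => u n - b n).
  apply/nondecreasing_seqP => n; have := uA n; rewrite (bS n) ler_norml => /andP[h1 h2]; lra.
have wS : nonincreasing_seq (fun n => u n + b n).
  apply/nonincreasing_seqP => n; have := uA n; rewrite (bS n) ler_norml => /andP[h1 h2]; lra.
have vw n k : u n - b n <= u k + b k.
  apply: (le_trans (vS n (maxn n k) (leq_maxl _ _))).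
  apply: (le_trans _ (wS k (maxn n k) (leq_maxr _ _))).
  by have := b0 (maxn n k); lra.
have hs : has_sup (range (fun n => u n - b n)).
  split; first by exists (u 0%N - b 0%N), 0%N.
  by exists (u 0%N + b 0%N) => _ [n _ <-].
exists (sup (range (fun n => u n - b n))) => n; rewrite -/(b n) ler_norml.
have h1 : u n - b n <= sup (range (fun n => u n - b n)).
  by apply: ub_le_sup; [case: hs|exists n].
have h2 : sup (range (fun n => u n - b n)) <= u n + b n.
  by apply: ge_sup; [case: hs|move=> _ [k _ <-]].
by apply/andP; split; lra.
Qed.

Lemma compact_norm_bound (T : topologicalType) (K : set T) (f : T -> R) : compact K ->
  (forall x, K x -> {for x, continuous f}) -> exists2 B, 0 <= B & forall x, K x -> `|f x| <= B.
Proof.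
move=> cK cf; have [->|/set0P K0] := eqVneq K set0; first by exists 0.
have [|c _ Hc] := @compact_EVT_max T R (fun x => `|f x|) K K0 cK.
  apply: continuous_in_subspaceT => x; rewrite inE => Kx.
  exact: (@cvg_norm _ _ _ (nbhs x) _ f _ (cf x Kx)).
by exists `|f c| => // x Kx; apply: Hc; rewrite inE.
Qed.

End ScalarBounds.

Section VectorBounds.
Context {R : realType} {m : nat}.
Local Notation V := 'rV[R]_m.
Implicit Types (X : R -> V -> V).

Lemma mx_norm_le (v : V) (M : R) : 0 <= M -> (forall i, `|v 0 i| <= M) -> `|v| <= M.
Proof.
move=> M0 vM; rewrite [leLHS]/Num.Def.normr /= mx_normrE.
by apply: bigmax_le => // -[i j] _ /=; rewrite ord1.
Qed.

Lemma coordB (x y : V) i : (x - y) 0 i = x 0 i - y 0 i.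
Proof. by rewrite !mxE. Qed.

Lemma cube_compact (rho : R) : compact [set x : V | `|x| <= rho].
Proof.
have -> : [set x : V | `|x| <= rho] =
    [set x : V | 0 <= rho] `&` [set x | forall i, `[- rho, rho]%classic (x ord0 i)].
  apply/seteqP; split => x /=.
    move=> xr; split; first exact: le_trans xr.
    by move=> i; rewrite in_itv /= -ler_norml; apply: le_trans xr; exact: mx_norm_coord.
  move=> [r0 xr]; apply: mx_norm_le => // i.
  by have := xr i; rewrite in_itv /= -ler_norml.
have cc := @rV_compact R m (fun=> `[- rho, rho]%classic) (fun=> @segment_compact _ _ _).
case: (lerP 0 rho) => r0.
  by rewrite (_ : [set x : V | true] = setT) ?setTI // -subTset.
by rewrite (_ : [set x : V | false] = set0) ?set0I //; [exact: compact0|apply/seteqP; split].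
Qed.

Lemma jcont_bound (I : finType) (F : I -> R -> V -> R) (rho : R) :
  (forall i t x, jcont (F i) t x) ->
  exists2 B, 0 <= B & forall i t x, t \in `[0, 1] -> `|x| <= rho -> `|F i t x| <= B.
Proof.
move=> cF.
have H i : exists B, 0 <= B /\ forall t x, t \in `[0, 1] -> `|x| <= rho -> `|F i t x| <= B.
  have cK := compact_setX (@segment_compact R 0 1) (@cube_compact rho).
  have [p _|B B0 HB] := @compact_norm_bound _ (R * V)%type _
    (fun p => F i (clamp01 p.1) p.2) cK.
    by case: p => t x; exact: cF.
  by exists B; split => // t x tI xr; have := HB (t, x); rewrite /= clamp01_id //; exact.
have [b Hb] := choice H; exists (\sum_i b i); first by apply: sumr_ge0 => i _; case: (Hb i).
move=> i t x tI xr; apply: le_trans ((Hb i).2 t x tI xr) _.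
rewrite (bigD1 i) //= lerDl; apply: sumr_ge0 => j _; by case: (Hb j).
Qed.

(** The derivative is two-sided even at times 0 and 1, so y must be differentiable there as a
    function on the whole line. *)
Definition solves X (y : R -> V) : Prop := forall i (t : R), t \in `[0, 1] ->
  is_derive t 1 (fun t => y t 0 i) (X t (y t) 0 i).

Lemma clamp_path_continuous X (y : R -> V) i : (forall i t x, jcont (fun t x => X t x 0 i) t x) ->
  (forall j, continuous (fun s => y (clamp01 s) 0 j)) ->
  continuous (fun s => X (clamp01 s) (y (clamp01 s)) 0 i).
Proof.
move=> cX cy s.
apply: (@cvg_comp _ _ _ (fun s : R => (s, y (clamp01 s)) : R * V)
  (fun p : R * V => X (clamp01 p.1) p.2 0 i) _ (nbhs ((s, y (clamp01 s)) : R * V))); last exact: cX.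
apply: (@cvg_pair _ _ _ (nbhs s) (nbhs s) (nbhs (y (clamp01 s)))); first exact: cvg_id.
by apply: cvg_row => j; exact: cy.
Qed.

(* The weight exp (2 K t) makes Picard's map contract with ratio 1/2 on the whole of [0, 1]. *)
Lemma picard X (K : R) (x0 : V) : 0 <= K ->
  (forall i t x, jcont (fun t x => X t x 0 i) t x) ->
  (forall t x y, t \in `[0, 1] -> `|X t x - X t y| <= K * `|x - y|) ->
  exists y : R -> V, y 0 = x0 /\ solves X y.
Proof.
move=> K0 cX lX.
pose rhs (y : R -> V) i (s : R) : R := X (clamp01 s) (y (clamp01 s)) 0 i.
pose next (y : R -> V) (t : R) : V :=
  \row_i (x0 0 i + (antiderivative (rhs y i) t - antiderivative (rhs y i) 0)).
pose ok (y : R -> V) := forall j, continuous (fun s => y (clamp01 s) 0 j).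
have crhs (y : R -> V) i : ok y -> continuous (rhs y i) by move=> oky; exact: (@clamp_path_continuous X y i cX oky).
have dnext (y : R -> V) i (t : R) : ok y -> t \in `[0, 1] ->
    is_derive t 1 (fun t => next y t 0 i) (rhs y i t).
  move=> oky tI.
  have -> : (fun t => next y t 0 i) = (fun t => x0 0 i +
    (antiderivative (rhs y i) t - antiderivative (rhs y i) 0)) by apply/funext => u; rewrite mxE.
  have H := int01_derive (crhs y i oky) tI.
  rewrite -[rhs y i t]add0r -[X in 0 + X]subr0.
  apply: (@is_deriveD _ _ _ (cst (x0 0 i)) (fun t => antiderivative (rhs y i) t - antiderivative (rhs y i) 0)).
have oknext (y : R -> V) : ok y -> ok (next y).
  move=> oky j.
  exact: (@derivable_clamp_continuous R (fun t => next y t 0 j) (rhs y j)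
    (fun s sI => dnext y j s oky sI)).
have next0 (y : R -> V) : next y 0 = x0 by apply/rowP => i; rewrite mxE subrr addr0.
pose u n := iter n next (fun=> x0).
have oku n : ok (u n).
  by elim: n => [|n IH] //; [move=> j s; exact: cvg_cst|exact: oknext].
have [B B0 HB] := @jcont_bound 'I_m (fun i t x => X t x 0 i) `|x0| cX.
have e1 (s : R) : 0 <= s -> 1 <= expR (2 * K * s).
  by move=> s0; rewrite -[1](@expR0 R) ler_expR !mulr_ge0.
have ud n t : t \in `[0, 1] ->
    `|u n.+1 t - u n t| <= B * (1 / 2) ^+ n * expR (2 * K * t).
  elim: n t => [|n IH] t tI; have /itv01P[t0 t1] := tI.
    rewrite expr0 mulr1; apply: (@le_trans _ _ B); last by rewrite ler_peMr // e1.
    apply: mx_norm_le => // i; rewrite !mxE.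
    have := @derive_bound R (fun t => next (u 0%N) t 0 i) (fun t => B * t) (rhs (u 0%N) i)
      (fun=> B) t (fun s sI => dnext (u 0%N) i s (oku 0%N) sI).
    rewrite next0 mulr0 subr0 mxE => H.
    apply: le_trans (H _ _ tI) _; last by rewrite ler_piMr.
    - by move=> s _; apply: is_derive_eq; rewrite /GRing.scale /= mulr1.
    - by move=> s sI; rewrite /rhs clamp01_id //; apply: HB.
  apply: mx_norm_le => [|i]; first by rewrite !mulr_ge0 ?exprn_ge0 ?expR_ge0 //; lra.
  have := @derive_bound R (fun t => u n.+2 t 0 i - u n.+1 t 0 i)
    (fun t => B * (1 / 2) ^+ n.+1 * expR (2 * K * t))
    (fun s => rhs (u n.+1) i s - rhs (u n) i s)
    (fun s => B * (1 / 2) ^+ n.+1 * (2 * K * expR (2 * K * s))) t.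
  rewrite ![u _ 0]/= !next0 subrr subr0 => H; rewrite coordB.
  apply: le_trans (H _ _ _ tI) _.
  - move=> s sI; have d1 := dnext (u n.+1) i s (oku _) sI.
    have d2 := dnext (u n) i s (oku _) sI; exact: (is_deriveB d1 d2).
  - move=> s sI; apply: (@is_deriveZ _ _ _ (fun t => expR (2 * K * t)) (B * (1 / 2) ^+ n.+1)).
    exact: expR_lin_derive.
  - move=> s sI; rewrite /rhs clamp01_id //.
    apply: le_trans (_ : `|X s (u n.+1 s) - X s (u n s)| <= _).
      by apply: le_trans (mx_norm_coord _ i); rewrite coordB.
    apply: le_trans (lX s _ _ sI) _; apply: le_trans (ler_wpM2l K0 (IH s sI)) _.
    by rewrite exprS le_eqVlt; apply/orP; left; apply/eqP; field.
  by rewrite mulr0 expR0 lerBlDr lerDl !mulr_ge0 ?exprn_ge0 //; lra.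
pose A := B * expR (2 * K).
have ud' n t : t \in `[0, 1] -> `|u n.+1 t - u n t| <= A * (1 / 2) ^+ n.
  move=> tI; have /itv01P[t0 t1] := tI; apply: le_trans (ud n t tI) _.
  rewrite mulrAC; apply: ler_wpM2r; first by apply: exprn_ge0; lra.
  by rewrite ler_wpM2l // ler_expR -[leRHS]mulr1 ler_wpM2l // mulr_ge0.
have A0 : 0 <= A by rewrite mulr_ge0 ?expR_ge0.
have r0 n : 0 <= 2 * A * (1 / 2) ^+ n by rewrite !mulr_ge0 ?exprn_ge0 //; lra.
have ylim t : exists yt : V, t \in `[0, 1] -> forall n, `|yt - u n t| <= 2 * A * (1 / 2) ^+ n.
  have [tI|tI] := boolP (t \in `[0, 1]); last by exists 0.
  have [l Hl] : exists l : 'I_m -> R, forall i n, `|l i - u n t 0 i| <= 2 * A * (1 / 2) ^+ n.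
    have H i : exists li : R, forall n, `|li - u n t 0 i| <= 2 * A * (1 / 2) ^+ n.
      apply: summable_limit => n; apply: le_trans (ud' n t tI).
      by apply: le_trans (mx_norm_coord _ i); rewrite coordB.
    by have [l Hl] := choice H; exists l.
  exists (\row_i l i) => _ n; apply: mx_norm_le => // i; rewrite !mxE; exact: Hl.
have [y Hy] := choice ylim.
have oky : ok y.
  move=> j s; apply/cvgrPdist_le => e e0.
  have [|n Hn] := @half_expn_lt R (2 * A) (e / 3); first lra.
  have := oku n j s; move=> /cvgrPdist_le /(_ (e / 3)) Hu.
  have e30 : 0 < e / 3 by lra.
  have {}Hu := Hu e30; near=> z.
  have h1 : `|u n (clamp01 s) 0 j - u n (clamp01 z) 0 j| <= e / 3 by near: z.
  have hy (v : R) : `|y (clamp01 v) 0 j - u n (clamp01 v) 0 j| <= e / 3.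
    apply: le_trans (ltW Hn); apply: le_trans (Hy _ (clamp01_itv v) n).
    by apply: le_trans (mx_norm_coord _ j); rewrite coordB.
  have h2 := hy s; have := hy z; rewrite distrC => h3.
  rewrite (_ : _ - _ = (y (clamp01 s) 0 j - u n (clamp01 s) 0 j)
     + ((u n (clamp01 s) 0 j - u n (clamp01 z) 0 j)
     + (u n (clamp01 z) 0 j - y (clamp01 z) 0 j))); last by ring.
  apply: le_trans (ler_normD _ _) _; have := ler_normD (u n (clamp01 s) 0 j - u n (clamp01 z) 0 j)
    (u n (clamp01 z) 0 j - y (clamp01 z) 0 j); lra.
(* The images of y and [u n] under [next] differ by at most K times the bound on the distance from y
   to [u n]; so the distance from [next y] to y is at most a multiple of (1/2)^n for every n. *)
have fixy t : t \in `[0, 1] -> next y t = y t.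
  move=> tI; apply/eqP; rewrite -subr_eq0 -normr_le0; apply/ler_addgt0Pr => e e0; rewrite add0r.
  have [n Hn] := @half_expn_lt R ((K + 1) * (2 * A)) e e0.
  apply: le_trans (ltW Hn).
  rewrite (_ : (K + 1) * (2 * A) * (1 / 2) ^+ n =
    K * (2 * A * (1 / 2) ^+ n) + 2 * A * (1 / 2) ^+ n); last by ring.
  rewrite -(subrKA (u n.+1 t)) (le_trans (ler_normD _ _)) // lerD //; last first.
    rewrite distrC; apply: le_trans (Hy t tI n.+1) _; rewrite exprS.
    by have := r0 n; set q := 2 * A * _; rewrite (_ : _ * _ = q / 2); [lra|rewrite /q; field].
  have /itv01P[t0 t1] := tI; have KA0 : 0 <= K * (2 * A * (1 / 2) ^+ n) by rewrite mulr_ge0.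
  apply: mx_norm_le => // i; rewrite coordB.
  have := @derive_bound R (fun t => next y t 0 i - u n.+1 t 0 i)
    (fun t => K * (2 * A * (1 / 2) ^+ n) * t)
    (fun s => rhs y i s - rhs (u n) i s) (fun s => K * (2 * A * (1 / 2) ^+ n)) t.
  rewrite [u _ 0]/= !next0 subrr subr0 mulr0 subr0 => H.
  apply: le_trans (H _ _ _ tI) _; last by rewrite ler_piMr.
  - move=> s sI; have d1 := dnext y i s oky sI.
    have d2 := dnext (u n) i s (oku _) sI; exact: (is_deriveB d1 d2).
  - by move=> s _; apply: is_derive_eq; rewrite /GRing.scale /= mulr1.
  - move=> s sI; rewrite /rhs clamp01_id //.
    apply: le_trans (_ : `|X s (y s) - X s (u n s)| <= _).
      by apply: le_trans (mx_norm_coord _ i); rewrite coordB.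
    by apply: le_trans (lX s _ _ sI) _; rewrite ler_wpM2l // Hy.
(* The solution is [next y] and not y: the two agree on [0, 1], but two-sided derivatives at 0 and 1
   also involve outside times, where y is arbitrary. *)
exists (next y); split=> // i t tI; rewrite fixy // -{2}(clamp01_id tI) -{3}(clamp01_id tI).
exact: dnext.
Unshelve. all: by end_near. Qed.

(** The rate m (2 K + 1) comes from 2 a (K a + eps) <= (2 K + 1) a ^ 2 + eps ^ 2 summed over the
    coordinates, the factor m + 1 from comparing the sup norm with the Euclidean one at time 0. *)
Definition gronwall_const (K : R) : R := m.+1%:R * expR (m%:R * (2 * K + 1)).

Lemma gronwall_const_ge1 K : 0 <= K -> 1 <= gronwall_const K.
Proof.
move=> K0; apply: mulr_ege1; first by rewrite ler1n.
by rewrite -[leLHS](@expR0 R) ler_expR mulr_ge0 // addr_ge0 // mulr_ge0.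
Qed.

Lemma sqr_mx_norm_le (v : V) : `|v| ^+ 2 <= \sum_i v 0 i ^+ 2.
Proof.
have s0 : 0 <= \sum_i v 0 i ^+ 2 by apply: sumr_ge0 => i _; exact: sqr_ge0.
rewrite -[leRHS]sqr_sqrtr // ler_sqr ?nnegrE ?sqrtr_ge0 //.
apply: mx_norm_le => [|i]; first exact: sqrtr_ge0.
rewrite -sqrtr_sqr ler_sqrt // (bigD1 i) //= lerDl.
by apply: sumr_ge0 => j _; exact: sqr_ge0.
Qed.

Lemma sum_sqr_le (v : V) : \sum_i v 0 i ^+ 2 <= m%:R * `|v| ^+ 2.
Proof.
apply: (@le_trans _ _ (\sum_(i < m) `|v| ^+ 2)); last by rewrite sumr_const card_ord mulr_natl.
by apply: ler_sum => i _; rewrite -real_normK ?num_real // ler_sqr ?nnegrE // mx_norm_coord.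
Qed.

Lemma is_derive_sum_sqr (y : R -> V) (a : V) (t : R) :
  (forall i, is_derive t 1 (fun t => y t 0 i) (a 0 i)) ->
  is_derive t 1 (fun t => \sum_i y t 0 i ^+ 2) (\sum_i 2 * y t 0 i * a 0 i).
Proof.
move=> dy.
have -> : (fun t => \sum_i y t 0 i ^+ 2) = \sum_i (fun t => y t 0 i ^+ 2).
  by apply/funext => s; rewrite fct_sumE.
apply: is_derive_sum => i.
have -> : (fun t => y t 0 i ^+ 2) = (fun t => y t 0 i * y t 0 i).
  by apply/funext => s; rewrite expr2.
rewrite (_ : 2 * _ * _ = y t 0 i *: a 0 i + y t 0 i *: a 0 i); last first.
  by rewrite /GRing.scale /=; ring.
by apply: (@is_deriveM _ _ (fun t => y t 0 i) (fun t => y t 0 i)).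
Qed.

(** The squared Euclidean distance u satisfies u' <= c (u + eps ^ 2), so (u + eps ^ 2) exp (- c t)
    does not increase. With eps = 0 this gives uniqueness and Lipschitz dependence on the initial
    point; eps > 0 is for approximate solutions, namely first order expansions of the flow. *)
Lemma gronwall (y z a b : R -> V) (K eps : R) : 0 <= K -> 0 <= eps ->
  (forall i (t : R), t \in `[0, 1] -> is_derive t 1 (fun t => y t 0 i) (a t 0 i)) ->
  (forall i (t : R), t \in `[0, 1] -> is_derive t 1 (fun t => z t 0 i) (b t 0 i)) ->
  (forall t, t \in `[0, 1] -> `|a t - b t| <= K * `|y t - z t| + eps) ->
  forall t, t \in `[0, 1] -> `|y t - z t| <= gronwall_const K * (`|y 0 - z 0| + eps).
Proof.
move=> K0 e0 dy dz ab t tI; have /itv01P[t0 t1] := tI.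
pose d t : V := y t - z t.
pose u t := \sum_i d t 0 i ^+ 2; pose c := m%:R * (2 * K + 1) : R.
have c0 : 0 <= c by rewrite mulr_ge0 // addr_ge0 // mulr_ge0.
have du (s : R) : s \in `[0, 1] -> is_derive s 1 u (\sum_i 2 * d s 0 i * (a s - b s) 0 i).
  move=> sI; apply: is_derive_sum_sqr => i.
  have -> : (fun t => d t 0 i) = (fun t => y t 0 i - z t 0 i) by apply/funext => r; rewrite !mxE.
  rewrite coordB; apply: is_deriveB; [exact: dy|exact: dz].
have du_le (s : R) : s \in `[0, 1] -> \sum_i 2 * d s 0 i * (a s - b s) 0 i <= c * (u s + eps ^+ 2).
  move=> sI; have nd := normr_ge0 (d s).
  apply: (@le_trans _ _ (\sum_(i < m) ((2 * K + 1) * `|d s| ^+ 2 + eps ^+ 2))).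
    apply: ler_sum => i _; apply: le_trans (ler_norm _) _.
    have -> : `|2 * d s 0 i * (a s - b s) 0 i| = 2 * (`|d s 0 i| * `|(a s - b s) 0 i|).
      by rewrite -mulrA !normrM ger0_norm.
    apply: (@le_trans _ _ (2 * (`|d s| * (K * `|d s| + eps)))).
      rewrite ler_wpM2l // ler_pM //; first exact: mx_norm_coord.
      by apply: le_trans (mx_norm_coord _ i) (ab s sI).
    have := sqr_ge0 (`|d s| - eps); rewrite !expr2; nra.
  rewrite sumr_const card_ord -[_ *+ m]mulr_natl /c -mulrA ler_wpM2l //.
  have := sqr_mx_norm_le (d s); rewrite -/(u s) => h; have := sqr_ge0 eps; nra.
pose v (s : R) := (u s + eps ^+ 2) * expR (- c * s).
have dv (s : R) : s \in `[0, 1] -> is_derive s 1 v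
  ((u s + eps ^+ 2) *: (- c * expR (- c * s)) + expR (- c * s) *: (\sum_i 2 * d s 0 i * (a s - b s) 0 i + 0)).
  move=> sI; apply: (@is_deriveM _ _ (fun s => u s + eps ^+ 2) (fun s => expR (- c * s))).
    by apply: (@is_deriveD _ _ _ u (cst (eps ^+ 2))); exact: du.
  exact: expR_lin_derive.
have [s sI E] := mvt0 dv tI.
have vt : v t <= v 0.
  rewrite -subr_le0 E; apply: mulr_le0_ge0 => //.
  rewrite /GRing.scale /= addr0.
  rewrite (_ : _ + _ = expR (- c * s) * (\sum_i 2 * d s 0 i * (a s - b s) 0 i - c * (u s + eps ^+ 2))); last by ring.
  by apply: mulr_ge0_le0; [exact: expR_ge0|rewrite subr_le0; exact: du_le].
have ut : u t <= (u 0 + eps ^+ 2) * expR c.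
  have E0 : v 0 = u 0 + eps ^+ 2 by rewrite /v mulr0 expR0 mulr1.
  have h1 : u t + eps ^+ 2 <= (u 0 + eps ^+ 2) * expR (c * t).
    rewrite -E0 (_ : u t + _ = v t * expR (c * t)).
      by rewrite ler_wpM2r ?expR_ge0.
    by rewrite /v -mulrA -expRD mulNr addNr expR0 mulr1.
  have h2 : (u 0 + eps ^+ 2) * expR (c * t) <= (u 0 + eps ^+ 2) * expR c.
    rewrite ler_wpM2l ?addr_ge0 ?sqr_ge0 //; first by apply: sumr_ge0 => i _; exact: sqr_ge0.
    by rewrite ler_expR ler_piMr.
  have := sqr_ge0 eps; lra.
have C1 := gronwall_const_ge1 K0; have C0 := le_trans ler01 C1.
have S0 : 0 <= `|d 0| + eps by rewrite addr_ge0.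
rewrite -ler_sqr ?nnegrE ?mulr_ge0 //.
apply: le_trans (sqr_mx_norm_le (d t)) _; apply: le_trans ut _.
have h3 : u 0 + eps ^+ 2 <= m.+1%:R * (`|d 0| + eps) ^+ 2.
  apply: (@le_trans _ _ (m%:R * `|d 0| ^+ 2 + eps ^+ 2)); first by rewrite lerD2r; exact: sum_sqr_le.
  rewrite -natr1 mulrDl mul1r; apply: lerD; last by rewrite ler_sqr ?nnegrE // lerDr.
  by rewrite ler_wpM2l // ler_sqr ?nnegrE // lerDl.
apply: (@le_trans _ _ (gronwall_const K * (`|d 0| + eps) ^+ 2)).
  by rewrite /gronwall_const -/c mulrAC ler_wpM2r ?expR_ge0.
rewrite exprMn ler_wpM2r ?sqr_ge0 // expr2 ler_peMl //.
Qed.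

End VectorBounds.

(** * Global solutions, uniqueness and the flow *)

Section Existence.
Context {R : realType} {m : nat}.
Local Notation V := 'rV[R]_m.
Implicit Types (X : R -> V -> V) (x : V).

Lemma jcont_chain_row (F : R -> V -> R) (g : R -> V -> V) t x :
  jcont F t (g (clamp01 t) x) -> (forall j, jcont (fun t x => g t x 0 j) t x) ->
  jcont (fun t x => F t (g t x)) t x.
Proof.
move=> cF cg; have E u y : \row_j g u y 0 j = g u y by apply/rowP => j; rewrite mxE.
have E2 : (fun t x => F t (\row_j g t x 0 j)) = (fun t x => F t (g t x)).
  by apply/funext => u; apply/funext => y; rewrite E.
have := @jcont_chain R m m F (fun j t x => g t x 0 j) t x.
by rewrite E E2; apply.
Qed.

Lemma jcont_sum (I : Type) (r : seq I) (P : pred I) (F : I -> R -> V -> R) t x :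
  (forall i, P i -> jcont (F i) t x) -> jcont (fun t x => \sum_(i <- r | P i) F i t x) t x.
Proof. by move=> cF; apply: cvg_sum. Qed.

Lemma segment_le_norm (y x : V) (s rho : R) : s \in `[0, 1] -> `|x| <= rho -> `|y| <= rho ->
  `|y + s *: (x - y)| <= rho.
Proof.
move=> /itv01P[s0 s1] xr yr.
rewrite (_ : _ + _ = (1 - s) *: y + s *: x); last first.
  by rewrite scalerBr scalerBl scale1r addrA addrAC.
apply: le_trans (ler_normD _ _) _; rewrite !normrZ (ger0_norm s0) ger0_norm ?subr_ge0 //.
have h1 : (1 - s) * `|y| <= (1 - s) * rho by rewrite ler_wpM2l // subr_ge0.
have h2 : s * `|x| <= s * rho by rewrite ler_wpM2l.
lra.
Qed.

Lemma increment_mean (F : R -> V -> R) t x y : ck setT 1 F -> t \in `[0, 1] ->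
  exists2 s, s \in `[0, 1] &
    F t x - F t y = \sum_j (x - y) 0 j * pd (Some j) F t (y + s *: (x - y)).
Proof.
move=> kF tI.
have I1 : (1 : R) \in `[0, 1] by apply/itv01P; rewrite ler01.
have [s sI] := mvt0 (fun (s : R) (_ : s \in `[0, 1]) =>
  @is_derive_line R m setT F t y (x - y) s openT kF tI I) I1.
by rewrite scale1r scale0r addr0 subrKC mulr1 => E; exists s.
Qed.

Lemma local_lipschitz X (rho : R) : (forall i, ck setT 1 (fun t x => X t x 0 i)) ->
  exists2 K, 0 <= K & forall t x y, t \in `[0, 1] -> `|x| <= rho -> `|y| <= rho ->
    `|X t x - X t y| <= K * `|x - y|.
Proof.
move=> kX.
have [ij t x|B B0 HB] := @jcont_bound R m ('I_m * 'I_m)%type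
  (fun ij => pd (Some ij.2) (fun t x => X t x 0 ij.1)) rho.
  exact: ck_jcont (ck_pd _ (kX ij.1)) _.
exists (m%:R * B); first by rewrite mulr_ge0.
move=> t x y tI xr yr; apply: mx_norm_le => [|i]; first by rewrite !mulr_ge0.
rewrite coordB; have [s sI ->] := increment_mean x y (kX i) tI.
apply: le_trans (ler_norm_sum _ _ _) _.
apply: (@le_trans _ _ (\sum_(j < m) (B * `|x - y|))); last first.
  by rewrite sumr_const card_ord -[_ *+ m]mulr_natl mulrA.
apply: ler_sum => j _; rewrite normrM mulrC ler_pM //; last exact: mx_norm_coord.
by apply: (HB (i, j)) => //; exact: segment_le_norm.
Qed.

(** Clipping fixes the cube, is 1-Lipschitz and increases no coordinate in absolute value.
    Precomposing a field with it thus makes the field globally Lipschitz and preserves a monotone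
    growth bound. *)
Definition cube_proj (j : R) x : V := \row_i Num.max (- j) (Num.min j (x 0 i)).

Lemma clip_lipschitz (j a b : R) :
  `|Num.max (- j) (Num.min j a) - Num.max (- j) (Num.min j b)| <= `|a - b|.
Proof.
have h1 := ler_norm (a - b); have := ler_norm (b - a); rewrite distrC => h2.
have H c u v : u - v <= `|a - b| -> v - u <= `|a - b| ->
    Num.min c u - Num.min c v <= `|a - b| /\ Num.max c u - Num.max c v <= `|a - b|.
  have N0 := normr_ge0 (a - b); rewrite /Num.max /Num.min => k1 k2.
  by case: (ltP c u); case: (ltP c v) => *; split; lra.
have [m1 _] := H j a b h1 h2; have [m2 _] := H j b a h2 h1.
have [_ M1] := H (- j) _ _ m1 m2; have [_ M2] := H (- j) _ _ m2 m1.
by rewrite ler_norml; apply/andP; split; lra.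
Qed.

Lemma clip_norm (j a : R) : 0 <= j -> `|Num.max (- j) (Num.min j a)| <= j.
Proof.
by move=> j0; rewrite ler_norml; apply/andP; split; rewrite ?le_max ?lexx // ge_max ge_min lexx; lra.
Qed.

Lemma clip_le (j a : R) : 0 <= j -> `|Num.max (- j) (Num.min j a)| <= `|a|.
Proof.
move=> j0; have h1 := ler_norm a; have := ler_norm (- a); rewrite normrN => h2.
rewrite ler_norml /Num.max /Num.min.
by case: (ltP j a) => ?; case: ltP => ?; apply/andP; split; lra.
Qed.

Lemma clip_id (j a : R) : `|a| <= j -> Num.max (- j) (Num.min j a) = a.
Proof. by rewrite ler_norml => /andP[ja aj]; rewrite min_r // max_r. Qed.

Lemma enorm_ge0 x : 0 <= enorm x.
Proof. exact: sqrtr_ge0. Qed.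

Lemma enorm_sqr x : enorm x ^+ 2 = \sum_i x 0 i ^+ 2.
Proof. by rewrite sqr_sqrtr //; apply: sumr_ge0 => i _; exact: sqr_ge0. Qed.

Lemma coord_le_enorm x i : `|x 0 i| <= enorm x.
Proof.
rewrite -sqrtr_sqr ler_sqrt; last by apply: sumr_ge0 => j _; exact: sqr_ge0.
by rewrite (bigD1 i) //= lerDl; apply: sumr_ge0 => j _; exact: sqr_ge0.
Qed.

Lemma norm_le_enorm x : `|x| <= enorm x.
Proof. by apply: mx_norm_le => [|i]; [exact: enorm_ge0|exact: coord_le_enorm]. Qed.

Lemma enorm_mono (x y : V) : (forall i, `|x 0 i| <= `|y 0 i|) -> enorm x <= enorm y.
Proof.
move=> xy; rewrite ler_sqrt; last by apply: sumr_ge0 => j _; exact: sqr_ge0.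
by apply: ler_sum => i _; rewrite -[x 0 i ^+ 2]real_normK ?num_real // -[y 0 i ^+ 2]real_normK ?num_real // ler_sqr ?nnegrE.
Qed.

(** Of the order of r log r at infinity, but monotone and at least 1, so that it can also bound a
    field near the origin. *)
Definition growth (r : R) : R := (1 + r) * (1 + ln (1 + r ^+ 2)).

Lemma growth_mono (r s : R) : 0 <= r -> r <= s -> growth r <= growth s.
Proof.
move=> r0 rs; have s0 := le_trans r0 rs.
have l0 (u : R) : 0 <= u -> 0 <= ln (1 + u ^+ 2) by move=> _; rewrite ln_ge0 // lerDl sqr_ge0.
apply: ler_pM; rewrite ?addr_ge0 ?l0 ?lerD2l // ler_ln ?posrE ?ltr_pwDl ?sqr_ge0 //.
by rewrite lerD2l ler_sqr.
Qed.

(** Obtained by inverting the Lyapunov function: it starts at most at ln (1 + ln (1 + m rho ^ 2)),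
    as the squared Euclidean norm is at most m times the squared sup norm, and gains at most 4 m A
    in unit time. *)
Definition escape_bound (A rho : R) : R :=
  expR ((1 + ln (1 + m%:R * rho ^+ 2)) * expR (4 * m%:R * A)).

(* The Lyapunov function is ln (1 + ln (1 + |y|^2)), whose derivative along
   trajectories is bounded because of the growth condition. *)
Lemma no_escape X (A rho : R) (y : R -> V) : 0 <= A -> solves X y -> `|y 0| <= rho ->
  (forall t x, t \in `[0, 1] -> enorm (X t x) <= A * growth (enorm x)) ->
  forall t, t \in `[0, 1] -> `|y t| <= escape_bound A rho.
Proof.
move=> A0 sy y0r gX t tI; have /itv01P[t0 t1] := tI.
pose u t := \sum_i y t 0 i ^+ 2.
have u0 s : 0 <= u s by apply: sumr_ge0 => i _; exact: sqr_ge0.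
have du (s : R) : s \in `[0, 1] -> is_derive s 1 u (\sum_i 2 * y s 0 i * X s (y s) 0 i).
  by move=> sI; apply: is_derive_sum_sqr => i; exact: sy.
have p1 s : 0 < 1 + u s by rewrite ltr_pwDl.
have p2 s : 0 < 1 + ln (1 + u s) by rewrite ltr_pwDl // ln_ge0 // lerDl.
pose W s := ln (1 + ln (1 + u s)).
have d1D (f : R -> R) (s v : R) : is_derive s 1 f v -> is_derive s 1 (fun s => 1 + f s) v.
  move=> df; have := is_deriveD (is_derive_cst (1 : R) s (1 : R)) df.
  by rewrite add0r.
have dW (s : R) : s \in `[0, 1] -> is_derive s 1 W
    ((1 + ln (1 + u s))^-1 * ((1 + u s)^-1 * \sum_i 2 * y s 0 i * X s (y s) 0 i)).
  move=> sI.
  apply: (@is_derive1_comp R (@ln R) (fun s => 1 + ln (1 + u s))); first exact: is_derive1_ln.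
  apply: (d1D); apply: (@is_derive1_comp R (@ln R) (fun s => 1 + u s)); first exact: is_derive1_ln.
  by apply: (d1D); exact: du.
have [s sI E] := mvt0 dW tI.
have Wt : W t <= W 0 + 4 * m%:R * A.
  rewrite -lerBlDl E; apply: le_trans (_ : 4 * m%:R * A * t <= _); last first.
    by rewrite ler_piMr // !mulr_ge0.
  rewrite ler_wpM2r //.
  rewrite mulrA -invfM mulrC ler_pdivrMr ?mulr_gt0 //.
  set r := enorm (y s); have r2 : r ^+ 2 = u s by exact: enorm_sqr.
  have rr : 0 <= r by exact: enorm_ge0.
  have gr : enorm (X s (y s)) <= A * ((1 + r) * (1 + ln (1 + u s))).
    by rewrite -r2; exact: gX.
  (* The factor 4 comes from r (1 + r) <= 2 (1 + r ^ 2). *)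
  have le2 : 2 * (r * (A * ((1 + r) * (1 + ln (1 + u s))))) <=
      4 * A * ((1 + ln (1 + u s)) * (1 + u s)).
    rewrite (_ : 2 * _ = 2 * A * (1 + ln (1 + u s)) * (r * (1 + r))); last by ring.
    rewrite (_ : 4 * A * _ = 2 * A * (1 + ln (1 + u s)) * (2 * (1 + u s))); last by ring.
    rewrite ler_wpM2l ?mulr_ge0 //; first exact: ltW.
    by rewrite -r2; have := sqr_ge0 (r - 1); rewrite !expr2; nra.
  apply: (@le_trans _ _ (\sum_(i < m) (4 * A * ((1 + ln (1 + u s)) * (1 + u s))))); last first.
    by rewrite sumr_const card_ord -[_ *+ m]mulr_natl; rewrite !mulrA [m%:R * 4]mulrC.
  apply: ler_sum => i _; apply: le_trans le2; apply: le_trans (ler_norm _) _.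
  rewrite -mulrA normrM ger0_norm // ler_wpM2l // normrM.
  apply: ler_pM => //; first exact: coord_le_enorm.
  by apply: le_trans (coord_le_enorm _ i) gr.
have lt_ : 1 + ln (1 + u t) <= (1 + ln (1 + m%:R * rho ^+ 2)) * expR (4 * m%:R * A).
  rewrite -[leLHS]lnK ?posrE // -/(W t).
  apply: le_trans (_ : expR (W 0 + 4 * m%:R * A) <= _); first by rewrite ler_expR.
  rewrite expRD ler_wpM2r ?expR_ge0 // /W lnK ?posrE // lerD2l ler_ln ?posrE //; last first.
    by rewrite ltr_pwDl // mulr_ge0 // sqr_ge0.
  rewrite lerD2l; apply: le_trans (sum_sqr_le _) _; rewrite ler_wpM2l //.
  by rewrite ler_sqr ?nnegrE //; apply: le_trans y0r.
have ut : 1 + u t <= escape_bound A rho.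
  rewrite -[leLHS]lnK ?posrE // /escape_bound ler_expR; apply: le_trans lt_.
  by rewrite lerDr.
have b1 : 1 <= escape_bound A rho by apply: le_trans ut; rewrite lerDl.
rewrite -ler_sqr ?nnegrE //; last exact: le_trans b1.
apply: le_trans (sqr_mx_norm_le (y t)) _; rewrite -/(u t).
have b2 : escape_bound A rho <= escape_bound A rho ^+ 2 by rewrite expr2 ler_peMl // (le_trans _ b1).
lra.
Qed.

(** The field is frozen outside a cube, where Picard's theorem gives a solution on all of [0, 1].
    The truncated field obeys the same growth bound, so [no_escape] keeps that solution in the cube,
    where nothing was changed. *)
Lemma solution_exists X (A : R) x : 0 <= A -> (forall i, ck setT 1 (fun t x => X t x 0 i)) ->
  (forall t x, t \in `[0, 1] -> enorm (X t x) <= A * growth (enorm x)) ->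
  exists y : R -> V, y 0 = x /\ solves X y.
Proof.
move=> A0 kX gX; pose B := escape_bound A `|x|.
have B0 : 0 <= B by exact: expR_ge0.
pose Y t x := X t (cube_proj B x).
have proj_le z : `|cube_proj B z| <= B.
  by apply: mx_norm_le => // i; rewrite mxE clip_norm.
have [K K0 lX] := local_lipschitz B kX.
have [|t z z' tI|y [y0 sy]] := @picard R m Y K x K0.
- move=> i t z; apply: (@jcont_chain_row (fun t x => X t x 0 i) (fun _ => cube_proj B)).
    exact: ck_jcont (kX i) _.
  move=> j; rewrite (_ : (fun _ _ => _) = (fun (t : R) (z : V) => Num.max (- B) (Num.min B (z 0 j)))); last first.
    by apply/funext => s; apply/funext => v; rewrite mxE.
  apply: (@jcont_comp _ _ (fun u : R => Num.max (- B) (Num.min B u)) (fun _ z => z 0 j)).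
    exact: jcont_coord.
  apply: (@continuous_max R R (cst (- B)) (fun u => Num.min B u)).
    exact: cst_continuous.
  by apply: (@continuous_min R R (cst B) id); [exact: cst_continuous|exact: cvg_id].
- apply: le_trans (lX t _ _ tI (proj_le z) (proj_le z')) _; rewrite ler_wpM2l //.
  apply: mx_norm_le => // i; rewrite coordB !mxE; apply: le_trans (clip_lipschitz _ _ _) _.
  by rewrite -coordB mx_norm_coord.
have gY t z : t \in `[0, 1] -> enorm (Y t z) <= A * growth (enorm z).
  move=> tI; apply: le_trans (gX t _ tI) _; rewrite ler_wpM2l //.
  apply: growth_mono; first exact: enorm_ge0.
  by apply: enorm_mono => i; rewrite mxE clip_le.
have yB t : t \in `[0, 1] -> `|y t| <= B.
  by apply: (no_escape A0 sy _ gY); rewrite y0.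
exists y; split => // i t tI.
have := sy i t tI; rewrite /Y (_ : cube_proj B (y t) = y t) //.
by apply/rowP => j; rewrite mxE clip_id //; apply: le_trans (mx_norm_coord _ j) (yB t tI).
Qed.

Lemma solution_bounded X (y : R -> V) : solves X y ->
  exists2 B, 0 <= B & forall t, t \in `[0, 1] -> `|y t| <= B.
Proof.
move=> sy.
have H i : exists B : R, 0 <= B /\ forall t : R, t \in `[0, 1] -> `|y t 0 i| <= B.
  have cy := @derivable_clamp_continuous R (fun t => y t 0 i) (fun t => X t (y t) 0 i) (sy i).
  have [B B0 HB] := compact_norm_bound (@segment_compact R 0 1)
    (fun s _ => cy s : {for s, continuous _}).
  by exists B; split => // t tI; have := HB t tI; rewrite clamp01_id.
have [b Hb] := choice H; have b0 i : 0 <= b i by case: (Hb i).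
exists (\sum_i b i); first exact: sumr_ge0.
move=> t tI; apply: mx_norm_le => [|i]; first exact: sumr_ge0.
by apply: le_trans ((Hb i).2 t tI) _; rewrite (bigD1 i) //= lerDl sumr_ge0.
Qed.

Lemma solution_unique X (y z : R -> V) : (forall i, ck setT 1 (fun t x => X t x 0 i)) ->
  solves X y -> solves X z -> y 0 = z 0 -> forall t, t \in `[0, 1] -> y t = z t.
Proof.
move=> kX sy sz yz t tI.
have [B B0 yB] := solution_bounded sy; have [C C0 zC] := solution_bounded sz.
have [K K0 lX] := local_lipschitz (B + C) kX.
have H := @gronwall R m y z (fun t => X t (y t)) (fun t => X t (z t)) K 0 K0 (lexx 0) sy sz.
rewrite yz subrr normr0 addr0 mulr0 in H.
apply/eqP; rewrite -subr_eq0 -normr_le0; apply: H tI => s sI; rewrite addr0.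
apply: lX => //; first by apply: le_trans (yB s sI) _; rewrite lerDl.
by apply: le_trans (zC s sI) _; rewrite lerDr.
Qed.


(** Boundedness on bounded sets is recorded in place of the growth condition: regularity is proved
    by passing to the field extended by its linearization, for which no growth bound is available
    but whose flow is still bounded. *)
Record flow X (phi : R -> V -> V) : Prop := Flow {
  flow0 : forall x, phi 0 x = x;
  flow_solves : forall x, solves X (phi ^~ x);
  flow_bounded : forall rho, exists B, forall t x,
    t \in `[0, 1] -> `|x| <= rho -> `|phi t x| <= B }.

Lemma flow_exists X (A : R) : 0 <= A -> (forall i, ck setT 1 (fun t x => X t x 0 i)) ->
  (forall t x, t \in `[0, 1] -> enorm (X t x) <= A * growth (enorm x)) ->
  exists phi, flow X phi.
Proof.
move=> A0 kX gX.
have [phi Hphi] := choice (fun x => solution_exists x A0 kX gX).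
exists (fun t x => phi x t); split => [x|x|rho]; try by case: (Hphi x).
exists (escape_bound A rho) => t x tI xr; have [p0 sp] := Hphi x.
by apply: (no_escape A0 sp _ gX tI); rewrite p0.
Qed.

Lemma flow_lipschitz X phi (rho : R) : (forall i, ck setT 1 (fun t x => X t x 0 i)) -> flow X phi ->
  exists2 C, 0 <= C & forall t x y, t \in `[0, 1] -> `|x| <= rho -> `|y| <= rho ->
    `|phi t x - phi t y| <= C * `|x - y|.
Proof.
move=> kX fphi; have [B HB] := flow_bounded fphi rho.
have [K K0 lX] := local_lipschitz B kX.
exists (gronwall_const (m := m) K); first by apply: le_trans (gronwall_const_ge1 K0).
move=> t x y tI xr yr.
have H := @gronwall R m (phi ^~ x) (phi ^~ y) (fun t => X t (phi t x)) (fun t => X t (phi t y))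
  K 0 K0 (lexx 0) (flow_solves fphi x) (flow_solves fphi y).
rewrite !(flow0 fphi) addr0 in H; apply: H tI => s sI; rewrite addr0.
by apply: lX => //; exact: HB.
Qed.

Lemma flow_path_continuous X phi x i : flow X phi -> continuous (fun t => phi (clamp01 t) x 0 i).
Proof.
move=> fphi.
exact: (@derivable_clamp_continuous R (fun t => phi t x 0 i) (fun t => X t (phi t x) 0 i)
  (flow_solves fphi x i)).
Qed.

Lemma flow_jcont X phi i t x : (forall i, ck setT 1 (fun t x => X t x 0 i)) -> flow X phi ->
  jcont (fun t x => phi t x 0 i) t x.
Proof.
move=> kX fphi; apply/cvgrPdist_le => e e0.
have [C C0 lphi] := flow_lipschitz (`|x| + 1) kX fphi.
have e20 : 0 < e / 2 by rewrite divr_gt0.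
have c1 : phi (clamp01 p.1) x 0 i @[p --> ((t, x) : R * V)] --> phi (clamp01 t) x 0 i.
  apply: (@cvg_comp _ _ _ fst (fun t => phi (clamp01 t) x 0 i) _ (nbhs t)); first exact: cvg_fst.
  exact: (@flow_path_continuous X phi x i fphi t).
move/cvgrPdist_le : c1 => /(_ _ e20) c1.
have c2 : (p.2 : V) @[p --> ((t, x) : R * V)] --> x by exact: cvg_snd.
have d0 : 0 < Num.min 1 (e / 2 / (C + 1)).
  by rewrite lt_min ltr01 !divr_gt0 // ltr_pwDr.
move/cvgrPdist_lt : c2 => /(_ _ d0) c2.
near=> p.
have h1 : `|phi (clamp01 t) x 0 i - phi (clamp01 p.1) x 0 i| <= e / 2 by near: p.
have : `|x - p.2| < Num.min 1 (e / 2 / (C + 1)) by near: p.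
rewrite lt_min => /andP[h2 h3].
rewrite -(subrKA (phi (clamp01 p.1) x 0 i)) (le_trans (ler_normD _ _)) //.
rewrite (splitr e) lerD //.
apply: (@le_trans _ _ (C * `|x - p.2|)); last first.
  rewrite ltr_pdivlMr ?ltr_pwDr // in h3; have := normr_ge0 (x - p.2); nra.
apply: le_trans (lphi _ _ _ (clamp01_itv p.1) _ _); last 2 first.
- by rewrite lerDl.
- have := ler_normB x (x - p.2); rewrite opprB subrKC => h; apply: (le_trans h); lra.
by apply: le_trans (mx_norm_coord _ i); rewrite coordB.
Unshelve. all: by end_near. Qed.

Lemma is_pd_eps d (F : R -> V -> R) t x v :
  (forall e, 0 < e -> \forall h \near (0 : R), admissible d t h ->
     `|at_pair F (move d h (t, x)) - F t x - h * v| <= e * `|h|) ->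
  is_pd d F t x v.
Proof.
move=> H; exists (fun h => if h == 0 then v else (at_pair F (move d h (t, x)) - F t x) / h).
split; last first.
  move=> h ah; case: eqVneq => [->|h0]; first by rewrite move0 mul0r addr0.
  by rewrite mulrC divfK // subrKC.
apply/cvgrPdist_le => e e0; rewrite near_withinE; apply: filterS (H e e0) => h Hh ah.
case: eqVneq => [_|h0]; first by rewrite subrr normr0 ltW.
have hp : 0 < `|h| by rewrite normr_gt0.
rewrite -(ler_pM2r hp) -normrM mulrBl divfK // [v * h]mulrC distrC.
exact: Hh.
Qed.

Lemma is_pd_time (F : R -> V -> R) (t : R) x v : is_derive t 1 (F ^~ x) v -> is_pd None F t x v.
Proof.
move=> /is_derive1_caratheodory[g [Fg cg <-]]; exists (fun h => g (t + h)); split.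
  apply: cvg_within_filter.
  have H : t + h @[h --> (0 : R)] --> t + 0 by apply: cvgD; [exact: cvg_cst|exact: cvg_id].
  rewrite addr0 in H; exact: (@cvg_comp _ _ _ (fun h => t + h) g _ _ _ H cg).
move=> h _; rewrite /at_pair /=; have := Fg (t + h).
move=> E; apply/eqP; rewrite [X in _ == X]addrC -subr_eq E mulrC.
by rewrite (_ : t + h - t = h) // addrAC subrr add0r.
Qed.

End Existence.

(** * The derivative of the flow in the initial point *)

Section Variation.
Context {R : realType} {m : nat}.
Local Notation V := 'rV[R]_m.
Variables (X : R -> V -> V) (phi : R -> V -> V).
Hypothesis sX : forall i, smooth_on setT (fun t x => X t x 0 i).
Hypothesis fphi : flow X phi.

Let kX i : ck setT 1 (fun t x => X t x 0 i). Proof. exact: sX. Qed.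

Definition linearized (t : R) (x v : V) : V :=
  \row_i \sum_j v 0 j * pd (Some j) (fun t x => X t x 0 i) t x.

Let pd_jcont i j t x : jcont (pd (Some j) (fun t x => X t x 0 i)) t x.
Proof. exact: ck_jcont (ck_pd _ (kX i)) _. Qed.

Lemma linearized_bound (rho : R) : exists2 K, 0 <= K & forall t x v, t \in `[0, 1] ->
  `|x| <= rho -> `|linearized t (phi t x) v| <= K * `|v|.
Proof.
have [r Hr] := flow_bounded fphi rho.
have [ij t x|B B0 HB] := @jcont_bound R m ('I_m * 'I_m)%type
  (fun ij => pd (Some ij.2) (fun t x => X t x 0 ij.1)) r.
  exact: pd_jcont.
exists (m%:R * B); first by rewrite mulr_ge0.
move=> t x v tI xr; apply: mx_norm_le => [|i]; first by rewrite !mulr_ge0.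
rewrite mxE; apply: le_trans (ler_norm_sum _ _ _) _.
apply: (@le_trans _ _ (\sum_(j < m) (B * `|v|))); last first.
  by rewrite sumr_const card_ord -[_ *+ m]mulr_natl mulrA.
apply: ler_sum => j _; rewrite normrM mulrC ler_pM //; last exact: mx_norm_coord.
by apply: (HB (i, j)) => //; exact: Hr.
Qed.

Lemma coordDZ (x v : V) (h : R) i : (x + h *: v) 0 i = x 0 i + h * v 0 i.
Proof. by rewrite !mxE. Qed.

Lemma linearizedB t x u v : linearized t x u - linearized t x v = linearized t x (u - v).
Proof.
apply/rowP => i; rewrite !mxE -sumrB; apply: eq_bigr => j _.
by rewrite coordB mulrBl.
Qed.

(** The equation is linear in v with coefficients bounded along the trajectory of x, hence globally
    Lipschitz, and [picard] applies without truncation. *)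
Lemma variation_exists : exists psi : R -> V -> V -> V, forall x v,
  psi 0 x v = v /\ solves (fun t v => linearized t (phi t x) v) (fun t => psi t x v).
Proof.
have H (xv : V * V) : exists y : R -> V, y 0 = xv.2 /\
    solves (fun t v => linearized t (phi t xv.1) v) y.
  case: xv => x v /=.
  have [K K0 HK] := linearized_bound `|x|.
  apply: (picard v K0) => [i t u|t u u' tI]; last by rewrite linearizedB; exact: HK.
  rewrite (_ : (fun _ _ => _) = (fun (t : R) (u : V) => \sum_j u 0 j *
      pd (Some j) (fun t x => X t x 0 i) t (phi t x))); last first.
    by apply/funext => s; apply/funext => w; rewrite mxE.
  apply: jcont_sum => j _; apply: jcontM; first exact: jcont_coord.
  apply: (@jcont_chain_row R m (pd (Some j) (fun t x => X t x 0 i)) (fun t _ => phi t x)).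
    exact: pd_jcont.
  move=> l; apply: (@cvg_comp _ _ _ fst (fun t => phi (clamp01 t) x 0 l) _ (nbhs t)).
    exact: cvg_fst.
  exact: (@flow_path_continuous R m X phi x l fphi t).
have [psi Hpsi] := choice H.
by exists (fun t x v => psi (x, v) t) => x v; exact: (Hpsi (x, v)).
Qed.

Variable psi : R -> V -> V -> V.
Hypothesis psi0 : forall x v, psi 0 x v = v.
Hypothesis spsi : forall x v,
  solves (fun t v => linearized t (phi t x) v) (fun t => psi t x v).

Lemma variation_bounded (rho : R) : exists B, forall t x v, t \in `[0, 1] -> `|x| <= rho ->
  `|v| <= rho -> `|psi t x v| <= B.
Proof.
have [K K0 HK] := linearized_bound rho.
exists (gronwall_const (m := m) K * rho) => t x v tI xr vr.
have H := @gronwall R m (fun t => psi t x v) (fun=> 0) (fun t => linearized t (phi t x) (psi t x v))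
  (fun=> 0) K 0 K0 (lexx 0) (spsi x v).
rewrite psi0 !subr0 addr0 in H.
have {}H : `|psi t x v| <= gronwall_const (m := m) K * `|v|.
  rewrite -[psi t x v]subr0; apply: H tI => [i s _|s sI].
    by rewrite mxE; exact: is_derive_cst.
  by rewrite !subr0 addr0; exact: HK.
apply: le_trans H _; rewrite ler_wpM2l //.
by apply: le_trans (gronwall_const_ge1 K0).
Qed.

Lemma evec_norm_le (h : R) (j : 'I_m) : `|h *: evec j : V| <= `|h|.
Proof.
apply: mx_norm_le => // i; rewrite !mxE eqxx normrM /= ler_piMr //.
by case: (i == j); rewrite ?normr1 ?normr0.
Qed.

(** Nearby trajectories are compared at all times at once, so the derivatives of X must vary little
    near the trajectory of x, uniformly in time; [tube] provides this. *)
Lemma taylor_uniform x (e : R) : 0 < e -> \forall k \near (0 : V), forall s i j, s \in `[0, 1] ->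
  `|pd (Some j) (fun t x => X t x 0 i) s (phi s x)
    - pd (Some j) (fun t x => X t x 0 i) s (phi s x + k)| <= e.
Proof.
move=> e0.
have H (ij : 'I_m * 'I_m) : \forall k \near (0 : V), forall s, s \in `[0, 1] ->
  `|pd (Some ij.2) (fun t x => X t x 0 ij.1) (clamp01 s) (phi (clamp01 s) x + 0)
    - pd (Some ij.2) (fun t x => X t x 0 ij.1) (clamp01 s) (phi (clamp01 s) x + k)| <= e.
  apply: (@tube R V (fun s k => pd (Some ij.2) (fun t x => X t x 0 ij.1) (clamp01 s)
    (phi (clamp01 s) x + k))) => // s sI.
  apply: (@cvg_comp _ _ _ (fun q : R * V => (q.1, phi (clamp01 q.1) x + q.2) : R * V)
    (fun p : R * V => pd (Some ij.2) (fun t x => X t x 0 ij.1) (clamp01 p.1) p.2) _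
    (nbhs ((s, phi (clamp01 s) x + 0) : R * V))); last exact: pd_jcont.
  apply: (@cvg_pair _ _ _ (nbhs ((s, 0) : R * V)) (nbhs s) (nbhs (phi (clamp01 s) x + 0))).
    exact: cvg_fst.
  apply: cvg_row => l; under eq_fun do rewrite mxE; rewrite mxE.
  apply: cvgD.
    apply: (@cvg_comp _ _ _ fst (fun t => phi (clamp01 t) x 0 l) _ (nbhs s)).
      exact: cvg_fst.
    exact: (@flow_path_continuous R m X phi x l fphi s).
  apply: (@cvg_comp _ _ _ snd (fun v : V => v 0 l) _ (nbhs (0 : V))).
    exact: cvg_snd.
  exact: coord_continuous.
have := @filter_forall _ _ _ (nbhs (0 : V)) (nbhs_filter _) H.
apply: (@filterS _ (nbhs (0 : V)) (nbhs_filter _)) => k Hk s i j sI.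
by have := Hk (i, j) s sI; rewrite /= addr0 clamp01_id.
Qed.

(** The curve phi + h psi solves the equation of the trajectory from x + h e_j up to an error o(h),
    uniform in time, and has the same initial point; Gronwall's inequality bounds the difference of
    the two by o(h). *)
Lemma is_pd_flow i j t x : t \in `[0, 1] ->
  is_pd (Some j) (fun t x => phi t x 0 i) t x (psi t x (evec j) 0 i).
Proof.
move=> tI; apply: is_pd_eps => e e0.
have [C C0 lphi] := flow_lipschitz (`|x| + 1) kX fphi.
have [K K0 HK] := linearized_bound `|x|.
pose M := gronwall_const (m := m) K.
have M1 : 1 <= M by exact: gronwall_const_ge1.
have M0 : 0 <= M by exact: le_trans M1.
(* Gronwall's inequality turns a tolerance e' on the derivatives of X into M m C e' |h|. Taking e' =
   e / [D] leaves at most e |h|; the + 1 keeps [D] positive. *)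
pose D := M * (m%:R * C) + 1.
have D0 : 0 < D by rewrite ltr_pwDr // !mulr_ge0.
pose e' := e / D; have e'0 : 0 < e' by rewrite divr_gt0.
have e'1 := ltW e'0.
have [r /= r0 Hr] := (@nbhs_ballP R V 0 _).1 (taylor_uniform x e'0).
(* Up to distance 1 from x the Lipschitz constant C is valid, and for |h| < r / (C + 1) the two
   trajectories stay closer than r. *)
have d0 : 0 < Num.min 1 (r / (C + 1)) by rewrite lt_min ltr01 divr_gt0 // ltr_pwDr.
apply/nbhs_ballP; exists (Num.min 1 (r / (C + 1))) => //= h.
rewrite -ball_normE /= sub0r normrN lt_min => /andP[h1 hr] _.
rewrite /at_pair /=; set x' := x + h *: evec j.
have x'x : `|x' - x| <= `|h| by rewrite /x' addrAC subrr add0r; exact: evec_norm_le.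
have x'r : `|x'| <= `|x| + 1.
  by apply: le_trans (ler_normD _ _) _; rewrite lerD2l; apply: le_trans (evec_norm_le _ _) (ltW h1).
have xr : `|x| <= `|x| + 1 by rewrite lerDl.
have del s : s \in `[0, 1] -> `|phi s x' - phi s x| <= C * `|h|.
  by move=> sI; apply: le_trans (lphi s _ _ sI x'r xr) _; rewrite ler_wpM2l.
have delr s u : s \in `[0, 1] -> u \in `[0, 1] -> ball (0 : V) r (u *: (phi s x' - phi s x)).
  move=> sI /itv01P[u0 u1]; rewrite -ball_normE /= sub0r normrN normrZ (ger0_norm u0).
  have := del s sI; rewrite ltr_pdivlMr ?ltr_pwDr // in hr.
  have := normr_ge0 (phi s x' - phi s x); have := normr_ge0 h; nra.
have H := @gronwall R m (phi ^~ x') (fun s => phi s x + h *: psi s x (evec j))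
  (fun s => X s (phi s x')) (fun s => X s (phi s x) + h *: linearized s (phi s x) (psi s x (evec j)))
  K (m%:R * (C * `|h|) * e') K0.
have {}H := H _ (flow_solves fphi x').
have {}H : `|phi t x' - (phi t x + h *: psi t x (evec j))| <= M * (m%:R * (C * `|h|) * e').
  have := H _ _ _ t tI; rewrite !(flow0 fphi) psi0 subrr normr0 add0r; apply.
  - by apply: mulr_ge0 => //; rewrite !mulr_ge0.
  - move=> l s sI; rewrite coordDZ.
    rewrite (_ : (fun _ => _) = (fun s => phi s x 0 l + h * psi s x (evec j) 0 l)); last first.
      by apply/funext => u; rewrite !mxE.
    apply: is_deriveD; first exact: flow_solves.
    apply: (@is_deriveZ _ _ _ (fun s => psi s x (evec j) 0 l) h s 1); exact: spsi.
  move=> s sI; apply: mx_norm_le => [|l].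
    by apply: addr_ge0; [exact: mulr_ge0|apply: mulr_ge0 => //; rewrite !mulr_ge0].
  rewrite coordB coordDZ opprD addrA.
  have [u uI ->] := increment_mean (phi s x') (phi s x) (kX l) sI.
  set z := phi s x' - phi s x.
  (* The error splits into the variation of the derivative of X applied to the displacement z, and
     the linearized field applied to the very difference that Gronwall's inequality estimates. *)
  rewrite (_ : _ - _ = \sum_l0 z 0 l0 * (pd (Some l0) (fun t x => X t x 0 l) s (phi s x + u *: z)
      - pd (Some l0) (fun t x => X t x 0 l) s (phi s x))
      + linearized s (phi s x) (z - h *: psi s x (evec j)) 0 l); last first.
    rewrite -linearizedB coordB !mxE -[in RHS](addrC (- _)) addrA.
    rewrite (_ : \sum_l0 z 0 l0 * (_ - _) = \sum_l0 z 0 l0 * pd (Some l0) (fun t x => X t x 0 l) s (phi s x + u *: z)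
       - \sum_l0 z 0 l0 * pd (Some l0) (fun t x => X t x 0 l) s (phi s x)); last first.
      by rewrite -sumrB; apply: eq_bigr => q _; rewrite mulrBr.
    rewrite (_ : \sum_j0 (h *: psi s x (evec j)) 0 j0 * _ = h * \sum_j0 psi s x (evec j) 0 j0 *
       pd (Some j0) (fun t x => X t x 0 l) s (phi s x)); last first.
      by rewrite mulr_sumr; apply: eq_bigr => q _; rewrite mxE mulrA.
    ring.
  apply: le_trans (ler_normD _ _) _; rewrite addrC; apply: lerD.
    apply: le_trans (mx_norm_coord _ l) _; rewrite (_ : phi s x' - _ = z - h *: psi s x (evec j)).
      exact: HK.
    by rewrite /z opprD addrA.
  apply: le_trans (ler_norm_sum _ _ _) _.
  apply: (@le_trans _ _ (\sum_(l0 < m) (C * `|h| * e'))); last first.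
    by rewrite sumr_const card_ord -[_ *+ m]mulr_natl mulrA.
  apply: ler_sum => q _; rewrite normrM ler_pM //.
    by apply: le_trans (mx_norm_coord _ q) _; exact: del.
  by rewrite distrC; apply: Hr => //; exact: delr.
have : `|phi t x' 0 i - phi t x 0 i - h * psi t x (evec j) 0 i| <= M * (m%:R * (C * `|h|) * e').
  by apply: le_trans H; apply: le_trans (mx_norm_coord _ i); rewrite coordB coordDZ opprD addrA.
move=> /le_trans; apply.
rewrite (_ : M * _ = M * (m%:R * C) * e' * `|h|); last by ring.
rewrite ler_wpM2r // /e' mulrCA ler_piMr //; first exact: ltW.
by rewrite ler_pdivrMr // mul1r /D lerDl.
Qed.

End Variation.

Section FlowSmooth.
Context {R : realType}.

(** The tangent lift of X, a field on the tangent bundle V x V. *)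
Definition extended_field m (X : R -> 'rV[R]_m -> 'rV[R]_m) t (z : 'rV[R]_(m + m)) : 'rV[R]_(m + m) :=
  row_mx (X t (lsubmx z)) (linearized X t (lsubmx z) (rsubmx z)).

Lemma ck_lsubmx m k (F : R -> 'rV[R]_m -> R) : ck setT k F ->
  ck setT k (fun t (z : 'rV[R]_(m + m)) => F t (lsubmx z)).
Proof.
move=> kF.
have E (z : 'rV[R]_(m + m)) : \row_j z 0 (lshift m j) = lsubmx z.
  by apply/rowP => j; rewrite !mxE.
have := @ck_chain R (m + m) m k setT setT F (fun j _ z => z 0 (lshift m j)) openT openT kF.
move=> H; have {}H := H (fun j => ck_coord k _ openT) (fun _ _ _ _ => I).
by apply: (ck_ext openT _ H) => t z _ _; rewrite E.
Qed.

Lemma extended_field_smooth m (X : R -> 'rV[R]_m -> 'rV[R]_m) :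
  (forall i, smooth_on setT (fun t x => X t x 0 i)) ->
  forall i, smooth_on setT (fun t z => extended_field X t z 0 i).
Proof.
move=> sX i k; have oT : open [set: 'rV[R]_(m + m)] by exact: openT.
rewrite -(splitK i); case: (fintype.split i) => j /=.
  apply: (ck_ext oT _ (ck_lsubmx (sX j k))) => t z _ _.
  by rewrite /extended_field row_mxEl.
apply: (@ck_ext _ _ _ _ (fun t z => \sum_l z 0 (rshift m l) *
  pd (Some l) (fun t x => X t x 0 j) t (lsubmx z)) _ oT).
  move=> t z _ _; rewrite /extended_field row_mxEr mxE.
  by apply: eq_bigr => l _; rewrite mxE.
apply: ck_sum => // l _; apply: ckM => //; first exact: ck_coord.
by apply: ck_lsubmx; exact: smooth_pd.
Qed.

Lemma extended_flow m (X phi : R -> 'rV[R]_m -> 'rV[R]_m) (psi : R -> 'rV[R]_m -> 'rV[R]_m -> 'rV[R]_m) :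
  (forall i, smooth_on setT (fun t x => X t x 0 i)) -> flow X phi ->
  (forall x v, psi 0 x v = v /\
     solves (fun t v => linearized X t (phi t x) v) (fun t => psi t x v)) ->
  flow (extended_field X) (fun t z => row_mx (phi t (lsubmx z)) (psi t (lsubmx z) (rsubmx z))).
Proof.
move=> sX fphi Hpsi; split.
- by move=> z; rewrite (flow0 fphi) (Hpsi _ _).1 hsubmxK.
- move=> z i t tI; rewrite -(splitK i); case: (fintype.split i) => j /=.
    rewrite /extended_field row_mxEl row_mxKl.
    rewrite (_ : (fun _ => _) = (fun t => phi t (lsubmx z) 0 j)); first exact: (flow_solves fphi).
    by apply/funext => s; rewrite row_mxEl.
  rewrite /extended_field row_mxEr row_mxKl row_mxKr.
  rewrite (_ : (fun _ => _) = (fun t => psi t (lsubmx z) (rsubmx z) 0 j)); first exact: (Hpsi _ _).2.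
  by apply/funext => s; rewrite row_mxEr.
- move=> rho; have [B HB] := flow_bounded fphi rho.
  have [C HC] := variation_bounded sX fphi (fun x v => (Hpsi x v).1) (fun x v => (Hpsi x v).2) rho.
  exists (Num.max 0 (Num.max B C)) => t z tI zr.
  have lz : `|lsubmx z| <= rho.
    by apply: le_trans zr; apply: mx_norm_le => // i; rewrite mxE; exact: mx_norm_coord.
  have rz : `|rsubmx z| <= rho.
    by apply: le_trans zr; apply: mx_norm_le => // i; rewrite mxE; exact: mx_norm_coord.
  apply: mx_norm_le => [|i]; first by rewrite le_max lexx.
  rewrite -(splitK i); case: (fintype.split i) => j /=; rewrite ?row_mxEl ?row_mxEr.
    by rewrite !le_max (le_trans (mx_norm_coord _ j) (HB t _ tI lz)) orbT.
  by rewrite !le_max (le_trans (mx_norm_coord _ j) (HC t _ _ tI lz rz)) !orbT.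
Qed.

(* The derivative of the flow is a component of the flow of the extended field,
   so regularity improves by induction over all dimensions at once. *)
Theorem flow_ck k m (X phi : R -> 'rV[R]_m -> 'rV[R]_m) :
  (forall i, smooth_on setT (fun t x => X t x 0 i)) -> flow X phi ->
  forall i, ck setT k (fun t x => phi t x 0 i).
Proof.
elim: k m X phi => [|k IH] m X phi sX fphi i.
  by split => // t x _; apply: flow_jcont fphi => j; exact: sX.
have [psi Hpsi] := variation_exists sX fphi.
have oT : open [set: 'rV[R]_m] by exact: openT.
apply: (@ck_intro _ _ _ _ _ (fun d => if d is Some j then fun t x => psi t x (evec j) 0 i
  else fun t x => X t (phi t x) 0 i)) => //.
- by move=> t x _; apply: flow_jcont fphi => j; exact: sX.
- move=> [j|] t x tI _.
    exact: (is_pd_flow sX fphi (fun x v => (Hpsi x v).1) (fun x v => (Hpsi x v).2)).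
  by apply: is_pd_time; exact: flow_solves.
- move=> [j|]; last first.
    have H := @ck_chain R m m k setT setT (fun t x => X t x 0 i) (fun l t x => phi t x 0 l)
      oT oT (sX i k) (IH m X phi sX fphi) (fun _ _ _ _ => I).
    apply: (ck_ext oT _ H) => t x _ _; congr (X t _ 0 i).
    by apply/rowP => l; rewrite mxE.
  have K := IH _ _ _ (extended_field_smooth sX) (extended_flow sX fphi Hpsi) (rshift m i).
  have oT2 : open [set: 'rV[R]_(m + m)] by exact: openT.
  have H := @ck_chain R m (m + m) k setT setT _ (fun l _ x => row_mx x (evec j) 0 l) oT2 oT K.
  have {}H := H _ (fun _ _ _ _ => I).
  apply: (ck_ext oT _ (H _)) => [t x _ _|l].
    rewrite row_mxEr (_ : \row_l row_mx x (evec j) 0 l = row_mx x (evec j)).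
      by rewrite row_mxKl row_mxKr.
    by apply/rowP => l; rewrite mxE.
  rewrite -(splitK l); case: (fintype.split l) => a /=.
    by apply: (ck_ext oT _ (ck_coord k a oT)) => t x _ _; rewrite row_mxEl.
  by apply: (ck_ext oT _ (ck_cst k (evec j 0 a) oT)) => t x _ _; rewrite row_mxEr.
Qed.

End FlowSmooth.

(** * Comparison of the two notions of smooth paths *)

Section DefsToCk.
Context {R : realType} {m p q : nat}.
Local Notation V := 'rV[R]_m.
Local Notation W := 'M[R]_(p, q).

Lemma is_pd_quotient d (F : R -> V -> R) t x v :
  (at_pair F (move d h (t, x)) - F t x) / h @[h --> within (admissible d t) 0^'] --> v ->
  is_pd d F t x v.
Proof.
move=> Fv; apply: is_pd_eps => e e0.
move/cvgrPdist_le : Fv => /(_ e e0); rewrite near_withinE near_withinE; apply: filterS => h Hh ah.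
have [->|h0] := eqVneq h 0; first by rewrite move0 /at_pair /= subrr mul0r subr0 !normr0 mulr0.
have hp : 0 < `|h| by rewrite normr_gt0.
have := Hh h0 ah; rewrite -(ler_pM2r hp) -normrM mulrBl divfK // [v * h]mulrC distrC.
by [].
Qed.

Lemma path_jcont (F : R -> V -> W) i j :
  {within `[0, 1] `*` [set: V], continuous (fun p : R * V => F p.1 p.2)} ->
  forall t x, jcont (fun t x => F t x i j) t x.
Proof.
move=> /subspace_continuousP cF t x.
have Ic : (`[0, 1] `*` [set: V]) (clamp01 t, x) by split => //=; exact: clamp01_itv.
have := cF _ Ic => {}cF.
have cc : ((clamp01 p.1, p.2) : R * V) @[p --> ((t, x) : R * V)] -->
    within (`[0, 1] `*` [set: V]) (nbhs ((clamp01 t, x) : R * V)).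
  have H : ((clamp01 p.1, p.2) : R * V) @[p --> ((t, x) : R * V)] --> ((clamp01 t, x) : R * V).
    apply: (@cvg_pair _ _ _ (nbhs ((t, x) : R * V)) (nbhs (clamp01 t)) (nbhs x)).
      apply: (@cvg_comp _ _ _ fst clamp01 _ (nbhs t)); first exact: cvg_fst.
      exact: clamp01_continuous.
    exact: cvg_snd.
  move=> A wA.
  have {}H : \forall p \near ((t, x) : R * V), (`[0, 1] `*` [set: V]) (clamp01 p.1, p.2) ->
      A (clamp01 p.1, p.2) by exact: (H _ wA).
  apply: (@filterS _ (nbhs ((t, x) : R * V)) (nbhs_filter _) _ _ _ H) => u; apply.
  by split => //=; exact: clamp01_itv.
have := @cvg_comp _ _ _ (fun p : R * V => (clamp01 p.1, p.2)) (fun p : R * V => F p.1 p.2) _ _ _ cc cF.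
move=> H; apply: (@cvg_comp _ _ _ (fun p : R * V => F (clamp01 p.1) p.2) (fun M : W => M i j) _ _ _ H).
exact: coord_continuous.
Qed.

Lemma time_quotient_coord (c : R -> W) t i j : time_derivable c t ->
  time_quotient (fun s => c s i j) t s @[s --> within `[0, 1] t^'] --> time_derive c t i j.
Proof.
move=> dc.
have H := @cvg_comp _ _ _ (time_quotient c t) (fun M : W => M i j) _ _ _ dc (@coord_continuous _ _ _ i j _).
apply: cvg_trans H; apply: near_eq_cvg; apply: nearW => s.
by rewrite /= /time_quotient !mxE.
Qed.

Lemma is_pd_time_quotient (F : R -> V -> R) t x v : t \in `[0, 1] ->
  time_quotient (F ^~ x) t s @[s --> within `[0, 1] t^'] --> v -> is_pd None F t x v.
Proof.
move=> tI Fv; apply: is_pd_eps => e e0.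
move/cvgrPdist_le : Fv => /(_ e e0); rewrite near_withinE near_withinE => H.
have {}H : \forall h \near (0 : R), h + t != t -> h + t \in `[0, 1] ->
    `|v - time_quotient (F ^~ x) t (h + t)| <= e.
  have ct : h + t @[h --> (0 : R)] --> t.
    rewrite -[X in _ --> X](add0r t); apply: cvgD; [exact: cvg_id|exact: cvg_cst].
  exact: (ct _ H).
apply: filterS H => h Hh ah; rewrite /admissible /= in ah.
have [->|h0] := eqVneq h 0; first by rewrite /at_pair /= addr0 subrr mul0r subr0 !normr0 mulr0.
have hp : 0 < `|h| by rewrite normr_gt0.
have tht : h + t != t by rewrite -subr_eq0 addrK.
rewrite [t + h]addrC in ah; have := Hh tht ah.
rewrite /time_quotient addrK -(ler_pM2r hp) -normrM mulrBl /GRing.scale /=.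
by rewrite [h^-1 * _]mulrC divfK // [v * h]mulrC distrC /at_pair /= [t + h]addrC.
Qed.

Lemma is_pd_derivable (F : R -> V -> R) t x l : derivable (F t) x (evec l) ->
  is_pd (Some l) F t x ('D_(evec l) (F t) x).
Proof.
move=> dF; apply: is_pd_quotient; apply: cvg_within_filter.
apply: cvg_trans dF; apply: near_eq_cvg; apply: nearW => h.
by rewrite /at_pair /= (addrC x); exact: mulrC.
Qed.

(** [Ck_path] differentiates matrix-valued maps along arbitrary vectors; restricting to basis
    vectors and to single entries gives the partial derivatives of [ck]. *)
Lemma Ck_path_ck k (F : R -> V -> W) i j : Ck_path k F -> ck setT k (fun t x => F t x i j).
Proof.
elim: k F => [|k IH] F [cF dF]; first by split => // t x _; exact: path_jcont.
have [dFt kdot kD] := dF.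
apply: (@ck_intro _ _ _ _ _ (fun d => if d is Some l then fun t x => 'D_(evec l) (F t) x i j
  else fun t x => path_dot F t x i j)) => //; first exact: openT.
- by move=> t x _; exact: path_jcont.
- move=> [l|] t x tI _; have [dx dt] := dFt t tI x.
    have dl := diff_derivable (v := evec l) dx.
    rewrite (derive_mx dl) mxE; apply: (@is_pd_derivable (fun t x => F t x i j)).
    exact: ((derivable_mxP _ _ _).1 dl i j).
  apply: is_pd_time_quotient => //; exact: time_quotient_coord.
- by move=> [l|]; apply: IH => //; exact: kD.
Qed.

Lemma path_dot_coord (F : R -> V -> W) i j t x : smooth_path F -> t \in `[0, 1] ->
  path_dot F t x i j = pd None (fun t x => F t x i j) t x.
Proof.
move=> /(_ 1%N)[_ [/(_ t) dFt _ _]] tI; apply/esym/pdE => //.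
by apply: is_pd_time_quotient => //; apply: time_quotient_coord; exact: (dFt tI x).2.
Qed.

End DefsToCk.

Section CkToDefs.
Context {R : realType} {m p : nat}.

(** Limits along this filter are unique because every time in [0, 1] is a limit point of other such
    times; this identifies the [lim] in [time_derive]. *)
Lemma time_filter_proper (t : R) : t \in `[0, 1] -> ProperFilter (within `[0, 1] t^').
Proof.
move=> tI; apply: Build_ProperFilter_ex => P; rewrite /within /= => HP.
have [r /= r0 Hr] : nbhs_ball t [set s | s != t -> s \in `[0, 1] -> P s].
  by apply/nbhs_ballP; exact: HP.
have [h [h0 hr ah]] := @admissible_small R 0 None t r tI r0.
exists (t + h); apply: Hr => //; last by rewrite -subr_eq0 addrAC subrr add0r.
by rewrite -ball_normE /= opprD addrA subrr sub0r normrN.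
Qed.

Local Notation V := 'rV[R]_m.
Local Notation W := 'rV[R]_p.

Lemma jcont_path (F : R -> V -> W) : (forall j t x, jcont (fun t x => F t x 0 j) t x) ->
  {within `[0, 1] `*` [set: V], continuous (fun p : R * V => F p.1 p.2)}.
Proof.
move=> cF; apply/subspace_continuousP => -[t x] [/= tI _].
have H : F (clamp01 p.1) p.2 @[p --> ((t, x) : R * V)] --> F t x.
  by apply: cvg_row => j; have := cF j t x; rewrite /jcont (clamp01_id tI).
apply: cvg_trans (@cvg_within_filter _ _ _ _ _ _ (`[0, 1] `*` [set: V]) H).
by apply: near_eq_cvg; rewrite near_withinE; near=> u => -[/= uI _]; rewrite clamp01_id.
Unshelve. all: by end_near. Qed.

Lemma is_pd_time_derive (F : R -> V -> W) (v : W) t x : t \in `[0, 1] ->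
  (forall j, is_pd None (fun t x => F t x 0 j) t x (v 0 j)) ->
  time_quotient (F ^~ x) t s @[s --> within `[0, 1] t^'] --> v.
Proof.
move=> tI Fv; apply: cvg_row => j.
have [q [qv Fq]] := Fv j.
apply: (@cvg_trans _ (q (s - t) @[s --> within `[0, 1] t^'])).
  apply: near_eq_cvg; rewrite near_withinE near_withinE; near=> s => st sI.
  rewrite /time_quotient !mxE; have := Fq (s - t); rewrite /admissible /at_pair /= subrKC => -> //.
  by rewrite addrAC subrr add0r mulKf // subr_eq0.
move=> A /qv; rewrite /within /= !nbhs_filterE => HA.
have {}HA : \forall h \near (0 : R), t + h \in `[0, 1] -> A (q h) by exact: HA.
have H : \forall s \near t, t + (s - t) \in `[0, 1] -> A (q (s - t)).
  by rewrite (near_shift 0) /=; apply: filterS HA => h; rewrite /= subr0 addrK.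
have {}H : \forall s \near t, s != t -> s \in `[0, 1] -> A (q (s - t)).
  by apply: filterS H => s; rewrite subrKC => + _.
exact: H.
Unshelve. all: by end_near. Qed.

Lemma ck_differentiable_row U (F : R -> V -> W) t x : open U ->
  (forall j, ck U 1 (fun t x => F t x 0 j)) -> t \in `[0, 1] -> U x -> differentiable (F t) x.
Proof.
move=> oU kF tI Ux.
have -> : F t = \sum_(j < p) (fun y => F t y 0 j *: (delta_mx 0 j : W)).
  by apply/funext => y; rewrite fct_sumE [LHS]row_sum_delta.
apply: differentiable_sum => j; apply: differentiableZl.
exact: (ck_differentiable oU (kF j) tI Ux).1.
Qed.

Lemma derive_row U (F : R -> V -> W) t x v j : open U ->
  (forall j, ck U 1 (fun t x => F t x 0 j)) -> t \in `[0, 1] -> U x ->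
  'D_v (F t) x 0 j = \sum_l v 0 l * pd (Some l) (fun t x => F t x 0 j) t x.
Proof.
move=> oU kF tI Ux; have dF := ck_differentiable_row oU kF tI Ux.
by rewrite (derive_mx (diff_derivable (v := v) dF)) mxE (ck_derive v oU (kF j) tI Ux).
Qed.

(** Continuous partial derivatives give total differentiability, and the derivative along v is then
    the combination of the partial ones with the coordinates of v. *)
Lemma ck_Ck_path k (F : R -> V -> W) : (forall j, ck setT k (fun t x => F t x 0 j)) -> Ck_path k F.
Proof.
elim: k F => [|k IH] F kF.
  by split => //; apply: jcont_path => j t x; exact: ck_jcont (kF j) _.
have oT : open [set: V] by exact: openT.
have k1 j : ck setT 1 (fun t x => F t x 0 j).
  exact: ck_le (kF j).
have tq t x : t \in `[0, 1] -> time_quotient (F ^~ x) t s @[s --> within `[0, 1] t^'] -->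
    \row_j pd None (fun t x => F t x 0 j) t x.
  by move=> tI; apply: is_pd_time_derive => // j; rewrite mxE; exact: ck_is_pd (kF j) tI _.
split; first by apply: jcont_path => j t x; exact: ck_jcont (kF j) _.
split.
- move=> t tI x; split; first exact: ck_differentiable_row oT k1 tI _.
  by apply/cvg_ex; exists (\row_j pd None (fun t x => F t x 0 j) t x); exact: tq.
- apply: IH => j; apply: (ck_ext oT _ (ck_pd None (kF j))) => t x tI _.
  rewrite /path_dot /time_derive.
  have -> : lim (time_quotient (F ^~ x) t s @[s --> within `[0, 1] t^']) =
    \row_j pd None (fun t x => F t x 0 j) t x.
    have PF := time_filter_proper tI.
    apply: cvg_lim; [exact: norm_hausdorff|exact: tq].
  by rewrite mxE.
- move=> v; apply: IH => j.
  apply: (@ck_ext _ _ _ _ (fun t x => \sum_l v 0 l * pd (Some l) (fun t x => F t x 0 j) t x) _ oT).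
    by move=> t x tI _; rewrite (derive_row v j oT k1 tI).
  by apply: ck_sum => // l _; apply: ckZ => //; exact: ck_pd.
Qed.

Lemma Ck_path_Ck k (F : R -> V -> W) t : t \in `[0, 1] -> Ck_path k F -> Ck k (F t).
Proof.
move=> tI; elim: k F => [|k IH] F [cF dF] /=.
  move=> x; apply: (@cvg_row _ _ _ (nbhs x) (nbhs_filter x)) => j.
  have := @path_jcont R m 1 p F 0 j cF t x; rewrite /jcont (clamp01_id tI) => cj.
  have H := @cvg_comp _ _ _ (fun y : V => (t, y) : R * V)
    (fun p : R * V => F (clamp01 p.1) p.2 0 j) (nbhs x) (nbhs ((t, x) : R * V)) _ _ cj.
  apply: cvg_trans (H _); last first.
    by apply: (@cvg_pair _ _ _ (nbhs x) (nbhs t) (nbhs x)); [exact: cvg_cst|exact: cvg_id].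
  by apply: near_eq_cvg; apply: nearW => y; rewrite /= (clamp01_id tI).
have [dFt _ kD] := dF; split; first by move=> x; exact: (dFt t tI x).1.
by move=> v; exact: (IH _ (kD v)).
Qed.

End CkToDefs.

(** * Time reversal and the inverse of the flow *)

Section TimeChange.
Context {R : realType} {m : nat}.
Local Notation V := 'rV[R]_m.

Lemma ck_time_affine U k (F : R -> V -> R) (a b : R) : open U ->
  (forall s, s \in `[0, 1] -> a + b * s \in `[0, 1]) -> ck U k F ->
  ck U k (fun s x => F (a + b * s) x).
Proof.
move=> oU ab.
have cj (G : R -> V -> R) t x : ck U 0 G -> U x -> jcont (fun s x => G (a + b * s) x) t x.
  move=> kG Ux; have := @ck_jcont R m U 0 G (a + b * clamp01 t) x kG Ux.
  rewrite /jcont (clamp01_id (ab _ (clamp01_itv t))) => cG.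
  apply: cvg_trans (@cvg_comp _ _ _ (fun p : R * V => (a + b * clamp01 p.1, p.2) : R * V)
    (fun p : R * V => G (clamp01 p.1) p.2) _ (nbhs ((a + b * clamp01 t, x) : R * V)) _ _ cG).
    by apply: near_eq_cvg; apply: nearW => p /=; rewrite (clamp01_id (ab _ (clamp01_itv p.1))).
  apply: (@cvg_pair _ _ _ (nbhs ((t, x) : R * V)) (nbhs (a + b * clamp01 t)) (nbhs x)).
    apply: cvgD; first exact: cvg_cst.
    apply: cvgM; first exact: cvg_cst.
    apply: (@cvg_comp _ _ _ fst clamp01 _ (nbhs t)); first exact: cvg_fst.
    exact: clamp01_continuous.
  exact: cvg_snd.
elim: k F => [|k IH] F kF; first by split => // t x; exact: cj.
apply: (@ck_intro _ _ _ _ _ (fun d => if d is Some l then fun s x => pd (Some l) F (a + b * s) x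
  else fun s x => b * pd None F (a + b * s) x)) => //.
- by move=> t x; apply: cj; exact: ck_le kF.
- move=> [l|] s x sI Ux.
    by have [q [qv Fq]] := ck_is_pd (Some l) kF (ab s sI) Ux; exists q.
  have [q [qv Fq]] := ck_is_pd None kF (ab s sI) Ux.
  exists (fun h => b * q (b * h)); split.
    apply: cvgM; first exact: cvg_cst.
    move=> A nA; have HA : \forall h \near (0 : R), @admissible R m None (a + b * s) h -> A (q h).
      exact: (qv A nA).
    have cb : b * h @[h --> (0 : R)] --> (0 : R).
      by rewrite -[X in _ --> X](mulr0 b); apply: cvgM; [exact: cvg_cst|exact: cvg_id].
    have {}HA : \forall h \near (0 : R), @admissible R m None (a + b * s) (b * h) -> A (q (b * h)).
      exact: (cb _ HA).
    have {}HA : \forall h \near (0 : R), @admissible R m None s h -> A (q (b * h)).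
      apply: filterS HA => h + ah; apply; rewrite /admissible /= -addrA -mulrDr; exact: ab.
    exact: HA.
  move=> h ah; rewrite /at_pair /= mulrDr addrA.
  rewrite (_ : F _ x = at_pair F (move None (b * h) (a + b * s, x))) // Fq; first by ring.
  by rewrite /admissible /= -addrA -mulrDr; exact: ab.
- by move=> [l|]; [|apply: ckZ => //]; apply: IH; exact: ck_pd.
Qed.

Lemma is_derive_affine (f : R -> R) (a b s v : R) : is_derive (a + b * s) 1 f v ->
  is_derive s 1 (fun s => f (a + b * s)) (b * v).
Proof.
move=> fv; rewrite mulrC.
apply: (@is_derive1_comp R f (fun s => a + b * s) s v b fv).
have H : is_derive s 1 (fun s : R => b * s) b.
  by apply: is_derive_eq; rewrite /GRing.scale /= mulr1.
by have := is_deriveD (is_derive_cst (a : R) s (1 : R)) H; rewrite add0r.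
Qed.

(** The trajectories of X run backward from time t to 0, with time rescaled to [0, 1]: the curve s
    |-> phi (t - t s) x is a solution. For t in [0, 1] the rescaling does not enlarge the field, so
    its growth bound survives. *)
Definition reversed (X : R -> V -> V) (t s : R) (x : V) : V := (- t) *: X (t + (- t) * s) x.

Lemma enormZ (c : R) (x : V) : enorm (c *: x) = `|c| * enorm x.
Proof.
rewrite /enorm -[`|c|]sqrtr_sqr -sqrtrM ?sqr_ge0 //.
by rewrite mulr_sumr; congr Num.sqrt; apply: eq_bigr => i _; rewrite mxE exprMn.
Qed.

(** The inverse of phi t is the time one map of the reversed flow, so its smoothness comes from the
    regularity of flows. Each cancellation is uniqueness of solutions with a common starting
    point. *)
Lemma flow_inverse (X phi : R -> V -> V) (A t : R) : 0 <= A ->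
  (forall i, smooth_on setT (fun t x => X t x 0 i)) -> flow X phi ->
  (forall t x, t \in `[0, 1] -> enorm (X t x) <= A * growth (enorm x)) -> t \in `[0, 1] ->
  exists theta : R -> V -> V, [/\ smooth_path theta,
    cancel (phi t) (theta 1) & cancel (theta 1) (phi t)].
Proof.
move=> A0 sX fphi gX tI; have /itv01P[t0 t1] := tI.
have oT : open [set: V] by exact: openT.
have tr s : s \in `[0, 1] -> t + - t * s \in `[0, 1].
  by move=> /itv01P[s0 s1]; apply/itv01P; split; nra.
have ts s : s \in `[0, 1] -> 0 + t * s \in `[0, 1].
  by move=> /itv01P[s0 s1]; apply/itv01P; split; nra.
have sY i : smooth_on setT (fun s x => reversed X t s x 0 i).
  move=> k; apply: (@ck_ext _ _ _ _ (fun s x => - t * X (t + - t * s) x 0 i) _ oT).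
    by move=> s x _ _; rewrite mxE.
  by apply: ckZ => //; apply: (@ck_time_affine setT k (fun t x => X t x 0 i)) => //; exact: sX.
have gY s x : s \in `[0, 1] -> enorm (reversed X t s x) <= A * growth (enorm x).
  move=> sI; rewrite enormZ normrN (ger0_norm t0); apply: le_trans (gX _ _ (tr s sI)).
  by rewrite ler_piMl // enorm_ge0.
have [theta ftheta] := flow_exists A0 (fun i => sY i 1%N) gY.
have I0 : (0 : R) \in `[0, 1] by apply/itv01P; rewrite lexx ler01.
have I1 : (1 : R) \in `[0, 1] by apply/itv01P; rewrite lexx ler01.
have canA x : theta 1 (phi t x) = x.
  have sc : solves (reversed X t) (fun s => phi (t + - t * s) x).
    move=> i s sI; rewrite mxE.
    have H := flow_solves fphi x i (tr s sI).
    exact: (@is_derive_affine (fun t => phi t x 0 i) t (- t) s _ H).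
  have := @solution_unique R m (reversed X t) (theta ^~ (phi t x)) _ (fun i => sY i 1%N)
    (flow_solves ftheta _) sc.
  rewrite (flow0 ftheta) mulr0 addr0 => /(_ erefl 1 I1) ->.
  by rewrite mulr1 subrr (flow0 fphi).
exists theta; split => //.
  by move=> k; apply: ck_Ck_path => j; exact: flow_ck sY ftheta j.
move=> y.
(* Both s |-> theta (1 - s) y and s |-> phi (t s) (theta 1 y) are solutions for this rescaled
   forward field, and both start at theta 1 y; at s = 1 they are y and phi t (theta 1 y). *)
pose Z s x := t *: X (0 + t * s) x.
have sZ i : ck setT 1 (fun s x => Z s x 0 i).
  apply: (@ck_ext _ _ _ _ (fun s x => t * X (0 + t * s) x 0 i) _ oT).
    by move=> s x _ _; rewrite mxE.
  by apply: ckZ => //; apply: (@ck_time_affine setT 1 (fun t x => X t x 0 i)) => //; exact: sX.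
have sd : solves Z (fun s => theta (1 + -1 * s) y).
  move=> i s /itv01P[s0 s1].
  have sI : 1 + -1 * s \in `[0, 1] by apply/itv01P; split; lra.
  have H := flow_solves ftheta y i sI.
  have := @is_derive_affine (fun t => theta t y 0 i) 1 (-1) s _ H.
  rewrite /Z /reversed !mxE (_ : t + - t * (1 + -1 * s) = 0 + t * s); last by ring.
  by rewrite mulrA (_ : -1 * - t = t) //; ring.
have se : solves Z (fun s => phi (0 + t * s) (theta 1 y)).
  move=> i s sI; rewrite mxE.
  have H := flow_solves fphi (theta 1 y) i (ts s sI).
  exact: (@is_derive_affine (fun t => phi t (theta 1 y) 0 i) 0 t s _ H).
have := solution_unique sZ sd se.
rewrite !mulr0 !addr0 (flow0 fphi) => /(_ erefl 1 I1).
by rewrite mulN1r subrr (flow0 ftheta) add0r mulr1 => <-.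
Qed.

End TimeChange.

(** * Cut-off functions *)

Section RealSmooth.
Context {R : realType}.
Implicit Types (f g : R -> R) (O : set R) (k n : nat) (c u : R).

(** A family closed under differentiation is smooth as soon as each member is continuous and has its
    derivative in the family. It is applied to the multiples of negative powers of u and of its
    square root. *)
Lemma ck_real_family (I : Type) O (f f' : I -> R -> R) (next : I -> I) :
  (forall i u, O u -> {for u, continuous (f i)}) ->
  (forall i u, O u -> is_derive u 1 (f i) (f (next i) u)) ->
  forall k i, ck_real O k (f i).
Proof.
move=> cf df; elim=> [|k IH] i; first by split => // u; exact: cf.
by split => [u|]; [exact: cf|exists (f (next i)); split => // u; exact: df].
Qed.

Lemma is_derive_continuous f u v : is_derive u 1 f v -> {for u, continuous f}.
Proof. by move=> [/derivable1_diffP df _]; exact: differentiable_continuous. Qed.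

Lemma is_derive_exprn f n u v : is_derive u 1 f v ->
  is_derive u 1 (fun u => f u ^+ n.+1) ((n.+1%:R * f u ^+ n) *: v).
Proof.
move=> df; have := @is_deriveX _ _ f n.+1 u 1 v df.
rewrite (_ : f ^+ n.+1 = (fun u => f u ^+ n.+1)) //; apply/funext => x.
by elim: (n.+1) => [|k IH]; rewrite ?expr0 // !exprS -IH.
Qed.

Lemma is_derive_inv (u : R) : u != 0 -> is_derive u 1 (fun u : R => u^-1) (- u ^- 2).
Proof.
move=> u0; have := @is_deriveV R id u 1 1 u0 (is_derive_id u 1).
by rewrite /GRing.scale /= mulr1.
Qed.

Lemma ck_real_inv k : ck_real [set u | u != 0] k (fun u => u^-1).
Proof.
pose f (cn : R * nat) (u : R) := cn.1 * u^-1 ^+ cn.2.+1.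
have df (cn : R * nat) u : u != 0 -> is_derive u 1 (f cn) (f (- cn.1 * cn.2.+1%:R, cn.2.+1) u).
  move=> u0.
  have -> : f (- cn.1 * cn.2.+1%:R, cn.2.+1) u = cn.1 *: ((cn.2.+1%:R * u^-1 ^+ cn.2) *: (- u ^- 2)).
    by rewrite /f /GRing.scale /= 2!exprS -exprVn; ring.
  apply: (@is_deriveZ _ _ _ (fun u : R => u^-1 ^+ cn.2.+1)).
  exact: is_derive_exprn (is_derive_inv u0).
have cf cn (u : R) : u != 0 -> {for u, continuous (f cn)}.
  by move=> u0; exact: is_derive_continuous (df cn u u0).
have -> : (fun u : R => u^-1) = f (1, 0%N) by apply/funext => u; rewrite /f /= mul1r expr1.
exact: (@ck_real_family (R * nat) [set u : R | u != 0] f f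
  (fun cn => (- cn.1 * cn.2.+1%:R, cn.2.+1)) cf df).
Qed.

Lemma ck_real_sqrt k : ck_real [set u : R | 0 < u] k Num.sqrt.
Proof.
pose f (cn : R * nat) (u : R) := cn.1 * (Num.sqrt u)^-1 ^+ cn.2.+1.
have ds (u : R) : 0 < u -> is_derive u 1 (fun u : R => (Num.sqrt u)^-1)
    (- (Num.sqrt u) ^- 2 *: (2 * Num.sqrt u)^-1).
  move=> u0; apply: is_deriveV; first by rewrite gt_eqF // sqrtr_gt0.
  exact: is_derive1_sqrt.
have df (cn : R * nat) (u : R) : 0 < u ->
    is_derive u 1 (f cn) (f (- cn.1 * cn.2.+1%:R / 2, cn.2.+2) u).
  move=> u0; have s0 : Num.sqrt u != 0 by rewrite gt_eqF // sqrtr_gt0.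
  have -> : f (- cn.1 * cn.2.+1%:R / 2, cn.2.+2) u =
      cn.1 *: ((cn.2.+1%:R * (Num.sqrt u)^-1 ^+ cn.2) *: (- (Num.sqrt u) ^- 2 *: (2 * Num.sqrt u)^-1)).
    by rewrite /f /GRing.scale /= 3!exprS -exprVn invfM; field.
  apply: (@is_deriveZ _ _ _ (fun u : R => (Num.sqrt u)^-1 ^+ cn.2.+1)).
  exact: is_derive_exprn (ds u u0).
have cf cn (u : R) : 0 < u -> {for u, continuous (f cn)} by move=> u0; exact: is_derive_continuous (df cn u u0).
(* The square root itself is outside the family f; its derivative is the member of index (1 / 2,
   0). *)
case: k => [|k]; first by split => // u _; exact: sqrt_continuous.
split; first by move=> u _; exact: sqrt_continuous.
exists (f (1 / 2, 0%N)); split.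
  move=> u u0; have -> : f (1 / 2, 0%N) u = (2 * Num.sqrt u)^-1 by rewrite /f /= expr1 invfM mul1r.
  exact: is_derive1_sqrt.
exact: (@ck_real_family (R * nat) [set u : R | 0 < u] f f (fun cn => (- cn.1 * cn.2.+1%:R / 2, cn.2.+2)) cf df).
Qed.

Lemma ck_realD O k f g : ck_real O k f -> ck_real O k g -> ck_real O k (fun u => f u + g u).
Proof.
elim: k f g => [|k IH] f g [cf df] [cg dg].
  by split => // u Ou; apply: cvgD; [exact: cf|exact: cg].
split; first by move=> u Ou; apply: cvgD; [exact: cf|exact: cg].
case: df => f' [df kf]; case: dg => g' [dg kg].
exists (fun u => f' u + g' u); split; last exact: IH.
by move=> u Ou; apply: is_deriveD; [exact: df|exact: dg].
Qed.

Lemma ck_realZ O k c f : ck_real O k f -> ck_real O k (fun u => c * f u).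
Proof.
elim: k f => [|k IH] f [cf df].
  by split => // u Ou; apply: cvgM; [exact: cvg_cst|exact: cf].
split; first by move=> u Ou; apply: cvgM; [exact: cvg_cst|exact: cf].
case: df => f' [df kf]; exists (fun u => c * f' u); split; last exact: IH.
by move=> u Ou; apply: (@is_deriveZ _ _ _ f c); exact: df.
Qed.

(* All derivatives of [exp (- 1 / u)] are combinations of these functions. *)
Definition flat n u : R := if 0 < u then u^-1 ^+ n * expR (- u^-1) else 0.

(** The exponential series gives exp v >= v ^ (n + 1) / (n + 1)! at v = 1 / u, one power more than
    needed, which leaves the factor |u| and hence continuity at 0. *)
Lemma flat_le n u : `|flat n u| <= n.+1`!%:R * `|u|.
Proof.
rewrite /flat; case: ltP => u0; last by rewrite normr0 mulr_ge0.
have v0 : 0 < u^-1 by rewrite invr_gt0.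
rewrite ger0_norm; last by rewrite mulr_ge0 ?expR_ge0 // exprn_ge0 // ltW.
rewrite (gtr0_norm u0) expRN -[leRHS]mulr1.
have F0 : 0 < n.+1`!%:R :> R by rewrite ltr0n fact_gt0.
rewrite ler_pdivrMr ?expR_gt0 //.
have := @expR_ge1Dxn R u^-1 n (ltW v0).
have -> : u^-1 ^+ n = u * u^-1 ^+ n.+1 by rewrite exprS mulrA divff ?mul1r // gt_eqF.
set p := u^-1 ^+ n.+1; have p0 : 0 <= p by rewrite exprn_ge0 // ltW.
move=> h; have {}h : p <= n.+1`!%:R * expR u^-1.
  by rewrite mulrC -ler_pdivrMr //; lra.
rewrite mulr1 [n.+1`!%:R * u]mulrC -mulrA ler_wpM2l //; exact: ltW.
Qed.

(** The delicate point is 0, where [flat n u] equals u times [flat n.+1 u]: the Carathéodory factor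
    is the next function of the family, which tends to 0 by [flat_le]. *)
Lemma flat_is_derive n (u : R) : is_derive u 1 (flat n) (- n%:R * flat n.+1 u + flat n.+2 u).
Proof.
have [u0|u0|->] := ltgtP u 0.
- have -> : - n%:R * flat n.+1 u + flat n.+2 u = 0.
    by rewrite /flat ltNge (ltW u0) /= mulr0 addr0.
  apply: near_eq_is_derive (is_derive_cst (0 : R) u (1 : R)).
  have : \forall v \near u, v < 0 by exact: lt_nbhsl.
  by apply: filterS => v v0; rewrite /flat ltNge (ltW v0).
- have d1 : is_derive u 1 (fun v : R => expR (- v^-1)) (expR (- u^-1) * - (- u ^- 2)).
    apply: (@is_derive1_comp R expR (fun v => - v^-1)).
    by apply: is_deriveN; apply: is_derive_inv; rewrite gt_eqF.
  have d2 : is_derive u 1 (fun v : R => v^-1 ^+ n) (n%:R * u^-1 ^+ n.-1 * - u ^- 2).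
    case: n => [|n] /=.
      rewrite !mul0r (_ : (fun v : R => v^-1 ^+ 0) = cst 1); last by apply/funext => v; rewrite expr0.
      exact: is_derive_cst.
    by apply: is_derive_exprn; apply: is_derive_inv; rewrite gt_eqF.
  have -> : - n%:R * flat n.+1 u + flat n.+2 u =
     u^-1 ^+ n *: (expR (- u^-1) * - (- u ^- 2)) + expR (- u^-1) *: (n%:R * u^-1 ^+ n.-1 * - u ^- 2).
    rewrite /flat u0 /GRing.scale /= opprK -exprVn; case: (n) => [|k] /=.
      by rewrite oppr0 !mul0r mulr0 add0r addr0 expr0 mul1r mulrC.
    by rewrite !exprS; ring.
  apply: near_eq_is_derive (is_deriveM d2 d1).
  have : \forall v \near u, 0 < v by exact: lt_nbhsr.
  by apply: filterS => v v0; rewrite /flat v0.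
have f0 k : flat k 0 = 0 by rewrite /flat ltxx.
rewrite !f0 mulr0 addr0; apply/is_derive1_caratheodory; exists (flat n.+1); split => //.
  move=> z; rewrite f0 !subr0 /flat; case: ltP => z0; last by rewrite mul0r.
  by rewrite exprS; field; rewrite gt_eqF.
apply/cvgrPdist_le => e e0.
have F0 : 0 < n.+2`!%:R :> R by rewrite ltr0n fact_gt0.
apply/nbhs_ballP; exists (e / n.+2`!%:R); first by rewrite /= divr_gt0.
move=> z; rewrite /ball_ /= sub0r normrN => ze; rewrite f0 sub0r normrN.
apply: le_trans (flat_le _ _) _; rewrite mulrC -ler_pdivlMr //; exact: ltW.
Qed.

Lemma ck_real_flat k n : ck_real setT k (flat n).
Proof.
elim: k n => [|k IH] n; first by split => // u _; exact: is_derive_continuous (flat_is_derive n u).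
split; first by move=> u _; exact: is_derive_continuous (flat_is_derive n u).
exists (fun u => - n%:R * flat n.+1 u + flat n.+2 u); split.
  by move=> u _; exact: flat_is_derive.
by apply: ck_realD => //; exact: ck_realZ.
Qed.

Definition step u : R := flat 0 u / (flat 0 u + flat 0 (1 - u)).

Lemma flat_ge0 u : 0 <= flat 0 u.
Proof. by rewrite /flat; case: ltP => // _; rewrite expr0 mul1r expR_ge0. Qed.

Lemma step_den_gt0 u : 0 < flat 0 u + flat 0 (1 - u).
Proof.
have [u0|u0] := ltP 0 u.
  by rewrite ltr_pwDl ?flat_ge0 // /flat u0 expr0 mul1r expR_gt0.
by rewrite ltr_pwDr ?flat_ge0 // /flat expr0 mul1r subr_gt0 (le_lt_trans u0) // expR_gt0.
Qed.

Lemma step0 u : u <= 0 -> step u = 0.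
Proof. by move=> u0; rewrite /step /flat ltNge u0 /= mul0r. Qed.

Lemma step1 u : 1 <= u -> step u = 1.
Proof.
move=> u1; have H := step_den_gt0 u; rewrite /step.
have E : flat 0 (1 - u) = 0 by rewrite /flat subr_gt0 ltNge u1.
by rewrite E addr0 in H *; rewrite divff // gt_eqF.
Qed.

Lemma step_itv u : 0 <= step u <= 1.
Proof.
have H := step_den_gt0 u; rewrite /step divr_ge0 ?flat_ge0 ?(ltW H) //=.
by rewrite ler_pdivrMr // mul1r lerDl flat_ge0.
Qed.

End RealSmooth.

Section SmoothScalars.
Context {R : realType} {m : nat}.
Local Notation V := 'rV[R]_m.
Implicit Types (F G : R -> V -> R) (U : set V).

Lemma ck_inv U k F : open U -> ck U k F ->
  (forall t x, t \in `[0, 1] -> U x -> F t x != 0) -> ck U k (fun t x => (F t x)^-1).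
Proof. by move=> oU kF F0; apply: (ck_comp1 oU (ck_real_inv k) kF). Qed.

Lemma ck_sqrt U k F : open U -> ck U k F ->
  (forall t x, t \in `[0, 1] -> U x -> 0 < F t x) -> ck U k (fun t x => Num.sqrt (F t x)).
Proof. by move=> oU kF F0; apply: (ck_comp1 oU (ck_real_sqrt k) kF). Qed.

Lemma ck_step U k F : open U -> ck U k F -> ck U k (fun t x => step (F t x)).
Proof.
move=> oU kF.
have k1 : ck U k (fun t x => flat 0 (F t x)) by apply: (ck_comp1 oU (ck_real_flat k 0) kF).
have k2 : ck U k (fun t x => flat 0 (1 - F t x)).
  by apply: (ck_comp1 oU (ck_real_flat k 0)) => //; apply: ckB => //; exact: ck_cst.
apply: ckM => //; apply: ck_inv => //; first exact: ckD.
by move=> t x _ _; rewrite gt_eqF // step_den_gt0.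
Qed.

Lemma is_pd_sum d (I : Type) (r : seq I) (P : pred I) (F : I -> R -> V -> R) (v : I -> R) t x :
  (forall i, P i -> is_pd d (F i) t x (v i)) ->
  is_pd d (fun t x => \sum_(i <- r | P i) F i t x) t x (\sum_(i <- r | P i) v i).
Proof.
move=> dF; elim: r => [|a r IH].
  rewrite big_nil (_ : (fun _ _ => _) = (fun _ _ => 0)); first exact: is_pd_cst.
  by apply/funext => s; apply/funext => y; rewrite big_nil.
rewrite big_cons; case Pa: (P a).
  rewrite (_ : (fun _ _ => _) = (fun t x => F a t x + \sum_(i <- r | P i) F i t x)).
    by apply: is_pdD => //; exact: dF.
  by apply/funext => s; apply/funext => y; rewrite big_cons Pa.
rewrite (_ : (fun _ _ => _) = (fun t x => \sum_(i <- r | P i) F i t x)) //.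
by apply/funext => s; apply/funext => y; rewrite big_cons Pa.
Qed.

Lemma int01_cst (c : R) : int01 (fun _ => c) = c.
Proof.
have H (s : R) : s \in `[0, 1] -> is_derive s 1 (fun s : R => s * c) c.
  move=> _; have := @is_deriveM R R id (cst c) s 1 1 0 (is_derive_id s 1) (is_derive_cst c s 1).
  by rewrite scaler0 add0r /GRing.scale /= mulr1.
by rewrite (FTC01 (@cst_continuous _ _ c) H) mul1r mul0r subr0.
Qed.

Lemma continuous_bigsum (I : Type) (r : seq I) (f : I -> R -> R) :
  (forall i, continuous (f i)) -> continuous (fun s => \sum_(i <- r) f i s).
Proof.
move=> cf s; elim: r => [|a r IH].
  rewrite (_ : (fun s => _) = (fun=> 0)); first exact: cst_continuous.
  by apply/funext => u; rewrite big_nil.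
rewrite (_ : (fun s => _) = (fun s => f a s + \sum_(i <- r) f i s)); first by apply: cvgD; [exact: cf|].
by apply/funext => u; rewrite big_cons.
Qed.

Lemma int01_sum (I : Type) (r : seq I) (f : I -> R -> R) :
  (forall i, continuous (f i)) ->
  int01 (fun s => \sum_(i <- r) f i s) = \sum_(i <- r) int01 (f i).
Proof.
move=> cf; elim: r => [|a r IH].
  rewrite big_nil (_ : (fun s => _) = (fun=> 0)) ?int01_cst //.
  by apply/funext => s; rewrite big_nil.
rewrite big_cons -IH -int01D //; last exact: continuous_bigsum.
by congr int01; apply/funext => s; rewrite big_cons.
Qed.

End SmoothScalars.

Section StepDerivative.
Context {R : realType}.

Lemma step_is_derive : exists2 f : R -> R, continuous f & forall u : R, is_derive u 1 step (f u).
Proof.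
have f1 n (u : R) := flat_is_derive n u.
pose f n (u : R) : R := - n%:R * flat n.+1 u + flat n.+2 u.
have cflat n : continuous (@flat R n) by move=> u; exact: is_derive_continuous (f1 n u).
have cflat1 n : continuous (fun u : R => flat n (1 - u)).
  move=> u; apply: (@continuous_comp _ _ _ (fun u : R => 1 - u) (flat n)); last exact: cflat.
  by apply: cvgB; [exact: cvg_cst|exact: cvg_id].
have cf n : continuous (f n).
  by move=> u; apply: cvgD; [apply: cvgM; [exact: cvg_cst|exact: cflat]|exact: cflat].
pose D (u : R) : R := flat 0 u + flat 0 (1 - u).
have D0 u : D u != 0 by rewrite gt_eqF // step_den_gt0.
have dr (u : R) : is_derive u 1 (fun u : R => 1 - u) (-1).
  rewrite -[X in is_derive _ _ _ X]sub0r.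
  exact: is_deriveB.
have dD (u : R) : is_derive u 1 D (f 0%N u + f 0%N (1 - u) * -1).
  by apply: is_deriveD => //; exact: (@is_derive1_comp R (flat 0) (fun u => 1 - u)).
have cD : continuous D by move=> u; exact: is_derive_continuous (dD u).
exists (fun u => flat 0 u * (- (D u) ^- 2 * (f 0%N u + f 0%N (1 - u) * -1)) + (D u)^-1 * f 0%N u).
  move=> u; apply: cvgD.
    apply: cvgM; first exact: cflat.
    apply: cvgM.
      by apply: cvgN; apply: cvgV; rewrite ?expf_neq0 //; exact: (cvgM (cD u) (cD u)).
    apply: cvgD; first exact: cf.
    apply: cvgM; last exact: cvg_cst.
    apply: (@continuous_comp _ _ _ (fun u : R => 1 - u) (f 0%N)); last exact: cf.
    by apply: cvgB; [exact: cvg_cst|exact: cvg_id].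
  by apply: cvgM; [apply: cvgV; [exact: D0|exact: cD]|exact: cf].
by move=> u; have := is_deriveM (f1 0%N u) (is_deriveV (D0 u) (dD u)).
Qed.

(** The cut-off between the poles is [step] of 3/2 minus a colatitude in [0, 2], so its argument
    lies in [-1/2, 3/2], inside this compact interval. *)
Lemma step_derive_bounded : exists2 C : R, 0 <= C &
  forall u v : R, - 1 <= u <= 2 -> is_derive u 1 step v -> `|v| <= C.
Proof.
have [f cf df] := step_is_derive.
have [||c /itvP c1 cmax] := @EVT_max R (fun u => `|f u|) (-1) 2.
- by lra.
- apply: continuous_subspaceT => u.
  by apply: (@continuous_comp _ _ _ f (fun v : R => `|v|)); [exact: cf|exact: norm_continuous].
exists `|f c| => // u v u12 dv.
have -> : v = f u by rewrite -(@derive_val _ _ _ _ _ _ _ dv) (@derive_val _ _ _ _ _ _ _ (df u)).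
by apply: cmax; rewrite in_itv.
Qed.

End StepDerivative.

(** * A primitive of a closed 2-form *)

Section FirstCoordinate.
Context {R : realType} {m : nat}.
Local Notation V := 'rV[R]_m.
Local Notation W := 'rV[R]_(1 + m).
Implicit Types (U : set V) (F : R -> W -> R) (t : R).

Definition first_dir : option 'I_(1 + m) := Some (lshift m ord0).

Lemma pt_first (s : R) (x : V) : pt s x 0 (lshift m ord0) = s.
Proof. by rewrite /pt row_mxEl mxE. Qed.

Lemma pt_rest (s : R) (x : V) l : pt s x 0 (rshift 1 l) = x 0 l.
Proof. by rewrite /pt row_mxEr. Qed.

Lemma pt_line (s : R) (x : V) : pt 0 x + s *: evec (lshift m ord0) = pt s x.
Proof.
apply/rowP => i; rewrite !mxE; case: (fintype.split_ordP i) => j ->.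
  by rewrite !ord1 !mxE !eqxx mulr1 add0r.
by rewrite eq_rlshift mulr0 addr0.
Qed.

Lemma is_derive_first F t (s : R) (x : V) v : is_pd first_dir F t (pt s x) v ->
  is_derive s 1 (fun s => F t (pt s x)) v.
Proof.
move=> H; have E s' : move first_dir s' (t, pt 0 x) = (t, pt s' x) by rewrite /move /= pt_line.
have := @is_pd_is_derive R _ first_dir F t (pt 0 x) s v; rewrite E /=.
have -> : (fun s => at_pair F (move first_dir s (t, pt 0 x))) = (fun s => F t (pt s x)).
  by apply/funext => s'; rewrite E.
by apply=> //; exact: (@filterT _ (nbhs (0 : R)) (nbhs_filter _)).
Qed.

Lemma int_first_pd U F t (x : V) : open U -> ck (cylinder U) 1 F -> t \in `[0, 1] -> U x ->
  int_first (pd first_dir F) t x = F t (pt 1 x) - F t (pt 0 x).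
Proof.
move=> oU kF tI Ux; apply: (@FTC01 _ _ (fun s => F t (pt s x))).
  have := @pt_continuous1 R m U (pd first_dir F) t x (fun t z => ck_jcont (ck_pd first_dir kF)) Ux.
  by rewrite clamp01_id.
move=> s _; apply: is_derive_first; apply: ck_is_pd kF tI _.
by rewrite /cylinder /= /pt row_mxKr.
Qed.

Lemma cylinderT : cylinder (@setT V) = setT.
Proof. by apply/seteqP. Qed.

End FirstCoordinate.

Section RadialPrimitive.
Context {R : realType} {m : nat}.
Local Notation V := 'rV[R]_m.
Local Notation W := 'rV[R]_(1 + m).
Variable s : 'I_m -> 'I_m -> R -> V -> R.
Hypothesis smooth_s : forall i j, smooth_on setT (s i j).
Hypothesis anti_s : forall i j (t : R) (x : V), t \in `[0, 1] -> s i j t x = - s j i t x.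
Hypothesis closed_s : forall i j k (t : R) (x : V), t \in `[0, 1] ->
  pd (Some i) (s j k) t x + pd (Some j) (s k i) t x + pd (Some k) (s i j) t x = 0.

Let o : 'I_(1 + m) := lshift m ord0.

Implicit Types (t : R) (x : V) (z : W).

Definition dilation (l : 'I_m) (t : R) (z : W) : R := z 0 o * z 0 (rshift 1 l).

(* The integrand of the Poincaré homotopy operator for the contraction to the origin. *)
Definition radial_integrand (j : 'I_m) (t : R) (z : W) : R :=
  \sum_i z 0 o * (z 0 (rshift 1 i) * s i j t (\row_l dilation l t z)).

Definition radial_primitive (j : 'I_m) : R -> V -> R := int_first (radial_integrand j).

Lemma ck_dilation k l : ck setT k (dilation l).
Proof. by apply: ckM; [exact: openT|apply: ck_coord; exact: openT|apply: ck_coord; exact: openT]. Qed.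

Lemma ck_dilate k F : ck setT k F -> ck setT k (fun t z => F t (\row_l dilation l t z)).
Proof. by move=> kF; apply: ck_chain kF _ _ => //; [exact: openT|exact: openT|move=> j; exact: ck_dilation]. Qed.

Lemma ck_radial_integrand k j : ck setT k (radial_integrand j).
Proof.
apply: ck_sum; first exact: openT.
move=> i _; apply: ckM; [exact: openT|by apply: ck_coord; exact: openT|].
apply: ckM; [exact: openT|by apply: ck_coord; exact: openT|].
exact: ck_dilate (smooth_s i j k).
Qed.

Lemma smooth_radial_primitive j : smooth_on setT (radial_primitive j).
Proof.
by move=> k; apply: ck_int_first; [exact: openT|rewrite cylinderT; exact: ck_radial_integrand].
Qed.

Lemma is_pd_dilate F k t (z : W) : ck setT 1 F -> t \in `[0, 1] ->
  is_pd (Some (rshift 1 k)) (fun t z => F t (\row_l dilation l t z)) t z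
    (z 0 o * pd (Some k) F t (\row_l dilation l t z)).
Proof.
move=> kF tI.
have H l : is_pd (Some (rshift 1 k)) (dilation l) t z (z 0 o * (k == l)%:R).
  rewrite -[X in is_pd _ _ _ _ X]add0r -[X in is_pd _ _ _ _ (X + _)](mul0r (z 0 (rshift 1 l))).
  apply: is_pdM.
    have := is_pd_coord (Some (rshift 1 k)) o t z.
    by rewrite (inj_eq Some_inj) eq_rlshift.
  by have := is_pd_coord (Some (rshift 1 k)) (rshift 1 l) t z; rewrite (inj_eq Some_inj) eq_rshift.
have := is_pd_chain (openT) kF tI I H; rewrite /= mul0r add0r.
rewrite (bigD1 k) //= eqxx mulr1 big1 ?addr0 //.
by move=> l /negPf; rewrite eq_sym => ->; rewrite mulr0 mul0r.
Qed.

Lemma is_pd_dilate_first F t (z : W) : ck setT 1 F -> t \in `[0, 1] ->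
  is_pd (Some o) (fun t z => F t (\row_l dilation l t z)) t z
    (\sum_l z 0 (rshift 1 l) * pd (Some l) F t (\row_l dilation l t z)).
Proof.
move=> kF tI.
have H l : is_pd (Some o) (dilation l) t z (z 0 (rshift 1 l)).
  have := is_pdM (is_pd_coord (Some o) o t z) (is_pd_coord (Some o) (rshift 1 l) t z).
  by rewrite !(inj_eq Some_inj) eqxx eq_lrshift mul1r mulr0 addr0.
by have := is_pd_chain (openT) kF tI I H; rewrite /= mul0r add0r.
Qed.

Lemma is_pd_radial_integrand k j t z : t \in `[0, 1] ->
  is_pd (Some (rshift 1 k)) (radial_integrand j) t z
    (z 0 o * s k j t (\row_l dilation l t z)
     + z 0 o ^+ 2 * \sum_i z 0 (rshift 1 i) * pd (Some k) (s i j) t (\row_l dilation l t z)).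
Proof.
move=> tI.
have H i : is_pd (Some (rshift 1 k))
    (fun t z => z 0 o * (z 0 (rshift 1 i) * s i j t (\row_l dilation l t z))) t z
    (z 0 o * ((k == i)%:R * s i j t (\row_l dilation l t z)
      + z 0 (rshift 1 i) * (z 0 o * pd (Some k) (s i j) t (\row_l dilation l t z)))).
  have Ho : is_pd (Some (rshift 1 k)) (fun _ z => z 0 o) t z 0.
    have := is_pd_coord (Some (rshift 1 k)) o t z.
    by rewrite (inj_eq Some_inj) eq_rlshift.
  have Hi : is_pd (Some (rshift 1 k)) (fun _ z => z 0 (rshift 1 i)) t z (k == i)%:R.
    by have := is_pd_coord (Some (rshift 1 k)) (rshift 1 i) t z; rewrite (inj_eq Some_inj) eq_rshift.
  have := is_pdM Ho (is_pdM Hi (is_pd_dilate k z (smooth_s i j 1) tI)).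
  by rewrite mul0r add0r.
have := @is_pd_sum _ _ _ 'I_m (index_enum _) xpredT _ _ _ _ (fun i _ => H i).
rewrite -mulr_sumr big_split /=; congr is_pd.
rewrite mulrDr; congr (_ + _).
  rewrite (bigD1 k) //= eqxx mul1r big1 ?addr0 //.
  by move=> l /negPf; rewrite eq_sym => ->; rewrite mul0r.
rewrite expr2 -mulrA; congr (_ * _); rewrite mulr_sumr; apply: eq_bigr => i _.
by rewrite mulrCA.
Qed.

(** By closedness and antisymmetry, the exterior derivative of the integrand is the derivative in r
    of r ^ 2 s (r x), which is s (x) at r = 1 and 0 at r = 0. *)
Lemma radial_primitiveP k j t x : t \in `[0, 1] ->
  pd (Some k) (radial_primitive j) t x - pd (Some j) (radial_primitive k) t x = s k j t x.
Proof.
move=> tI; have kR i : ck (cylinder (@setT V)) 2 (radial_integrand i).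
  by rewrite cylinderT; exact: ck_radial_integrand.
have E i l : pd (Some i) (radial_primitive l) t x
    = int_first (pd (Some (rshift 1 i)) (radial_integrand l)) t x.
  by apply: pdE => //; apply: (@is_pd_int_first _ _ setT); [exact: openT|exact: ckS|done|done].
rewrite !E.
pose G (t : R) (z : W) := z 0 o ^+ 2 * s k j t (\row_l dilation l t z).
have kG : ck (cylinder (@setT V)) 1 G.
  rewrite cylinderT; apply: ckM; [exact: openT| |exact: ck_dilate (smooth_s k j 1)].
  by apply: ckM; [exact: openT|apply: ck_coord; exact: openT|apply: ck_coord; exact: openT].
have -> : s k j t x = G t (pt 1 x) - G t (pt 0 x).
  rewrite /G !pt_first expr0n expr1n mul0r subr0 mul1r; congr s.
  by apply/rowP => l; rewrite mxE /dilation pt_first pt_rest mul1r.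
rewrite -(int_first_pd openT kG tI I) /int_first.
have cont F : ck (cylinder (@setT V)) 0 F -> continuous (fun r => F t (pt r x)).
  move=> kF; have := @pt_continuous1 R m setT F t x (fun t z => ck_jcont kF) I.
  by rewrite clamp01_id.
rewrite -int01B; [|by apply: cont; apply: ck_pd; exact: ckS|by apply: cont; apply: ck_pd; exact: ckS].
congr int01; apply/funext => r; set z := pt r x; set y := \row_l dilation l t z.
rewrite !(pdE tI (is_pd_radial_integrand _ _ _ tI)) -/y.
have Ho : is_pd (Some o) (fun _ z => z 0 o) t z 1.
  by have := is_pd_coord (Some o) o t z; rewrite eqxx.
have HG := is_pdM (is_pdM Ho Ho) (is_pd_dilate_first z (smooth_s k j 1) tI).
rewrite (pdE tI HG) -/y.
have -> : \sum_i z 0 (rshift 1 i) * pd (Some k) (s i j) t y =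
    \sum_i z 0 (rshift 1 i) * pd (Some j) (s i k) t y
    + \sum_i z 0 (rshift 1 i) * pd (Some i) (s k j) t y.
  rewrite -big_split; apply: eq_bigr => i _ /=; rewrite -mulrDr; congr (_ * _).
  have N a b c : pd (Some a) (s b c) t y = - pd (Some a) (s c b) t y.
    apply: pdE => //; have H := is_pdN (@smooth_is_pd R m setT _ (Some a) t y (smooth_s c b) tI I).
    by apply: is_pd_ext openT I tI _ H => t' x' t'I _; rewrite -anti_s.
  have := closed_s i j k y tI; rewrite (N i j k) (N j k i) => h.
  by apply/eqP; rewrite -subr_eq0; apply/eqP; lra.
have -> : s j k t y = - s k j t y by exact: anti_s.
by rewrite mulr1 mul1r expr2; ring.
Qed.

(** An alternating form is evaluated twice on the radial vector. This kills the contribution of the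
    starting point of the meridians and the radial derivative met when potentials are normalized. *)
Lemma radial_primitive_radial t x : t \in `[0, 1] -> \sum_j x 0 j * radial_primitive j t x = 0.
Proof.
move=> tI.
have cont j : continuous (fun r => x 0 j * radial_integrand j t (pt r x)).
  move=> r; apply: cvgM; first exact: cvg_cst.
  have := @pt_continuous1 R m setT (radial_integrand j) t x.
  rewrite clamp01_id //; apply=> // t' z' _; apply: ck_jcont (ck_radial_integrand 0 j) _.
  by [].
transitivity (\sum_j int01 (fun r => x 0 j * radial_integrand j t (pt r x))).
  apply: eq_bigr => j _; rewrite int01Z //.
  have := @pt_continuous1 R m setT (radial_integrand j) t x.
  rewrite clamp01_id //; apply=> // t' z' _; apply: ck_jcont (ck_radial_integrand 0 j) _.
  by [].
rewrite -int01_sum //.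
rewrite (_ : (fun r => _) = (fun=> 0)) ?int01_cst //.
apply/funext => r; set y := \row_l dilation l t (pt r x).
transitivity (r * \sum_j \sum_i x 0 j * x 0 i * s i j t y).
  rewrite mulr_sumr; apply: eq_bigr => j _; rewrite /radial_integrand !mulr_sumr.
  by apply: eq_bigr => i _; rewrite pt_first pt_rest -/y; ring.
have : \sum_j \sum_i x 0 j * x 0 i * s i j t y = - \sum_j \sum_i x 0 j * x 0 i * s i j t y.
  rewrite {1}exchange_big -sumrN; apply: eq_bigr => i _; rewrite -sumrN; apply: eq_bigr => j _.
  by rewrite anti_s //; ring.
by move=> h; rewrite (_ : \sum_j _ = 0) ?mulr0 //; lra.
Qed.

End RadialPrimitive.

Section ChainHomotopy.
Context {R : realType} {m : nat}.
Local Notation V := 'rV[R]_m.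
Local Notation W := 'rV[R]_(1 + m).
Variables (a : 'I_m -> R -> V -> R) (U : set V) (H : 'I_m -> R -> W -> R).
Hypothesis smooth_a : forall j, smooth_on setT (a j).
Hypothesis open_U : open U.
Hypothesis smooth_H : forall j, smooth_on (cylinder U) (H j).
Implicit Types (t : R) (x : V) (z : W).

Let y t z : V := \row_l H l t z.

(* The homotopy formula for the 1-form [a] and the family of maps [H (pt r _)], r in [0, 1]:
   H_1^* a - H_0^* a = d (homotopy_primitive) - (a term involving only da). *)
Definition homotopy_integrand t z : R := \sum_j a j t (y t z) * pd first_dir (H j) t z.

Definition homotopy_primitive : R -> V -> R := int_first homotopy_integrand.

Let open_C : open (cylinder U) := open_cylinder open_U.

Lemma ck_pullback k F : ck setT k F -> ck (cylinder U) k (fun t z => F t (y t z)).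
Proof. by move=> kF; apply: ck_chain kF _ _ => //; [exact: openT|move=> j; exact: smooth_H]. Qed.

Lemma ck_homotopy_integrand k : ck (cylinder U) k homotopy_integrand.
Proof.
apply: ck_sum => // j _; apply: ckM => //; first exact: ck_pullback (smooth_a j k).
exact: (smooth_pd first_dir (smooth_H j) k).
Qed.

Lemma smooth_homotopy_primitive : smooth_on U homotopy_primitive.
Proof. by move=> k; apply: ck_int_first => //; exact: ck_homotopy_integrand. Qed.

(** From the derivative along x_k of the integrand one subtracts the derivative along r of [B], the
    pullback of a on the k-th vector. The mixed second derivatives of H cancel, da on the
    derivatives of H remains, and the integral of the subtracted term gives the two boundary
    terms. *)
Lemma pd_homotopy_primitive (s : 'I_m -> 'I_m -> R -> V -> R) k t x :
  (forall i j x, pd (Some i) (a j) t x - pd (Some j) (a i) t x = s i j t x) ->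
  t \in `[0, 1] -> U x ->
  pd (Some k) homotopy_primitive t x =
    \sum_j a j t (y t (pt 1 x)) * pd (Some (rshift 1 k)) (H j) t (pt 1 x)
    - \sum_j a j t (y t (pt 0 x)) * pd (Some (rshift 1 k)) (H j) t (pt 0 x)
    + int01 (fun r => \sum_i \sum_j s i j t (y t (pt r x))
        * (pd (Some (rshift 1 k)) (H i) t (pt r x) * pd first_dir (H j) t (pt r x))).
Proof.
move=> da tI Ux; set d := Some (rshift 1 k).
have Cx r : cylinder U (pt r x) by rewrite /cylinder /= /pt row_mxKr.
pose B t z := \sum_j a j t (y t z) * pd d (H j) t z.
have kB k' : ck (cylinder U) k' B.
  apply: ck_sum => // j _; apply: ckM => //; first exact: ck_pullback (smooth_a j k').
  exact: (smooth_pd d (smooth_H j) k').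
rewrite -/(B t (pt 1 x)) -/(B t (pt 0 x)) -(int_first_pd open_U (kB 1%N) tI Ux).
have kQ := ck_homotopy_integrand 1.
have -> : pd (Some k) homotopy_primitive t x = int_first (pd d homotopy_integrand) t x.
  by apply: pdE => //; exact: (@is_pd_int_first _ _ U).
have cont F : ck (cylinder U) 0 F -> continuous (fun r => F t (pt r x)).
  move=> kF; have := @pt_continuous1 R m U F t x (fun t z => ck_jcont kF) Ux.
  by rewrite clamp01_id.
have dy (d' : 'I_(1 + m)) j z : cylinder U z -> is_pd (Some d') (fun t z => a j t (y t z)) t z
    (\sum_i pd (Some d') (H i) t z * pd (Some i) (a j) t (y t z)).
  move=> Cz.
  have := @is_pd_chain R _ _ (Some d') setT (a j) H (fun i => pd (Some d') (H i) t z) t z openT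
    (smooth_a j 1) tI I (fun i => smooth_is_pd (Some d') (smooth_H i) tI Cz).
  by rewrite /= mul0r add0r.
have dQ z : cylinder U z -> pd d homotopy_integrand t z =
    \sum_j ((\sum_i pd d (H i) t z * pd (Some i) (a j) t (y t z)) * pd first_dir (H j) t z
      + a j t (y t z) * pd d (pd first_dir (H j)) t z).
  move=> Cz; apply: pdE => //; apply: is_pd_sum => j _; apply: is_pdM; first exact: dy.
  exact: smooth_is_pd (smooth_pd first_dir (smooth_H j)) tI Cz.
have dB z : cylinder U z -> pd first_dir B t z =
    \sum_j ((\sum_i pd first_dir (H i) t z * pd (Some i) (a j) t (y t z)) * pd d (H j) t z
      + a j t (y t z) * pd first_dir (pd d (H j)) t z).
  move=> Cz; apply: pdE => //; apply: is_pd_sum => j _; apply: is_pdM; first exact: dy.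
  exact: smooth_is_pd (smooth_pd d (smooth_H j)) tI Cz.
apply/eqP; rewrite -subr_eq0 opprD addrA subr_eq0; apply/eqP.
rewrite /int_first -int01B; last 2 first.
- by apply: cont; apply: ck_pd.
- by apply: cont; apply: ck_pd; exact: kB.
congr int01; apply/funext => r; rewrite dQ // dB //; set z := pt r x.
rewrite !big_split /=.
have -> : \sum_j a j t (y t z) * pd d (pd first_dir (H j)) t z
    = \sum_j a j t (y t z) * pd first_dir (pd d (H j)) t z.
  by apply: eq_bigr => j _; rewrite (@pdC R _ (cylinder U) (H j) d first_dir t z open_C (smooth_H j 2) tI (Cx r)).
rewrite opprD addrACA subrr addr0.
have -> : \sum_j (\sum_i pd d (H i) t z * pd (Some i) (a j) t (y t z)) * pd first_dir (H j) t z
    = \sum_i \sum_j pd (Some i) (a j) t (y t z) * (pd d (H i) t z * pd first_dir (H j) t z).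
  rewrite exchange_big; apply: eq_bigr => j _; rewrite mulr_suml; apply: eq_bigr => i _.
  by rewrite mulrCA mulrA.
have -> : \sum_j (\sum_i pd first_dir (H i) t z * pd (Some i) (a j) t (y t z)) * pd d (H j) t z
    = \sum_i \sum_j pd (Some j) (a i) t (y t z) * (pd d (H i) t z * pd first_dir (H j) t z).
  apply: eq_bigr => j _; rewrite mulr_suml; apply: eq_bigr => i _.
  by rewrite mulrAC mulrC [_ * pd d _ _ _]mulrC.
rewrite -sumrB; apply: eq_bigr => i _; rewrite -sumrB; apply: eq_bigr => j _.
by rewrite -mulrBl da.
Qed.

End ChainHomotopy.

(** * Curves, the Euclidean norm and functions lifted to R^(1 + m) *)

Section Curves.
Context {R : realType} {m : nat}.
Local Notation V := 'rV[R]_m.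
Implicit Types (U : set V) (F : R -> V -> R) (t : R) (x : V).

Lemma is_derive_curve U F (g : 'I_m -> R -> R) (v : 'I_m -> R) t (s : R) : open U -> ck U 1 F ->
  t \in `[0, 1] -> (forall j, is_derive s 1 (g j) (v j)) -> U (\row_j g j s) ->
  is_derive s 1 (fun s => F t (\row_j g j s)) (\sum_j v j * pd (Some j) F t (\row_j g j s)).
Proof.
move=> oU kF tI dg Us; pose G j (_ : R) (z : 'rV[R]_1) := g j (z 0 0).
have E (h : R) : (0 + h *: evec 0 : 'rV[R]_1) 0 0 = h by rewrite !mxE !eqxx mulr1 add0r.
have dG j : is_pd (Some ord0) (G j) t (0 + s *: evec 0) (v j).
  rewrite -[v j]mulr1; apply: is_pd_comp; last by rewrite E.
  by have := is_pd_coord (Some (ord0 : 'I_1)) ord0 t (0 + s *: evec 0); rewrite eqxx.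
have Us' : U (\row_j G j t (0 + s *: evec 0)).
  by rewrite (_ : \row_j _ = \row_j g j s) //; apply/rowP => j; rewrite !mxE /G E.
have := is_pd_chain oU kF tI Us' dG; rewrite /= mul0r [X in is_pd _ _ _ _ X]add0r => H.
have := @is_pd_is_derive R 1 (Some ord0) (fun t z => F t (\row_j G j t z)) t 0 s _ _ H.
rewrite /at_pair /G /= E.
have -> : (fun h => F t (\row_j g j ((0 + h *: evec ord0 : 'rV[R]_1) 0 0))) =
    (fun h => F t (\row_j g j h)) by apply/funext => h; rewrite E.
by apply; exact: (@filterT _ (nbhs (0 : R)) (nbhs_filter _)).
Qed.

End Curves.

Section EuclideanNorm.
Context {R : realType} {m : nat}.
Local Notation V := 'rV[R]_m.
Implicit Types (U : set V) (F : R -> V -> R) (t r : R) (x : V).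

Lemma enorm_continuous : continuous (@enorm R m).
Proof.
move=> x; apply: (@continuous_comp _ _ _ (fun x : V => \sum_i x 0 i ^+ 2) Num.sqrt).
  apply: (@cvg_sum R V (nbhs x) (nbhs_filter x)) => i _.
  have c : (fun x : V => x 0 i) y @[y --> x] --> x 0 i by exact: coord_continuous.
  exact: (cvgM c c).
exact: sqrt_continuous.
Qed.

Lemma open_enorm_gt r : open [set x : V | r < enorm x].
Proof.
rewrite (_ : [set x | _] = @enorm R m @^-1` [set u | r < u]) //.
by apply: open_comp; [move=> x _; exact: enorm_continuous|exact: open_gt].
Qed.

Lemma smooth_enorm : smooth_on [set x : V | 0 < enorm x] (fun _ => @enorm R m).
Proof.
move=> k; have oU : open [set x : V | 0 < enorm x] := @open_enorm_gt 0.
pose F (_ : R) (x : V) : R := \sum_i x 0 i ^+ 2.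
have kF : ck [set x : V | 0 < enorm x] k F.
  apply: ck_sum => // i _; apply: ckM => //; exact: ck_coord.
apply: (@ck_sqrt R m [set x : V | 0 < enorm x] k F oU kF) => t x _.
by rewrite /= /enorm sqrtr_gt0.
Qed.

Lemma is_pd_enorm k t x : 0 < enorm x ->
  is_pd (Some k) (fun _ => @enorm R m) t x (x 0 k / enorm x).
Proof.
move=> x0; have s0 : 0 < \sum_i x 0 i ^+ 2 by rewrite -sqrtr_gt0.
have -> : x 0 k / enorm x = (2 * enorm x)^-1 * \sum_i (x 0 i * (k == i)%:R + x 0 i * (k == i)%:R).
  rewrite (bigD1 k) //= eqxx mulr1 big1; first by field; rewrite gt_eqF.
  by move=> i /negPf; rewrite eq_sym => ->; rewrite mulr0 addr0.
apply: (@is_pd_comp _ _ (Some k) Num.sqrt (fun _ x => \sum_i x 0 i ^+ 2)); last first.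
  exact: is_derive1_sqrt.
apply: is_pd_sum => i _.
have Hi : is_pd (Some k) (fun _ x => x 0 i) t x (k == i)%:R.
  by have := is_pd_coord (Some k) i t x; rewrite (inj_eq Some_inj).
by have := is_pdM Hi Hi; rewrite [_%:R * _]mulrC.
Qed.

End EuclideanNorm.

Section Lift.
Context {R : realType} {m : nat}.
Local Notation V := 'rV[R]_m.
Local Notation W := 'rV[R]_(1 + m).
Implicit Types (U : set V) (F : R -> V -> R) (t : R) (z : W).

Lemma rsubmx_row z : \row_j z 0 (rshift 1 j) = rsubmx z.
Proof. by apply/rowP => j; rewrite !mxE; congr (z _ _); apply/val_inj. Qed.

Lemma smooth_lift U F : open U -> smooth_on U F ->
  smooth_on (cylinder U) (fun t z => F t (rsubmx z)).
Proof.
move=> oU sF k; under eq_fun do under eq_fun do rewrite -rsubmx_row.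
apply: (ck_chain oU (open_cylinder oU) (sF k)).
  by move=> j; apply: ck_coord; exact: open_cylinder.
by move=> t z _; rewrite rsubmx_row.
Qed.

Lemma is_pd_lift U F k t z : open U -> smooth_on U F -> t \in `[0, 1] -> cylinder U z ->
  is_pd (Some (rshift 1 k)) (fun t z => F t (rsubmx z)) t z (pd (Some k) F t (rsubmx z)).
Proof.
move=> oU sF tI Uz.
have H (j : 'I_m) : is_pd (Some (rshift 1 k)) (fun _ z => z 0 (rshift 1 j)) t z (k == j)%:R.
  by have := is_pd_coord (Some (rshift 1 k)) (rshift 1 j) t z; rewrite (inj_eq Some_inj) eq_rshift.
have Uz' : U (\row_j (fun j (_ : R) z => z 0 (rshift 1 j)) j t z) by rewrite rsubmx_row.
have := is_pd_chain oU (sF 1%N) tI Uz' H; rewrite /= mul0r add0r.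
rewrite rsubmx_row (bigD1 k) //= eqxx mul1r big1 ?addr0.
  by under eq_fun do under eq_fun do rewrite rsubmx_row.
by move=> j /negPf; rewrite eq_sym => ->; rewrite mul0r.
Qed.

Lemma is_pd_lift_first F t z : is_pd first_dir (fun t z => F t (rsubmx z)) t z 0.
Proof.
exists (fun _ => 0); split; first exact: cvg_cst.
move=> h _; rewrite mulr0 addr0 /at_pair /=; congr F.
apply/rowP => j; rewrite !mxE.
by rewrite (_ : rshift 1 j == _ = false) ?andbF ?mulr0 ?addr0 // eq_rlshift.
Qed.

Lemma is_pd_first_first t z : is_pd first_dir (fun _ z => z 0 (lshift m ord0)) t z 1.
Proof. by have := is_pd_coord first_dir (lshift m ord0) t z; rewrite eqxx. Qed.

Lemma is_pd_first_rest (k : 'I_m) t z :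
  is_pd (Some (rshift 1 k)) (fun _ z => z 0 (lshift m ord0)) t z 0.
Proof.
have := is_pd_coord (Some (rshift 1 k)) (lshift m ord0) t z.
by rewrite (inj_eq Some_inj) eq_rlshift.
Qed.

End Lift.

(** * Spherical caps *)

Section Meridian.
Context {R : realType} {m : nat}.
Local Notation V := 'rV[R]_m.
Local Notation W := 'rV[R]_(1 + m).
Variables (i0 : 'I_m) (e : R).
Hypothesis e2 : e * e = 1.
Implicit Types (t s : R) (x : V) (z : W).

Let o : 'I_(1 + m) := lshift m ord0.

(* The complement of the half-line spanned by [- e *: evec i0]. *)
Definition cap : set V := [set x | 0 < enorm x + e * x 0 i0].

Lemma sign_norm : `|e| = 1.
Proof.
apply/eqP; rewrite -(@eqrXn2 _ 2) ?normr_ge0 ?ler01 // expr1n.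
by rewrite -normrX expr2 e2 normr1.
Qed.

Lemma cap_gt0 x : cap x -> 0 < enorm x.
Proof.
rewrite lt_def enorm_ge0 andbT => H; apply/eqP => x0.
have := coord_le_enorm x i0; rewrite x0 normr_le0 => /eqP h.
by move: H; rewrite /cap /= x0 h mulr0 addr0 ltxx.
Qed.

Lemma open_cap : open cap.
Proof.
rewrite (_ : cap = (fun x : V => enorm x + e * x 0 i0) @^-1` [set u | 0 < u]) //.
apply: open_comp; last exact: open_gt.
move=> x _; have c1 : e * (y : V) 0 i0 @[y --> x] --> e * x 0 i0.
  have c : (fun x : V => x 0 i0) y @[y --> x] --> x 0 i0 by exact: coord_continuous.
  exact: cvgM (cvg_cst e) c.
exact: cvgD (@enorm_continuous R m x) c1.
Qed.

(* One minus the cosine of the angle between [x] and [e *: evec i0]. *)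
Definition colat x : R := 1 - e * (x 0 i0 / enorm x).

Lemma colat_itv x : cap x -> 0 <= colat x < 2.
Proof.
move=> /[dup] cx /cap_gt0 x0; rewrite /colat; apply/andP; split.
  rewrite subr_ge0; apply: le_trans (ler_norm _) _.
  by rewrite normrM sign_norm mul1r normf_div (gtr0_norm x0) ler_pdivrMr // mul1r coord_le_enorm.
have : - (e * (x 0 i0 / enorm x)) < 1; last by lra.
rewrite mulrA -mulNr ltr_pdivrMr // mul1r; move: cx; rewrite /cap /=; lra.
Qed.

Lemma smooth_colat : smooth_on cap (fun _ => colat).
Proof.
have oU := open_cap; move=> k; apply: ckB => //; first exact: ck_cst.
apply: ckZ => //; apply: ckM => //; first exact: ck_coord.
have kn : ck cap k (fun _ => @enorm R m) by apply: ck_sub (smooth_enorm k) => x /cap_gt0.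
by apply: (ck_inv oU kn) => t x _ /cap_gt0 x0; rewrite gt_eqF.
Qed.

Lemma is_pd_colat k t x : 0 < enorm x -> is_pd (Some k) (fun _ => colat) t x
  (- (e * ((k == i0)%:R / enorm x - x 0 i0 * x 0 k / enorm x ^+ 3))).
Proof.
move=> x0; have n0 : enorm x != 0 by rewrite gt_eqF.
have H1 : is_pd (Some k) (fun _ x => x 0 i0) t x (k == i0)%:R.
  by have := is_pd_coord (Some k) i0 t x; rewrite (inj_eq Some_inj).
have H2 := is_pd_comp (is_pd_enorm k t x0) (is_derive_inv n0).
have := is_pdD (is_pd_cst (Some k) 1 t x) (is_pdM (is_pd_cst (Some k) (- e) t x) (is_pdM H1 H2)).
rewrite mul0r !add0r.
have -> : - e * ((k == i0)%:R / enorm x + x 0 i0 * (- enorm x ^- 2 * (x 0 k / enorm x))) =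
   - (e * ((k == i0)%:R / enorm x - x 0 i0 * x 0 k / enorm x ^+ 3)) by field.
by under eq_fun do under eq_fun do rewrite mulNr.
Qed.

Lemma colat_slope (k : 'I_m) x : 0 < enorm x ->
  `|- (e * ((k == i0)%:R / enorm x - x 0 i0 * x 0 k / enorm x ^+ 3))| <= 2 / enorm x.
Proof.
move=> x0; rewrite normrN normrM sign_norm mul1r.
apply: le_trans (ler_normB _ _) _; rewrite mulrDl mul1r lerD //.
  rewrite normf_div (gtr0_norm x0) -[leRHS]mul1r ler_pM2r ?invr_gt0 //.
  by case: eqP; rewrite ?normr1 ?normr0.
rewrite exprS invfM mulrA [X in `|X|]mulrAC normrM [`|(enorm x)^-1|]gtr0_norm ?invr_gt0 //.
rewrite -[leRHS]mul1r ler_pM2r ?invr_gt0 // normf_div ler_pdivrMr; last first.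
  by rewrite normr_gt0 expf_neq0 // gt_eqF.
rewrite mul1r normrM normrX (gtr0_norm x0) expr2.
by apply: ler_pM => //; exact: coord_le_enorm.
Qed.

(** The squared length of [segment] divided by the squared norm of x, so [rescale] is the factor
    that brings the segment back to the sphere. *)
Definition chord2 z : R := 1 - 2 * (z 0 o * (1 - z 0 o)) * colat (rsubmx z).

Definition rescale z : R := (Num.sqrt (chord2 z))^-1.

Definition segment (j : 'I_m) z : R :=
  (1 - z 0 o) * (e * enorm (rsubmx z)) * (j == i0)%:R + z 0 o * z 0 (rshift 1 j).

(* The straight segment from [enorm x *: (e *: evec i0)] to [x], projected to the sphere of
   radius [enorm x]. *)
Definition meridian (j : 'I_m) (_ : R) z : R := rescale z * segment j z.

Lemma cylinder_pt s x : cylinder cap (pt s x) = cap x.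
Proof. by rewrite /cylinder /= /pt row_mxKr. Qed.

(** The first coordinate s is any real number here, but s (1 - s) <= 1/4 always and the colatitude
    is below 2 on the cap; if s (1 - s) is negative the value is at least 1. *)
Lemma chord2_gt0 z : cylinder cap z -> 0 < chord2 z.
Proof.
move=> /colat_itv /andP[]; rewrite /chord2; move: (colat _) (z 0 o) => c s c0 c2.
have [h|h] := lerP 0 (s * (1 - s)); last first.
  have := mulr_le0_ge0 (ltW h) c0; lra.
have h4 : s * (1 - s) <= 1 / 4.
  by have := sqr_ge0 (s - 1 / 2); rewrite expr2; lra.
have : s * (1 - s) * c <= 1 / 4 * c by exact: ler_wpM2r.
lra.
Qed.

Lemma smooth_meridian j : smooth_on (cylinder cap) (meridian j).
Proof.
have oC := open_cylinder open_cap; have oU := open_cap.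
have kn : smooth_on (cylinder cap) (fun _ z => enorm (rsubmx z)).
  apply: (@smooth_lift _ _ _ (fun _ => @enorm R m) open_cap) => k.
  by apply: ck_sub (smooth_enorm k) => x /cap_gt0.
have kc := smooth_lift oU smooth_colat.
move=> k.
have ko : ck (cylinder cap) k (fun _ z => z 0 o) by exact: ck_coord.
have k1o : ck (cylinder cap) k (fun _ z => 1 - z 0 o).
  by apply: ckB => //; exact: ck_cst.
have kch : ck (cylinder cap) k (fun _ => chord2).
  apply: ckB => //; first exact: ck_cst.
  by apply: ckM => //; apply: ckZ => //; exact: ckM.
apply: ckM => //.
  have ks : ck (cylinder cap) k (fun _ z => Num.sqrt (chord2 z)).
    by apply: (ck_sqrt oC kch) => t z _; exact: chord2_gt0.
  by apply: (ck_inv oC ks) => t z _ Cz; rewrite gt_eqF // sqrtr_gt0 chord2_gt0.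
apply: ckD => //; last by apply: ckM => //; exact: ck_coord.
apply: ckM => //; last exact: ck_cst.
by apply: ckM => //; apply: ckZ.
Qed.

Lemma is_derive_rsqrt (u : R) : 0 < u ->
  is_derive u 1 (fun u : R => (Num.sqrt u)^-1) (- ((Num.sqrt u)^-1 ^+ 3 / 2)).
Proof.
move=> u0; have s0 : Num.sqrt u != 0 by rewrite gt_eqF // sqrtr_gt0.
have := is_deriveV s0 (is_derive1_sqrt u0); rewrite /GRing.scale /=.
by rewrite (_ : - _ * _ = - ((Num.sqrt u)^-1 ^+ 3 / 2)) //; field.
Qed.

Section Derivatives.
Variables (t s : R) (x : V).
Hypotheses (tI : t \in `[0, 1]) (cx : cap x).

Let z := pt s x.
Let c := colat x.
Let r := enorm x.
Let u := rescale z.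

Lemma rsubmx_pt : rsubmx z = x.
Proof. exact: row_mxKr. Qed.

Let Cz : cylinder cap z.
Proof. by rewrite /z cylinder_pt. Qed.

Lemma pd_meridian_first j : pd first_dir (meridian j) t z =
  u ^+ 3 * ((1 - 2 * s) * c) * segment j z + u * (x 0 j - e * r * (j == i0)%:R).
Proof.
have oC := open_cylinder open_cap; apply: pdE => //.
have H0 := is_pd_first_first (m := m) t z.
have H1 : is_pd first_dir (fun _ z => 1 - z 0 o) t z (-1).
  by rewrite -[X in is_pd _ _ _ _ X]sub0r; exact: is_pdB (is_pd_cst _ _ _ _) H0.
have Hc := is_pd_lift_first (fun _ => colat) t z.
have Hr := is_pd_lift_first (fun _ => @enorm R m) t z.
have Hj : is_pd first_dir (fun _ z => z 0 (rshift 1 j)) t z 0.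
  have := is_pd_coord first_dir (rshift 1 j) t z.
  by rewrite (inj_eq Some_inj) eq_lrshift.
have Hch : is_pd first_dir (fun _ => chord2) t z (- (2 * ((1 - 2 * s) * c))).
  have := is_pdD (is_pd_cst first_dir 1 t z) (is_pdM (is_pdM (is_pd_cst first_dir (-2) t z)
    (is_pdM H0 H1)) Hc).
  rewrite mulr0 mul0r !add0r addr0 rsubmx_pt pt_first.
  have -> : -2 * (1 * (1 - s) + s * -1) * colat x = - (2 * ((1 - 2 * s) * c)) by rewrite /c; ring.
  by under eq_fun do under eq_fun do rewrite mulNr mulNr.
have Hu := is_pd_comp Hch (is_derive_rsqrt (chord2_gt0 Cz)).
have Hseg := is_pdD (is_pdM (is_pdM H1 (is_pdM (is_pd_cst first_dir e t z) Hr))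
  (is_pd_cst first_dir (j == i0)%:R t z)) (is_pdM H0 Hj).
have := is_pdM Hu Hseg; rewrite -/(meridian j).
congr is_pd; rewrite -/(rescale z) -/u rsubmx_pt -/r pt_rest /segment pt_first pt_rest rsubmx_pt -/r.
by field.
Qed.

Lemma pd_meridian_rest k j : pd (Some (rshift 1 k)) (meridian j) t z =
  - (u ^+ 3 * (s * (1 - s)))
    * (e * ((k == i0)%:R / r - x 0 i0 * x 0 k / r ^+ 3)) * segment j z
  + u * ((1 - s) * (e * (x 0 k / r)) * (j == i0)%:R + s * (k == j)%:R).
Proof.
have oC := open_cylinder open_cap; apply: pdE => //; set d := Some _.
have r0 : 0 < enorm x by exact: cap_gt0.
have H0 : is_pd d (fun _ z => z 0 o) t z 0 by exact: is_pd_first_rest.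
have H1 : is_pd d (fun _ z => 1 - z 0 o) t z 0.
  by rewrite -[X in is_pd _ _ _ _ X](subr0 0); exact: is_pdB (is_pd_cst _ _ _ _) H0.
have Hc := is_pd_lift k open_cap smooth_colat tI Cz.
have kn : smooth_on cap (fun _ => @enorm R m).
  by move=> k'; apply: ck_sub (smooth_enorm k') => y /cap_gt0.
have Hr := is_pd_lift k open_cap kn tI Cz.
have Hj : is_pd d (fun _ z => z 0 (rshift 1 j)) t z (k == j)%:R.
  have := is_pd_coord d (rshift 1 j) t z.
  by rewrite (inj_eq Some_inj) eq_rshift.
rewrite rsubmx_pt (pdE tI (is_pd_colat k t r0)) in Hc.
rewrite rsubmx_pt (pdE tI (is_pd_enorm k t r0)) in Hr.
have Hch : is_pd d (fun _ => chord2) t z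
    (2 * (s * (1 - s)) * (e * ((k == i0)%:R / r - x 0 i0 * x 0 k / r ^+ 3))).
  have := is_pdD (is_pd_cst d 1 t z) (is_pdM (is_pdM (is_pd_cst d (-2) t z)
    (is_pdM H0 H1)) Hc).
  rewrite !(mul0r, mulr0, addr0, add0r) pt_first -/r.
  rewrite mulrN !mulNr opprK.
  by under eq_fun do under eq_fun do rewrite mulNr mulNr.
have Hu := is_pd_comp Hch (is_derive_rsqrt (chord2_gt0 Cz)).
have Hseg := is_pdD (is_pdM (is_pdM H1 (is_pdM (is_pd_cst d e t z) Hr))
  (is_pd_cst d (j == i0)%:R t z)) (is_pdM H0 Hj).
have := is_pdM Hu Hseg; rewrite -/(meridian j).
congr is_pd; rewrite -/(rescale z) -/u rsubmx_pt -/r pt_first pt_rest /segment pt_first pt_rest rsubmx_pt -/r.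
by field; rewrite gt_eqF.
Qed.

Lemma chord2_pt : chord2 z = 1 - 2 * (s * (1 - s)) * c.
Proof. by rewrite /chord2 pt_first rsubmx_pt. Qed.

(** This is the advantage over the radial contraction: along a meridian the homotopy term sees s
    only on the sphere through x. *)
Lemma enorm_meridian : enorm (\row_l meridian l t z) = r.
Proof.
have r0 : 0 < r by exact: cap_gt0.
have N0 := chord2_gt0 Cz.
have S : \sum_i segment i z ^+ 2 = r ^+ 2 * chord2 z.
  rewrite chord2_pt (eq_bigr (fun i => ((1 - s) * (e * r)) ^+ 2 * (i == i0)%:R
     + 2 * ((1 - s) * (e * r)) * s * x 0 i0 * (i == i0)%:R + s ^+ 2 * x 0 i ^+ 2)); last first.
    move=> i _; rewrite /segment pt_first pt_rest rsubmx_pt -/r.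
    by case: eqP => [->|_]; rewrite ?mulr1 ?mulr0; ring.
  have D (a : R) : \sum_i a * (i == i0)%:R = a.
    rewrite (bigD1 i0) //= eqxx mulr1 big1 ?addr0 // => i /negPf ->; by rewrite mulr0.
  rewrite !big_split /= !D -mulr_sumr -enorm_sqr -/r /c /colat -/r.
  have -> : ((1 - s) * (e * r)) ^+ 2 = (1 - s) ^+ 2 * r ^+ 2.
    by rewrite exprMn [(e * r) ^+ 2]exprMn [e ^+ 2]expr2 e2 mul1r.
  by field; rewrite gt_eqF.
rewrite /enorm (eq_bigr (fun i => (chord2 z)^-1 * segment i z ^+ 2)); last first.
  by move=> i _; rewrite mxE /meridian exprMn /rescale exprVn sqr_sqrtr // ltW.
rewrite -mulr_sumr S mulrCA mulVf ?gt_eqF // mulr1.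
by rewrite sqrtr_sqr ger0_norm // ltW.
Qed.

Hypothesis sI : s \in `[0, 1].
Hypothesis half : - (r / 2) <= e * x 0 i0.

Let r0 : 0 < r. Proof. exact: cap_gt0. Qed.

Let s01 : 0 <= s <= 1. Proof. by move: sI; rewrite in_itv. Qed.

(** At height at least - r / 2 the colatitude is at most 3/2, so [chord2] is at least 1 - 2 (1/4)
    (3/2) = 1/4. Nearer to the missing pole the segment passes close to the origin and the factor is
    unbounded. *)
Lemma rescale_itv : 0 <= u <= 2.
Proof.
have N0 := chord2_gt0 Cz; have [s0 s1] := andP s01.
have c32 : c <= 3 / 2.
  have : - (e * (x 0 i0 / r)) <= 1 / 2; last by rewrite /c /colat -/r; lra.
  by rewrite mulrA -mulNr ler_pdivrMr //; move: half; lra.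
have /andP[c0 _] := colat_itv cx.
have N4 : 1 / 4 <= chord2 z.
  have h4 : s * (1 - s) <= 1 / 4.
    by have := sqr_ge0 (s - 1 / 2); rewrite expr2; lra.
  have : s * (1 - s) * c <= 1 / 4 * (3 / 2).
    by apply: ler_pM => //; rewrite mulr_ge0 // subr_ge0.
  by rewrite chord2_pt; lra.
rewrite /u /rescale invr_ge0 sqrtr_ge0 /=.
rewrite -[leRHS]invrK lef_pV2 ?posrE ?sqrtr_gt0 ?invr_gt0 //.
have -> : 2^-1 = Num.sqrt (2^-1 ^+ 2) :> R by rewrite sqrtr_sqr ger0_norm // invr_ge0.
by rewrite ler_wsqrtr //; apply: le_trans N4; rewrite exprVn div1r -natrX.
Qed.

Lemma segment_le j : `|segment j z| <= r.
Proof.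
have [s0 s1] := andP s01.
rewrite /segment pt_first pt_rest rsubmx_pt -/r.
rewrite [leRHS](_ : r = (1 - s) * r + s * r); last by ring.
apply: le_trans (ler_normD _ _) _; apply: lerD.
  rewrite !normrM sign_norm mul1r [`|1 - s|]ger0_norm ?subr_ge0 // -mulrA ler_wpM2l ?subr_ge0 //.
  rewrite (gtr0_norm r0) -[leRHS]mulr1 ler_wpM2l ?(ltW r0) //.
  by case: eqP; rewrite ?normr1 ?normr0 ?ler01.
by rewrite normrM ger0_norm // ler_wpM2l // coord_le_enorm.
Qed.

(** With u ^ 3 <= 8, colatitude at most 2 and both [segment] and x of size at most r, the two terms
    are at most 16 r and 4 r. *)
Lemma meridian_first_le j : `|pd first_dir (meridian j) t z| <= 20 * r.
Proof.
have [s0 s1] := andP s01; have /andP[u0 u2] := rescale_itv.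
have /andP[c0 c2] := colat_itv cx.
have u3 : 0 <= u ^+ 3 <= 8.
  rewrite exprn_ge0 //=; have -> : 8 = 2 ^+ 3 :> R by rewrite -natrX.
  by rewrite ler_pXn2r ?nnegrE.
rewrite pd_meridian_first; have -> : 20 * r = 8 * 2 * r + 2 * (r + r) by ring.
apply: le_trans (ler_normD _ _) _; apply: lerD.
  rewrite !normrM; apply: ler_pM => //; last exact: segment_le.
  apply: ler_pM => //; first by rewrite ger0_norm; lra.
  rewrite -[2]mul1r; apply: ler_pM => //; last by rewrite ger0_norm //; exact: ltW.
  by rewrite ler_norml; lra.
rewrite normrM; apply: ler_pM => //; first by rewrite ger0_norm.
apply: le_trans (ler_normB _ _) _; apply: lerD; first exact: coord_le_enorm.
rewrite !normrM sign_norm mul1r (ger0_norm (ltW r0)) -[leRHS]mulr1 ler_wpM2l ?(ltW r0) //.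
by case: eqP; rewrite ?normr1 ?normr0 ?ler01.
Qed.

(** The slope of the colatitude is at most 2 / r and [segment] has size at most r, so the radius
    cancels: the two terms are at most 8 (2 / r) r = 16 and 2 (1 + 1) = 4. *)
Lemma meridian_rest_le k j : `|pd (Some (rshift 1 k)) (meridian j) t z| <= 20.
Proof.
have [s0 s1] := andP s01; have /andP[u0 u2] := rescale_itv.
have u3 : 0 <= u ^+ 3 <= 8.
  rewrite exprn_ge0 //=; have -> : 8 = 2 ^+ 3 :> R by rewrite -natrX.
  by rewrite ler_pXn2r ?nnegrE.
rewrite pd_meridian_rest; have -> : 20 = 8 * 1 * (2 / r) * r + 2 * (1 + 1) :> R by field; rewrite gt_eqF.
apply: le_trans (ler_normD _ _) _; apply: lerD.
  rewrite mulNr -mulrN !normrM; apply: ler_pM => //; last exact: segment_le.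
  apply: ler_pM => //; last exact: colat_slope r0.
  apply: ler_pM => //; first by rewrite ger0_norm; lra.
  by rewrite -normrM ger0_norm ?mulr_ge0 ?subr_ge0 // -[leRHS]mulr1; apply: ler_pM; lra.
rewrite normrM; apply: ler_pM => //; first by rewrite ger0_norm.
apply: le_trans (ler_normD _ _) _; apply: lerD; rewrite !normrM; last first.
  by rewrite -[leRHS]mulr1; apply: ler_pM; rewrite // ?ger0_norm //; case: eqP.
rewrite -[leRHS]mulr1; apply: ler_pM; rewrite //; last by case: eqP; rewrite ?normr1 ?normr0.
rewrite -[leRHS]mulr1; apply: ler_pM; rewrite // ?[`|1 - s|]ger0_norm ?subr_ge0 //; first by lra.
rewrite sign_norm mul1r normfV (gtr0_norm r0) ler_pdivrMr // mul1r; exact: coord_le_enorm.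
Qed.

End Derivatives.

Lemma rescale1 (s : R) x : s * (1 - s) = 0 -> rescale (pt s x) = 1.
Proof. by move=> h; rewrite /rescale chord2_pt h mulr0 mul0r subr0 sqrtr1 invr1. Qed.

Lemma meridian_end t x : \row_l meridian l t (pt 1 x) = x.
Proof.
apply/rowP => j; rewrite mxE /meridian rescale1 ?subrr ?mulr0 // /segment pt_first pt_rest.
by rewrite subrr !mul0r add0r !mul1r.
Qed.

Lemma meridian_start t x : \row_l meridian l t (pt 0 x) = (e * enorm x) *: evec i0.
Proof.
apply/rowP => j; rewrite mxE /meridian rescale1 ?mul0r // /segment pt_first rsubmx_pt.
by rewrite subr0 !mul1r mul0r addr0 !mxE eqxx.
Qed.

(** * A potential on a cap *)

Section CapPrimitive.
Variables (a : 'I_m -> R -> V -> R) (s : 'I_m -> 'I_m -> R -> V -> R).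
Hypothesis smooth_a : forall j, smooth_on setT (a j).
Hypothesis smooth_s : forall i j, smooth_on setT (s i j).
Hypothesis da : forall t x i j, t \in `[0, 1] ->
  pd (Some i) (a j) t x - pd (Some j) (a i) t x = s i j t x.
Hypothesis a_radial : forall t x, t \in `[0, 1] -> \sum_j x 0 j * a j t x = 0.

(** In the homotopy formula along the meridians the end term is a itself and the starting term is
    zero, so only the integral of s on two derivatives of the meridian remains. Each of its m ^ 2
    terms is at most M times 20 times 20 r, whence 400. *)
Lemma cap_primitive : exists g, smooth_on cap g /\
  forall t x M k, t \in `[0, 1] -> cap x -> - (enorm x / 2) <= e * x 0 i0 ->
    (forall y i j, enorm y = enorm x -> `|s i j t y| <= M) ->
    `|pd (Some k) g t x - a k t x| <= (m * m)%:R * 400 * (enorm x * M).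
Proof.
exists (homotopy_primitive a meridian); split.
  by apply: smooth_homotopy_primitive => //; [exact: open_cap|exact: smooth_meridian].
move=> t x M k tI cx half sM.
have r0 := cap_gt0 cx.
rewrite (@pd_homotopy_primitive R m a cap meridian smooth_a open_cap smooth_meridian s) //; last first.
  by move=> i j y; exact: da.
rewrite meridian_end meridian_start.
have -> : \sum_j a j t x * pd (Some (rshift 1 k)) (meridian j) t (pt 1 x) = a k t x.
  rewrite (bigD1 k) //= big1 ?addr0 => [|j jk]; rewrite pd_meridian_rest // rescale1 ?subrr ?mulr0 //.
    by rewrite oppr0 !mul0r eqxx add0r !mul1r add0r mulr1.
  by rewrite oppr0 !mul0r add0r !mul1r add0r eq_sym (negPf jk) mulr0.
(* The meridian of x starts on the axis, at a point depending only on the norm of x; moving x moves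
   it along the axis, a radial direction, on which a vanishes. *)
have -> : \sum_j a j t ((e * enorm x) *: evec i0) * pd (Some (rshift 1 k)) (meridian j) t (pt 0 x) = 0.
  have := a_radial ((e * enorm x) *: evec i0) tI.
  rewrite (bigD1 i0) //= big1 ?addr0 => [|j ji]; last by rewrite !mxE eqxx (negPf ji) mulr0 mul0r.
  rewrite !mxE !eqxx mulr1 => /eqP; rewrite mulf_eq0 => /orP[|/eqP a0].
    by rewrite mulf_eq0 (gt_eqF r0) orbF => /eqP e0; move: e2; rewrite e0 mul0r => /eqP; rewrite eq_sym oner_eq0.
  apply: big1 => j _; rewrite pd_meridian_rest // rescale1 ?mul0r // !mulr0 oppr0 !mul0r add0r mul1r addr0.
  by case: (eqVneq j i0) => [->|_]; rewrite ?a0 ?mul0r // !mulr0.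
rewrite subr0 addrAC subrr add0r.
have Cx r : cylinder cap (pt r x) by rewrite cylinder_pt.
apply: int01_le.
  have H : ck (cylinder cap) 0 (fun t z => \sum_i \sum_j s i j t (\row_l meridian l t z) *
      (pd (Some (rshift 1 k)) (meridian i) t z * pd first_dir (meridian j) t z)).
    have oC := open_cylinder open_cap.
    apply: ck_sum => // i _; apply: ck_sum => // j _; apply: ckM => //.
      exact: (ck_pullback open_cap smooth_meridian (smooth_s i j 0)).
    by apply: ckM => //; apply: ck_pd; exact: smooth_meridian.
  have := @pt_continuous1 R m cap _ t x (fun t z => ck_jcont H) cx.
  by rewrite clamp01_id.
move=> r rI.
have B i j : `|s i j t (\row_l meridian l t (pt r x)) * (pd (Some (rshift 1 k)) (meridian i) t (pt r x)
    * pd first_dir (meridian j) t (pt r x))| <= M * (20 * (20 * enorm x)).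
  rewrite !normrM; apply: ler_pM => //.
    by apply: sM; exact: enorm_meridian.
  apply: ler_pM => //; first exact: meridian_rest_le.
  exact: meridian_first_le.
apply: le_trans (ler_norm_sum _ _ _) _.
apply: le_trans (ler_sum _ (fun i _ => le_trans (ler_norm_sum _ _ _) (ler_sum _ (fun j _ => B i j)))) _.
rewrite !sumr_const !card_ord -mulrnA -[leLHS]mulr_natl.
have -> // : M * (20 * (20 * enorm x)) = 400 * (enorm x * M) by ring.
by rewrite !mulrA.
Qed.

End CapPrimitive.

End Meridian.

(** * A primitive controlled on spheres *)

Section SphericalPrimitive.
Context {R : realType} {m : nat}.
Local Notation V := 'rV[R]_m.
Implicit Types (t r : R) (x y : V) (U : set V).
Variables (i0 i1 i2 i3 : 'I_m).
Hypothesis distinct : uniq [:: i0; i1; i2; i3].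

Lemma axis_neq_pole : (i1 == i0) = false.
Proof. by move: distinct; rewrite /= !inE !negb_or eq_sym => /andP[/and3P[/negPf]]. Qed.

Lemma enorm_axis r : 0 <= r -> enorm (r *: evec i1 : V) = r.
Proof.
move=> r0; rewrite enormZ ger0_norm // /enorm (bigD1 i1) //= big1 ?addr0 ?mxE ?eqxx ?expr1n.
  by rewrite sqrtr1 mulr1.
by move=> i /negPf h; rewrite mxE h andbF expr0n.
Qed.

Lemma axis_pole r : (r *: evec i1 : V) 0 i0 = 0.
Proof. by rewrite !mxE eqxx eq_sym axis_neq_pole mulr0. Qed.

Section Potentials.
Variables (a : 'I_m -> R -> V -> R) (s : 'I_m -> 'I_m -> R -> V -> R).
Hypothesis smooth_a : forall j, smooth_on setT (a j).
Hypothesis smooth_s : forall i j, smooth_on setT (s i j).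
Hypothesis da : forall t x i j, t \in `[0, 1] ->
  pd (Some i) (a j) t x - pd (Some j) (a i) t x = s i j t x.
Hypothesis a_radial : forall t x, t \in `[0, 1] -> \sum_j x 0 j * a j t x = 0.

(** Twice the constant of [cap_primitive]: normalizing a potential subtracts a function whose
    gradient obeys the same bound. *)
Let K : R := 2 * ((m * m)%:R * 400).

Let K_ge0 : 0 <= K.
Proof. by apply: mulr_ge0; [exact: ler0n|apply: mulr_ge0; exact: ler0n]. Qed.

Definition sphere_bound t x (M : R) := forall y i j, enorm y = enorm x -> `|s i j t y| <= M.

Lemma sphere_bound_ge0 t x M : sphere_bound t x M -> 0 <= M.
Proof. by move=> /(_ x i0 i0 erefl); apply: le_trans. Qed.

(* Up to a gradient, [a] is controlled by [s = d a] one sphere at a time. *)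
Definition potential_on e g := [/\ smooth_on (cap i0 e) g,
  forall t r, 0 < r -> g t (r *: evec i1) = 0 &
  forall t x M k, t \in `[0, 1] -> cap i0 e x -> - (enorm x / 2) <= e * x 0 i0 ->
    sphere_bound t x M -> `|pd (Some k) g t x - a k t x| <= K * (enorm x * M)].

(** The value of g at the point of the axis [evec i1] on the same sphere is subtracted. Its gradient
    is at most the derivative of g along that axis, and there a vanishes on the axis direction, so
    the bound on dg - a is a bound on dg. *)
Lemma potential_exists e : e * e = 1 -> exists g, potential_on e g.
Proof.
move=> e2; have [g [sg gb]] := cap_primitive i0 e2 smooth_a smooth_s da a_radial.
pose G (l : 'I_m) (_ : R) (x : V) := enorm x * (l == i1)%:R.
have GE t x : \row_l G l t x = enorm x *: evec i1.
  by apply/rowP => l; rewrite /G !mxE eqxx.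
have oU := @open_cap R m i0 e.
have capr r : 0 < r -> cap i0 e (r *: evec i1 : V).
  by move=> r0; rewrite /cap /= enorm_axis ?(ltW r0) // axis_pole mulr0 addr0.
have sh : smooth_on (cap i0 e) (fun t x => g t (\row_l G l t x)).
  move=> k; apply: ck_chain (sg k) _ _ => //.
    move=> l; apply: ckM => //; last exact: ck_cst.
    by apply: ck_sub (smooth_enorm k) => x /cap_gt0.
  by move=> t x _ /cap_gt0 x0; rewrite GE; exact: capr.
exists (fun t x => g t x - g t (\row_l G l t x)); split.
- by move=> k; apply: ckB => //.
- by move=> t r r0; rewrite GE enorm_axis ?subrr // ltW.
move=> t x M k tI cx half sM; have x0 := cap_gt0 cx.
have dG l : is_pd (Some k) (G l) t x (x 0 k / enorm x * (l == i1)%:R).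
  have := is_pdM (is_pd_enorm k t x0) (is_pd_cst (Some k) (l == i1)%:R t x).
  by rewrite mulr0 addr0.
have UG : cap i0 e (\row_l G l t x) by rewrite GE; exact: capr.
have := is_pd_chain oU (sg 1%N) tI UG dG; rewrite /= mul0r add0r GE.
rewrite (bigD1 i1) //= eqxx mulr1 big1 ?addr0; last first.
  by move=> l /negPf ->; rewrite mulr0 mul0r.
move=> dg2; have dg1 := smooth_is_pd (Some k) sg tI cx.
rewrite (pdE tI (is_pdB dg1 dg2)) addrAC.
have -> : K * (enorm x * M) = (m * m)%:R * 400 * (enorm x * M) + (m * m)%:R * 400 * (enorm x * M).
  by rewrite /K; ring.
apply: le_trans (ler_normB _ _) _; apply: lerD; first exact: gb.
rewrite normrM -[leRHS]mul1r; apply: ler_pM => //.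
  by rewrite normf_div (gtr0_norm x0) ler_pdivrMr // mul1r coord_le_enorm.
have a1 : a i1 t (enorm x *: evec i1) = 0.
  have := a_radial (enorm x *: evec i1) tI.
  rewrite (bigD1 i1) //= big1 ?addr0 => [|j ji]; last by rewrite !mxE eqxx (negPf ji) mulr0 mul0r.
  by rewrite !mxE !eqxx mulr1 => /eqP; rewrite mulf_eq0 (gt_eqF x0) => /eqP.
rewrite -[pd _ _ _ _]subr0 -a1.
have := gb t (enorm x *: evec i1) M i1 tI (capr _ x0).
rewrite enorm_axis ?(ltW x0) // axis_pole mulr0; apply; first by rewrite oppr_le0 divr_ge0 ?(ltW x0).
by move=> y i j yE; apply: sM.
Qed.

(** All points off the polar axis, an open set on which both potentials are smooth. The estimates
    concern only its part with [|x 0 i0|] at most half the norm. *)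
Definition belt : set V := cap i0 1 `&` cap i0 (-1).

Lemma open_belt : open belt.
Proof. by apply: openI; exact: open_cap. Qed.

Lemma belt_sub x : 0 < enorm x -> `|x 0 i0| <= enorm x / 2 -> belt x.
Proof. by rewrite ler_norml => x0 /andP[h1 h2]; split; rewrite /cap /=; lra. Qed.

Lemma pi_le4 : pi <= 4 :> R.
Proof. by have := @pihalf_lt2 R; lra. Qed.

(** The arc cos y1 + sin y2 stays on the sphere by orthogonality; since y2 has height zero, the
    height along it is a multiple of that of y1 by a cosine, so it remains in the band. Each
    coordinate of its velocity is at most (pi / 2) (r + r) <= 4 r. *)
Lemma quarter_circle q t r (L : R) (y1 y2 : V) : t \in `[0, 1] -> smooth_on belt q -> 0 < r ->
  (forall y k, enorm y = r -> `|y 0 i0| <= r / 2 -> `|pd (Some k) q t y| <= L) ->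
  enorm y1 = r -> enorm y2 = r -> \sum_i y1 0 i * y2 0 i = 0 ->
  `|y1 0 i0| <= r / 2 -> y2 0 i0 = 0 ->
  `|q t y2 - q t y1| <= m%:R * (4 * r * L).
Proof.
move=> tI sq r0 qL n1 n2 orth p1 p2.
pose h : R := pi / 2.
pose g j (u : R) := cos (u * h) * y1 0 j + sin (u * h) * y2 0 j.
pose g' j (u : R) := h * (- sin (u * h) * y1 0 j + cos (u * h) * y2 0 j).
have dg j (u : R) : is_derive u 1 (g j) (g' j u).
  have dl : is_derive u 1 (fun u : R => u * h) h.
    have := @is_deriveM R R id (cst h) u 1 1 0 (is_derive_id u 1) (is_derive_cst h u 1).
    by rewrite scaler0 add0r /GRing.scale /= mulr1.
  have dc := @is_derive1_comp R cos _ u _ _ (is_derive_cos (u * h)) dl.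
  have ds := @is_derive1_comp R sin _ u _ _ (is_derive_sin (u * h)) dl.
  have := is_deriveD (is_deriveM dc (is_derive_cst (y1 0 j) u (1 : R)))
     (is_deriveM ds (is_derive_cst (y2 0 j) u (1 : R))).
  rewrite !scaler0 !add0r /GRing.scale /= (_ : _ + _ = g' j u) //.
  by rewrite /g'; ring.
have gn u : enorm (\row_j g j u) = r.
  rewrite /enorm (eq_bigr (fun i => cos (u * h) ^+ 2 * y1 0 i ^+ 2
    + 2 * cos (u * h) * sin (u * h) * (y1 0 i * y2 0 i) + sin (u * h) ^+ 2 * y2 0 i ^+ 2)).
    rewrite !big_split /= -!mulr_sumr -!enorm_sqr n1 n2 orth mulr0 addr0 -mulrDl cos2Dsin2 mul1r.
    by rewrite sqrtr_sqr gtr0_norm.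
  by move=> i _; rewrite mxE /g; ring.
have gp u : `|(\row_j g j u) 0 i0| <= r / 2.
  rewrite mxE /g p2 mulr0 addr0 normrM -[leRHS]mul1r; apply: ler_pM => //.
  by rewrite ler_norml cos_geN1 cos_le1.
have gb u : belt (\row_j g j u) by apply: belt_sub; rewrite gn.
have H (u : R) : u \in `[0, 1] -> is_derive u 1 (fun u => q t (\row_j g j u))
    (\sum_j g' j u * pd (Some j) q t (\row_j g j u)).
  by move=> _; apply: (is_derive_curve open_belt (sq 1%N)).
have [|u uI] := mvt0 H (t := 1); first by rewrite in_itv /= ler01 lexx.
have -> : \row_j g j 1 = y2.
  by apply/rowP => j; rewrite mxE /g /h mul1r cos_pihalf sin_pihalf mul0r add0r mul1r.
have -> : \row_j g j 0 = y1.
  by apply/rowP => j; rewrite mxE /g mul0r cos0 sin0 mul0r addr0 mul1r.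
rewrite mulr1 => ->; apply: le_trans (ler_norm_sum _ _ _) _.
rewrite -[m in m%:R]card_ord mulr_natl -sumr_const; apply: ler_sum => j _.
rewrite normrM; apply: ler_pM => //; last by apply: qL.
have pi0 := pi_ge0 R; have p4 := pi_le4.
have -> : 4 * r = 2 * (r + r) by ring.
rewrite /g' normrM; apply: ler_pM => //; first by rewrite /h ger0_norm; lra.
apply: le_trans (ler_normD _ _) _; rewrite !normrM normrN.
apply: lerD; rewrite -[leRHS]mul1r; apply: ler_pM => //.
- by rewrite ler_norml sin_geN1 sin_le1.
- by rewrite -n1 coord_le_enorm.
- by rewrite ler_norml cos_geN1 cos_le1.
- by rewrite -n2 coord_le_enorm.
Qed.

(* A vector orthogonal to [x], to the axis [evec i1] and to [evec i0]; this is where dimension at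
   least 4 is used. *)
Lemma orthogonal_exists x r : 0 < r ->
  exists y : V, [/\ enorm y = r, \sum_i x 0 i * y 0 i = 0, y 0 i1 = 0 & y 0 i0 = 0].
Proof.
move=> r0.
(* The pair is (x_i2, x_i3) turned by a right angle and normalized, or any unit pair if both
   coordinates vanish. *)
have [al [be [ab abx]]] : exists al be : R, al ^+ 2 + be ^+ 2 = 1 /\ x 0 i2 * al + x 0 i3 * be = 0.
  have [z0|z0] := eqVneq (x 0 i2 ^+ 2 + x 0 i3 ^+ 2) 0.
    exists 1, 0; move/eqP: z0; rewrite paddr_eq0 ?sqr_ge0 // !sqrf_eq0 => /andP[/eqP -> _].
    by rewrite expr1n expr0n !mulr0 mul0r !addr0.
  have z1 : 0 < x 0 i2 ^+ 2 + x 0 i3 ^+ 2 by rewrite lt_def z0 addr_ge0 // sqr_ge0.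
  have s0 : Num.sqrt (x 0 i2 ^+ 2 + x 0 i3 ^+ 2) != 0 by rewrite gt_eqF // sqrtr_gt0.
  exists (x 0 i3 / Num.sqrt (x 0 i2 ^+ 2 + x 0 i3 ^+ 2)), (- x 0 i2 / Num.sqrt (x 0 i2 ^+ 2 + x 0 i3 ^+ 2)).
  split; last by field.
  rewrite !exprMn !exprVn sqr_sqrtr ?ltW // sqrrN -mulrDl addrC divff //.
move: distinct; rewrite /= !inE !negb_or !andbT.
move=> /and3P[/and3P[/negPf n01 /negPf n02 /negPf n03] /andP[/negPf n12 /negPf n13] /negPf n23].
pose y : V := (r * al) *: evec i2 + (r * be) *: evec i3.
have yE i : y 0 i = r * al * (i == i2)%:R + r * be * (i == i3)%:R by rewrite !mxE eqxx.
have D (f : 'I_m -> R) j : \sum_i f i * (i == j)%:R = f j.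
  rewrite (bigD1 j) //= eqxx mulr1 big1 ?addr0 // => i /negPf ->; by rewrite mulr0.
exists y; split.
- rewrite /enorm (eq_bigr (fun i => (r * al) ^+ 2 * (i == i2)%:R + (r * be) ^+ 2 * (i == i3)%:R)).
    rewrite big_split /= !D !exprMn -mulrDr ab mulr1 sqrtr_sqr gtr0_norm //.
  move=> i _; rewrite yE; have [->|] := eqVneq i i2; first by rewrite n23 mulr0 addr0 !mulr1 mulr0 addr0.
  by case: (i == i3) => _; rewrite !(mulr0, mulr1, add0r, expr0n).
- rewrite (eq_bigr (fun i => x 0 i * (r * al) * (i == i2)%:R + x 0 i * (r * be) * (i == i3)%:R)).
    rewrite big_split /= !D; transitivity (r * (x 0 i2 * al + x 0 i3 * be)); first by ring.
    by rewrite abx mulr0.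
  by move=> i _; rewrite yE; ring.
- by rewrite yE n12 n13 !mulr0 addr0.
- by rewrite yE n02 n03 !mulr0 addr0.
Qed.

(** * Gluing the two potentials *)

Section Glue.
Variables gN gS : R -> V -> R.
Hypotheses (pN : potential_on 1 gN) (pS : potential_on (-1) gS).

Let q t x := gS t x - gN t x.

Let smooth_N : smooth_on (cap i0 1) gN. Proof. by case: pN. Qed.

Let smooth_S : smooth_on (cap i0 (-1)) gS. Proof. by case: pS. Qed.

Lemma belt_bounds t x M k : t \in `[0, 1] -> 0 < enorm x -> `|x 0 i0| <= enorm x / 2 ->
  sphere_bound t x M ->
  `|pd (Some k) gS t x - a k t x| <= K * (enorm x * M) /\
  `|pd (Some k) gS t x - pd (Some k) gN t x| <= 2 * K * (enorm x * M).
Proof.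
move=> tI x0 p sM; have [cN cS] := belt_sub x0 p; move: p; rewrite ler_norml => /andP[p1 p2].
have [_ _ bN] := pN; have [_ _ bS] := pS.
have hN : - (enorm x / 2) <= 1 * x 0 i0 by lra.
have hS : - (enorm x / 2) <= -1 * x 0 i0 by lra.
have := bN t x M k tI cN hN sM; have := bS t x M k tI cS hS sM.
rewrite -[2 * K * _]mulrA; move: (pd _ gS t x) (pd _ gN t x) (a k t x) (K * _) => u v w B h1 h2.
split => //; have -> : u - v = (u - w) - (v - w) by ring.
by apply: le_trans (ler_normB _ _) _; rewrite mulrDl mul1r lerD.
Qed.

Lemma smooth_difference : smooth_on belt q.
Proof.
move=> k; apply: ckB; first exact: open_belt.
  by apply: ck_sub (smooth_S k) => x [].
by apply: ck_sub (smooth_N k) => x [].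
Qed.

Lemma is_pd_difference t x k : t \in `[0, 1] -> belt x ->
  is_pd (Some k) q t x (pd (Some k) gS t x - pd (Some k) gN t x).
Proof.
move=> tI [cN cS]; have h1 := smooth_is_pd (Some k) smooth_S tI cS.
have h2 := smooth_is_pd (Some k) smooth_N tI cN.
exact: is_pdB h1 h2.
Qed.

(** The point x is joined to [r *: evec i1], where both potentials vanish, through a point y
    orthogonal to both. Two arcs at m (4 r) (2 K r M) each make 16 m K r ^ 2 M. *)
Lemma difference_le t x M : t \in `[0, 1] -> 0 < enorm x -> `|x 0 i0| <= enorm x / 2 ->
  sphere_bound t x M -> `|q t x| <= m%:R * (16 * K) * (enorm x * (enorm x * M)).
Proof.
move=> tI x0 p sM; set r := enorm x.
have qL y k : enorm y = r -> `|y 0 i0| <= r / 2 -> `|pd (Some k) q t y| <= 2 * K * (r * M).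
  move=> yr yp; have y0 : 0 < enorm y by rewrite yr.
  rewrite (pdE tI (is_pd_difference k tI (belt_sub y0 _))) ?yr // -yr.
  by apply: (belt_bounds k tI y0 _ _).2; [rewrite yr|move=> z i j zE; apply: sM; rewrite zE yr].
have [y [ny xy y1 y2]] := orthogonal_exists x x0.
have h1 := quarter_circle tI smooth_difference x0 qL erefl ny xy p y2.
have n1 : enorm (r *: evec i1 : V) = r by rewrite enorm_axis // ltW.
have o1 : \sum_i (r *: evec i1 : V) 0 i * y 0 i = 0.
  rewrite (bigD1 i1) //= y1 mulr0 add0r big1 // => i /negPf ii.
  by rewrite !mxE eqxx ii mulr0 mul0r.
have p1 : `|(r *: evec i1 : V) 0 i0| <= r / 2 by rewrite axis_pole normr0 divr_ge0 // ltW.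
have := quarter_circle tI smooth_difference x0 qL n1 ny o1 p1 y2.
have -> : q t (r *: evec i1) = 0.
  by rewrite /q; case: pS => _ -> // _; case: pN => _ -> // _; rewrite subrr.
rewrite subr0 => h2.
have -> : q t x = q t y - (q t y - q t x) by ring.
apply: le_trans (ler_normB _ _) _; apply: le_trans (lerD h2 h1) _.
by rewrite -/r le_eqVlt; apply/orP; left; apply/eqP; ring.
Qed.

(** The argument of [step] is 1/2 + x_i0 / |x|, so the transition takes place exactly between the
    heights - r / 2 and r / 2, where both potentials are controlled. *)
Definition height_step x : R := step (3 / 2 - colat i0 1 x).

Lemma colat_north x : colat i0 1 x = 1 - x 0 i0 / enorm x.
Proof. by rewrite /colat mul1r. Qed.

Lemma height_step_north x : enorm x / 2 < x 0 i0 -> height_step x = 1.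
Proof.
move=> h; have x0 : 0 < enorm x.
  have := le_trans (ler_norm _) (coord_le_enorm x i0); have := enorm_ge0 x; lra.
apply: step1; rewrite colat_north.
have : 1 / 2 <= x 0 i0 / enorm x by rewrite ler_pdivlMr //; lra.
lra.
Qed.

Lemma height_step_south x : enorm x / 2 < - x 0 i0 -> height_step x = 0.
Proof.
move=> h; have x0 : 0 < enorm x.
  by have := ler_norm (- x 0 i0); rewrite normrN; have := coord_le_enorm x i0; have := enorm_ge0 x; lra.
apply: step0; rewrite colat_north.
have : x 0 i0 / enorm x <= - (1 / 2) by rewrite ler_pdivrMr //; lra.
lra.
Qed.

(** It removes a neighbourhood of the origin, where neither the potentials nor [height_step] need be
    smooth, and is constant near all points of norm at least 2. The squared norm keeps it smooth at
    the origin. *)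
Definition outer_step x : R := step (\sum_i x 0 i ^+ 2 - 1).

Lemma smooth_outer_step U : open U -> smooth_on U (fun _ => outer_step).
Proof.
move=> oU k; apply: ck_step => //; apply: ckB => //; last exact: ck_cst.
by apply: ck_sum => // i _; apply: ckM => //; exact: ck_coord.
Qed.

Lemma outer_step0 x : enorm x < 1 -> outer_step x = 0.
Proof.
move=> x1; apply: step0; rewrite subr_le0 -enorm_sqr expr_le1 ?enorm_ge0 //; exact: ltW.
Qed.

Lemma outer_step1 x : 3 / 2 < enorm x -> outer_step x = 1.
Proof.
move=> x1; apply: step1; rewrite -enorm_sqr expr2.
have : 3 / 2 * (3 / 2) <= enorm x * enorm x by apply: ler_pM; lra.
lra.
Qed.

(** Up to the outer factor, the combination of gN and gS with weights [height_step] and its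
    complement. In a polar region one weight is identically zero, so the potential that is singular
    there drops out exactly. *)
Definition glued t x : R :=
  outer_step x * (gS t x - height_step x * q t x).

Lemma glued_north t x : enorm x / 2 < x 0 i0 -> glued t x = outer_step x * gN t x.
Proof. by move=> h; rewrite /glued height_step_north // /q; congr (_ * _); ring. Qed.

Lemma glued_south t x : enorm x / 2 < - x 0 i0 -> glued t x = outer_step x * gS t x.
Proof. by move=> h; rewrite /glued height_step_south // mul0r subr0. Qed.

Definition pole (e : R) : set V := [set x | enorm x / 2 < e * x 0 i0].

Lemma open_pole e : open (pole e).
Proof.
rewrite (_ : pole e = (fun x : V => e * x 0 i0 - enorm x / 2) @^-1` [set u | 0 < u]); last first.
  by apply/seteqP; split => x; rewrite /pole /= subr_gt0.
apply: open_comp; last exact: open_gt.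
move=> x _.
have c : (fun x : V => x 0 i0) y @[y --> x] --> x 0 i0 by exact: coord_continuous.
have c1 : e * (y : V) 0 i0 @[y --> x] --> e * x 0 i0 by exact: cvgM (cvg_cst e) c.
have c2 : enorm (y : V) / 2 @[y --> x] --> enorm x / 2.
  exact: cvgM (@enorm_continuous R m x) (cvg_cst _).
exact: cvgB c1 c2.
Qed.

Lemma pole_cap e : e * e = 1 -> pole e `<=` cap i0 e.
Proof.
move=> e2 x; rewrite /pole /cap /= => h.
by have := enorm_ge0 x; lra.
Qed.

Lemma smooth_height_step : smooth_on belt (fun _ => height_step).
Proof.
move=> k; apply: ck_step; first exact: open_belt.
apply: ckB; [exact: open_belt|exact: ck_cst open_belt|].
have H : ck (cap i0 1) k (fun _ => colat i0 1) := @smooth_colat R m i0 1 k.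
by apply: ck_sub H => x [].
Qed.

Lemma pole_or_belt x : 0 < enorm x ->
  [\/ pole 1 x, pole (-1) x | `|x 0 i0| <= enorm x / 2].
Proof.
move=> x0; have [h|h] := ltP (enorm x / 2) (1 * x 0 i0); first by constructor 1.
have [h'|h'] := ltP (enorm x / 2) (-1 * x 0 i0); first by constructor 2.
by constructor 3; rewrite ler_norml; lra.
Qed.

(** The unit ball, the two polar regions and the belt form an open cover, and on each of them
    [glued] has a smooth expression. *)
Lemma smooth_glued : smooth_on setT glued.
Proof.
move=> k; apply: ck_near; first exact: openT.
move=> x _; have [x1|x1] := ltP (enorm x) 1.
  have oU : open [set x : V | enorm x < 1].
    rewrite (_ : [set x | _] = @enorm R m @^-1` [set u | u < 1]) //.
    by apply: open_comp; [move=> y _; exact: enorm_continuous|exact: open_lt].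
  exists [set x : V | enorm x < 1]; split => //.
  apply: (ck_ext oU _ (ck_cst k 0 oU)) => t y _ /= y1.
  by rewrite /glued outer_step0 // mul0r.
have x0 : 0 < enorm x by lra.
have [xN|xS|xB] := pole_or_belt x0.
- exists (pole 1); split => //; first exact: open_pole.
  have H : ck (pole 1) k (fun t x => outer_step x * gN t x).
    have HO : ck (pole 1) k (fun _ => outer_step) := smooth_outer_step (@open_pole 1) k.
    apply: ckM => //; first exact: open_pole.
    by apply: ck_sub (smooth_N k); apply: pole_cap; rewrite mulr1.
  apply: (@ck_ext R m (pole 1) k _ glued (@open_pole 1) _ H) => t y _; rewrite /pole /= mul1r => h.
  by rewrite glued_north.
- exists (pole (-1)); split => //; first exact: open_pole.
  have H : ck (pole (-1)) k (fun t x => outer_step x * gS t x).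
    have HO : ck (pole (-1)) k (fun _ => outer_step) := smooth_outer_step (@open_pole (-1)) k.
    apply: ckM => //; first exact: open_pole.
    by apply: ck_sub (smooth_S k); apply: pole_cap; rewrite mulrNN mulr1.
  apply: (@ck_ext R m (pole (-1)) k _ glued (@open_pole (-1)) _ H) => t y _; rewrite /pole /= mulN1r => h.
  by rewrite glued_south.
exists belt; split; [exact: open_belt|exact: belt_sub|].
have oB := open_belt.
apply: ckM => //; first exact: smooth_outer_step.
apply: ckB => //; first by apply: ck_sub (smooth_S k) => y [].
by apply: ckM => //; [exact: smooth_height_step|exact: smooth_difference].
Qed.

Lemma glued_bound : exists2 C : R, 0 <= C & forall t x M k, t \in `[0, 1] -> 2 <= enorm x ->
  sphere_bound t x M -> `|a k t x - pd (Some k) glued t x| <= C * (enorm x * M).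
Proof.
have [Cs Cs0 sb] := @step_derive_bounded R.
have C0 : 0 <= Cs * 2 * (m%:R * (16 * K)).
  by apply: mulr_ge0; [exact: mulr_ge0|apply: mulr_ge0 => //; exact: mulr_ge0].
(* In the belt, K bounds dgS - a, the middle term is the slope Cs (2 / r) of the cut-off times the
   bound on gS - gN, and 2 K bounds the difference of the two gradients. Near the poles K alone
   suffices. *)
exists (K + Cs * 2 * (m%:R * (16 * K)) + 2 * K); first by apply: addr_ge0; [exact: addr_ge0|exact: mulr_ge0].
move=> t x M k tI x2 sM; have M0 := sphere_bound_ge0 sM; have x0 : 0 < enorm x by lra.
have oN : open [set y : V | 3 / 2 < enorm y] := @open_enorm_gt R m _.
have xN : [set y : V | 3 / 2 < enorm y] x by rewrite /=; lra.
have rM0 : 0 <= enorm x * M by rewrite mulr_ge0 // ltW.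
have weak (u : R) : u <= K * (enorm x * M) -> u <= (K + Cs * 2 * (m%:R * (16 * K)) + 2 * K) * (enorm x * M).
  move=> h; apply: le_trans h _; apply: ler_wpM2r => //.
  by rewrite -addrA lerDl addr_ge0 // mulr_ge0.
have [hN|hS|hB] := pole_or_belt x0.
- have H : is_pd (Some k) glued t x (pd (Some k) gN t x).
    have cN : cap i0 1 x by apply: pole_cap hN; rewrite ?mulrNN mulr1.
    apply: (@is_pd_ext R m (pole 1 `&` [set y : V | 3 / 2 < enorm y]) (Some k) gN glued t x _
      (openI (@open_pole 1) oN) (conj hN xN) tI _ (smooth_is_pd (Some k) smooth_N tI cN)).
    move=> t' y _ [h1 h2]; rewrite glued_north ?outer_step1 ?mul1r //.
    by move: h1; rewrite /pole /= mul1r.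
  rewrite (pdE tI H) distrC; apply: weak; case: pN => _ _; apply => //.
    by apply: pole_cap hN; rewrite mulr1.
  by move: hN; rewrite /pole /=; lra.
- have H : is_pd (Some k) glued t x (pd (Some k) gS t x).
    have cS : cap i0 (-1) x by apply: pole_cap hS; rewrite ?mulrNN mulr1.
    apply: (@is_pd_ext R m (pole (-1) `&` [set y : V | 3 / 2 < enorm y]) (Some k) gS glued t x _
      (openI (@open_pole (-1)) oN) (conj hS xN) tI _ (smooth_is_pd (Some k) smooth_S tI cS)).
    move=> t' y _ [h1 h2]; rewrite glued_south ?outer_step1 ?mul1r //.
    by move: h1; rewrite /pole /= mulN1r.
  rewrite (pdE tI H) distrC; apply: weak; case: pS => _ _; apply => //.
    by apply: pole_cap hS; rewrite mulrNN mulr1.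
  by move: hS; rewrite /pole /=; lra.
have [f cf df] := @step_is_derive R.
have Bx := belt_sub x0 hB; have [cN cS] := Bx.
have Hc := is_pd_colat i0 1 k t x0.
set w := - _ in Hc.
have wle : `|w| <= 2 / enorm x := colat_slope i0 (mul1r 1) k x0.
have Hc' : is_pd (Some k) (fun _ x => 3 / 2 - colat i0 1 x) t x (- w).
  by rewrite -sub0r; exact: is_pdB (is_pd_cst _ _ _ _) Hc.
set u := 3 / 2 - colat i0 1 x.
have Hh : is_pd (Some k) (fun _ => height_step) t x (f u * - w) := is_pd_comp Hc' (df u).
have fu : `|f u| <= Cs.
  apply: (sb u) => //; rewrite /u colat_north.
  have : `|x 0 i0 / enorm x| <= 1 by rewrite normf_div (gtr0_norm x0) ler_pdivrMr // mul1r coord_le_enorm.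
  by rewrite ler_norml; lra.
have HG := is_pdB (smooth_is_pd (Some k) smooth_S tI cS) (is_pdM Hh (is_pd_difference k tI Bx)).
have H := is_pd_ext (F := fun t x => gS t x - height_step x * q t x) (G := glued)
  (openI open_belt oN) (conj Bx xN) tI _ HG.
rewrite (pdE tI (H _)); last by move=> t' y _ [_ h2]; rewrite /glued outer_step1 // mul1r.
have [bS bq] := belt_bounds k tI x0 hB sM; have qb := difference_le tI x0 hB sM.
have /andP[h0 h1] := step_itv u.
have -> : a k t x - (pd (Some k) gS t x - (f u * - w * q t x +
     height_step x * (pd (Some k) gS t x - pd (Some k) gN t x)))
   = - (pd (Some k) gS t x - a k t x) + f u * - w * q t x
     + step u * (pd (Some k) gS t x - pd (Some k) gN t x) by rewrite /height_step -/u; ring.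
apply: le_trans (ler_normD _ _) _; rewrite 2!mulrDl; apply: lerD; last first.
  rewrite normrM (ger0_norm h0) -[leRHS]mul1r; apply: ler_pM => //.
apply: le_trans (ler_normD _ _) _; apply: lerD; first by rewrite normrN.
have -> : Cs * 2 * (m%:R * (16 * K)) * (enorm x * M) =
    Cs * (2 / enorm x) * (m%:R * (16 * K) * (enorm x * (enorm x * M))).
  by field; rewrite gt_eqF.
rewrite !normrM normrN; apply: ler_pM => //.
exact: ler_pM.
Qed.

End Glue.

(** Subtracting a gradient keeps the exterior derivative, by symmetry of the second derivatives of
    [glued]. *)
Lemma bounded_primitive : exists al : 'I_m -> R -> V -> R,
  [/\ forall j, smooth_on setT (al j),
      forall i j t x, t \in `[0, 1] -> pd (Some i) (al j) t x - pd (Some j) (al i) t x = s i j t x &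
      exists2 C : R, 0 <= C & forall t x M k, t \in `[0, 1] -> 2 <= enorm x ->
        sphere_bound t x M -> `|al k t x| <= C * (enorm x * M)].
Proof.
have [gN pN] := potential_exists (mulr1 1).
have [gS pS] : exists g, potential_on (-1) g by apply: potential_exists; rewrite mulrNN mulr1.
have sF := smooth_glued pN pS; have [C C0 bC] := glued_bound pN pS.
pose al j t x := a j t x - pd (Some j) (glued gN gS) t x.
have sal j : smooth_on setT (al j).
  by move=> k; apply: ckB; [exact: openT|exact: smooth_a|exact: smooth_pd].
exists al; split => //; last by exists C.
move=> i j t x tI.
have H i' j' : is_pd (Some i') (al j') t x
    (pd (Some i') (a j') t x - pd (Some i') (pd (Some j') (glued gN gS)) t x).
  exact: is_pdB (smooth_is_pd (Some i') (smooth_a j') tI I)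
    (smooth_is_pd (Some i') (smooth_pd (Some j') sF) tI I).
rewrite (pdE tI (H i j)) (pdE tI (H j i)) (@pdC R m setT (glued gN gS) (Some i) (Some j) t x openT (sF 2) tI I).
by rewrite -(da x i j tI); ring.
Qed.

End Potentials.

Lemma spherical_primitive (s : 'I_m -> 'I_m -> R -> V -> R) :
  (forall i j, smooth_on setT (s i j)) ->
  (forall i j t x, t \in `[0, 1] -> s i j t x = - s j i t x) ->
  (forall i j k t x, t \in `[0, 1] ->
    pd (Some i) (s j k) t x + pd (Some j) (s k i) t x + pd (Some k) (s i j) t x = 0) ->
  exists al : 'I_m -> R -> V -> R,
  [/\ forall j, smooth_on setT (al j),
      forall i j t x, t \in `[0, 1] -> pd (Some i) (al j) t x - pd (Some j) (al i) t x = s i j t x &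
      exists2 C : R, 0 <= C & forall t x M k, t \in `[0, 1] -> 2 <= enorm x ->
        sphere_bound s t x M -> `|al k t x| <= C * (enorm x * M)].
Proof.
move=> ss sa sc; apply: (bounded_primitive (a := radial_primitive s)) => //.
- exact: smooth_radial_primitive.
- by move=> t x i j tI; exact: radial_primitiveP.
- by move=> t x tI; exact: radial_primitive_radial.
Qed.

End SphericalPrimitive.

(** * Operator norms, matrix entries and inverse matrices *)

Section Norms.
Context {R : realType} {m : nat}.
Local Notation V := 'rV[R]_m.
Implicit Types (A : 'M[R]_m) (F : V -> 'M[R]_m) (u : V) (L r : R).

Lemma enorm_le u L : 0 <= L -> (forall i, `|u 0 i| <= L) -> enorm u <= m%:R * L.
Proof.
move=> L0 uL; have mL : 0 <= m%:R * L by rewrite mulr_ge0.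
rewrite -ler_sqr ?nnegrE ?enorm_ge0 // enorm_sqr.
apply: (@le_trans _ _ (\sum_(i < m) L ^+ 2)).
  by apply: ler_sum => i _; rewrite -real_normK ?num_real // ler_sqr ?nnegrE.
rewrite sumr_const card_ord -[leLHS]mulr_natl exprMn ler_wpM2r ?sqr_ge0 // -natrX ler_nat.
by case: (m) => // k; rewrite expnS expn1 leq_pmull.
Qed.

Lemma enorm_row_le A L u : 0 <= L -> (forall i j, `|A i j| <= L) -> enorm u <= 1 ->
  enorm (u *m A) <= m%:R * (m%:R * L).
Proof.
move=> L0 AL u1; apply: enorm_le => [|j]; first exact: mulr_ge0.
rewrite mxE; apply: le_trans (ler_norm_sum _ _ _) _.
rewrite -[m in m%:R]card_ord mulr_natl -sumr_const; apply: ler_sum => i _.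
rewrite normrM -[leRHS]mul1r; apply: ler_pM => //.
exact: le_trans (coord_le_enorm _ _) u1.
Qed.

Lemma opnorm_le A L : 0 <= L -> (forall i j, `|A i j| <= L) -> opnorm A <= m%:R * (m%:R * L).
Proof.
move=> L0 AL; apply: ge_sup.
  exists (enorm ((0 : V) *m A)), 0 => //.
  by rewrite /= /enorm big1 ?sqrtr0 // => i _; rewrite mxE expr0n.
by move=> _ [u u1 <-]; exact: enorm_row_le.
Qed.

Lemma coord_le_opnorm A i j : `|A i j| <= opnorm A.
Proof.
pose L := \sum_i \sum_j `|A i j|.
have AL k l : `|A k l| <= L.
  rewrite /L (bigD1 k) //= (bigD1 l) //= -addrA lerDl addr_ge0 //; apply: sumr_ge0 => // ? _.
  exact: sumr_ge0.
have L0 : 0 <= L by apply: sumr_ge0 => ? _; exact: sumr_ge0.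
apply: (@le_trans _ _ (enorm (evec i *m A))).
  have := coord_le_enorm (evec i *m A) j.
  by rewrite /evec -rowE mxE.
apply: ub_le_sup.
  by exists (m%:R * (m%:R * L)) => _ [u u1 <-]; exact: enorm_row_le.
exists (evec i) => //=; rewrite /enorm (bigD1 i) //= big1 ?addr0 => [|k /negPf ki].
  by rewrite mxE !eqxx expr1n sqrtr1.
by rewrite mxE ki andbF expr0n.
Qed.

(** A supremum dominates its set only when that set is bounded. The crude bound L serves no other
    purpose; compactness of spheres will supply it. *)
Lemma coord_le_sphere_norm F L r y i j : 0 <= L ->
  (forall x i j, enorm x = r -> `|F x i j| <= L) -> enorm y = r -> `|F y i j| <= sphere_norm r F.
Proof.
move=> L0 FL yr; apply: le_trans (coord_le_opnorm _ _ _) _.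
apply: ub_le_sup; last by exists y.
exists (m%:R * (m%:R * L)) => _ [x xr <-]; apply: opnorm_le => // k l; exact: FL.
Qed.

End Norms.

Section MatrixSmooth.
Context {R : realType} {m : nat}.
Local Notation V := 'rV[R]_m.
Implicit Types (U : set V) (t : R) (x : V).

Lemma ck_det U k n (A : R -> V -> 'M[R]_n) : open U ->
  (forall i j, ck U k (fun t x => A t x i j)) -> ck U k (fun t x => \det (A t x)).
Proof.
move=> oU kA; apply: ck_sum => // s _; apply: ckM => //; first exact: ck_cst.
by apply: ck_prod.
Qed.

(** Cramer's formula expresses the entries as polynomials in those of A divided by the
    determinant. *)
Lemma ck_invmx U k n (A : R -> V -> 'M[R]_n) i j : open U ->
  (forall i j, ck U k (fun t x => A t x i j)) ->
  (forall t x, t \in `[0, 1] -> U x -> A t x \in unitmx) ->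
  ck U k (fun t x => invmx (A t x) i j).
Proof.
move=> oU kA uA.
have H : ck U k (fun t x => (\det (A t x))^-1 * cofactor (A t x) j i).
  apply: ckM => //.
    apply: ck_inv => //; first exact: ck_det.
    by move=> t x tI Ux; rewrite -unitfE; exact: uA.
  apply: ckM => //; first exact: ck_cst.
  apply: ck_det => // a b.
  by under eq_fun do under eq_fun do rewrite !mxE; exact: kA.
apply: (ck_ext oU _ H) => t x tI Ux.
by rewrite /invmx uA // !mxE.
Qed.

End MatrixSmooth.

(** * The algebra of Cartan's formula *)

Section MoserIdentity.
Context {R : comPzRingType} {m : nat}.
(** Values at one point: U and V are pushed vectors, and [dX l i], [da l j], [dw l i j] stand for
    the derivatives along x_l of X_i, al_j, w_ij. [contraction] is then i_X w = - al differentiated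
    along x_l, and the identity is pure algebra. *)
Variables (U V X : 'I_m -> R) (w s dX da : 'I_m -> 'I_m -> R) (dw : 'I_m -> 'I_m -> 'I_m -> R).
Hypothesis anti_w : forall i j, w i j = - w j i.
Hypothesis anti_dw : forall l i j, dw l i j = - dw l j i.
Hypothesis closed_w : forall i j k, dw i j k + dw j k i + dw k i j = 0.
Hypothesis contraction : forall l j, \sum_i (dX l i * w i j + X i * dw l i j) = - da l j.
Hypothesis da_s : forall p q, da p q - da q p = s p q.

(* Cartan's formula: the Lie derivative of [w] along [X] is [d (i_X w)], which cancels [s]. *)
Lemma moser_identity : \sum_i \sum_j
  (((\sum_l U l * dX l i) * V j + U i * (\sum_l V l * dX l j)) * w i j
   + U i * V j * (s i j + \sum_l X l * dw l i j)) = 0.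
Proof.
have T1 : \sum_i \sum_j (\sum_l U l * dX l i) * V j * w i j =
    \sum_p \sum_q U p * V q * \sum_i dX p i * w i q.
  rewrite exchange_big [RHS]exchange_big; apply: eq_bigr => q _ /=.
  under eq_bigr do rewrite !mulr_suml.
  rewrite exchange_big; apply: eq_bigr => p _ /=; rewrite mulr_sumr; apply: eq_bigr => i _; ring.
have T2 : \sum_i \sum_j U i * (\sum_l V l * dX l j) * w i j =
    \sum_p \sum_q U p * V q * \sum_j dX q j * w p j.
  apply: eq_bigr => p _.
  under eq_bigr do rewrite mulr_sumr mulr_suml.
  rewrite exchange_big; apply: eq_bigr => q _ /=; rewrite mulr_sumr; apply: eq_bigr => i _; ring.
under eq_bigr do under eq_bigr do rewrite mulrDl.
under eq_bigr do rewrite 2!big_split /=.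
rewrite 2!big_split /= T1 T2 -!big_split /= big1 // => p _.
rewrite -!big_split /= big1 // => q _; rewrite -!mulrDr.
have C1 := contraction p q; have C2 := contraction q p.
rewrite big_split /= in C1; rewrite big_split /= in C2.
have E1 : \sum_i dX p i * w i q = - da p q - \sum_i X i * dw p i q by rewrite -C1 addrK.
have E2 : \sum_j dX q j * w p j = da q p + \sum_i X i * dw q i p.
  transitivity (- \sum_j dX q j * w j p).
    by rewrite -sumrN; apply: eq_bigr => j _; rewrite anti_w mulrN.
  by rewrite -[da q p]opprK -C2 opprD addrNK.
have E3 : \sum_l X l * dw l p q = \sum_i X i * dw p i q - \sum_i X i * dw q i p.
  rewrite -sumrB; apply: eq_bigr => i _; rewrite -mulrBr; congr (_ * _).
  have /eqP := closed_w i p q; rewrite -addrA addr_eq0 => /eqP ->.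
  by rewrite (anti_dw p q i); ring.
by rewrite E1 E2 E3 -da_s; ring.
Qed.

End MoserIdentity.

(** * Moser's argument *)

Section Moser.
Context {R : realType} {m : nat}.
Local Notation V := 'rV[R]_m.
Implicit Types (t : R) (x u v : V).
Variable w : R -> V -> 'M[R]_m.
Hypothesis iso : symplectic_isotopy w.

Let W i j t x : R := w t x i j.

Let s i j : R -> V -> R := pd None (W i j).

Lemma smooth_components i j : smooth_on setT (W i j).
Proof. by case: iso => sw _ _ k; apply: Ck_path_ck; exact: sw. Qed.

Lemma smooth_dot i j : smooth_on setT (s i j).
Proof. by move=> k; apply: (smooth_pd None (smooth_components i j)). Qed.

Lemma components_anti i j t x : t \in `[0, 1] -> W i j t x = - W j i t x.
Proof.
case: iso => _ symp _ tI; have [_ anti _ _] := symp t tI.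
by have := congr1 (fun A : 'M[R]_m => A j i) (anti x); rewrite !mxE.
Qed.

Lemma pd_components_anti d i j t x : t \in `[0, 1] -> pd d (W i j) t x = - pd d (W j i) t x.
Proof.
move=> tI; apply: pdE => //.
have H := is_pdN (@smooth_is_pd R m setT _ d t x (smooth_components j i) tI I).
by apply: is_pd_ext openT I tI _ H => t' x' t'I _; rewrite -components_anti.
Qed.

Lemma form2_evec t x i j : form2 (w t) x (evec i) (evec j) = W i j t x.
Proof.
by rewrite /form2 /pairing /evec -rowE trmx_delta -colE !mxE.
Qed.

Lemma components_closed i j k t x : t \in `[0, 1] ->
  pd (Some i) (W j k) t x + pd (Some j) (W k i) t x + pd (Some k) (W i j) t x = 0.
Proof.
move=> tI; case: iso => _ symp _; have [_ _ closed _] := symp t tI.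
have D i' j' k' : 'D_(evec i') (fun y => form2 (w t) y (evec j') (evec k')) x
    = pd (Some i') (W j' k') t x.
  rewrite (_ : (fun y => _) = W j' k' t); last by apply/funext => y; exact: form2_evec.
  rewrite (@ck_derive R m setT (W j' k') t x (evec i') openT (smooth_components j' k' 1) tI I).
  rewrite (bigD1 i') //= big1 ?addr0 => [|l /negPf li]; first by rewrite mxE !eqxx mul1r.
  by rewrite mxE li andbF mul0r.
by have := closed x (evec i) (evec j) (evec k); rewrite /d2 !D.
Qed.

Lemma dot_anti i j t x : t \in `[0, 1] -> s i j t x = - s j i t x.
Proof. exact: pd_components_anti. Qed.

(** Time and space derivatives commute, so the left side is the time derivative of the closedness
    relation for w, whose left side is zero at all times. *)
Lemma dot_closed i j k t x : t \in `[0, 1] ->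
  pd (Some i) (s j k) t x + pd (Some j) (s k i) t x + pd (Some k) (s i j) t x = 0.
Proof.
move=> tI.
have C i' j' k' : pd (Some i') (s j' k') t x = pd None (pd (Some i') (W j' k')) t x.
  exact: (@pdC R m setT (W j' k') (Some i') None t x openT (smooth_components j' k' 2) tI I).
have P i' j' k' : is_pd None (pd (Some i') (W j' k')) t x (pd (Some i') (s j' k') t x).
  rewrite C; have sm := smooth_pd (Some i') (smooth_components j' k').
  exact: (smooth_is_pd None sm tI I).
have H := is_pdD (is_pdD (P i j k) (P j k i)) (P k i j).
apply: (is_pd_unique tI H).
apply: (@is_pd_ext R m setT None (fun _ _ => 0)) openT I tI _ (is_pd_cst None 0 t x) => t' x' t'I _.
by rewrite components_closed.
Qed.

Lemma path_dotE i j t x : t \in `[0, 1] -> path_dot w t x i j = s i j t x.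
Proof. by case: iso => sw _ _ tI; exact: path_dot_coord. Qed.

Lemma unit_components t x : t \in `[0, 1] -> w t x \in unitmx.
Proof. by case: iso => _ symp _ tI; case: (symp t tI). Qed.

Lemma smooth_inverse i j : smooth_on setT (fun t x => invmx (w t x) i j).
Proof.
move=> k; apply: ck_invmx => [|i' j'|t x tI _]; first exact: openT.
  exact: smooth_components.
exact: unit_components.
Qed.

Lemma sphere_coord_le (F : R -> V -> 'M[R]_m) t y i j : (forall i j t x, jcont (fun t x => F t x i j) t x) ->
  t \in `[0, 1] -> `|F t y i j| <= sphere_norm (enorm y) (F t).
Proof.
move=> cF tI.
have [L L0 FL] := @jcont_bound R m _ (fun ij : 'I_m * 'I_m => fun t x => F t x ij.1 ij.2) (enorm y)
  (fun ij t x => cF ij.1 ij.2 t x).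
apply: (@coord_le_sphere_norm R m (F t) L (enorm y) y i j L0) => // x k l xy.
by apply: (FL (k, l)) => //; rewrite -xy norm_le_enorm.
Qed.

Section Field.
Variable al : 'I_m -> R -> V -> R.
Hypothesis smooth_al : forall j, smooth_on setT (al j).
Hypothesis dal : forall i j t x, t \in `[0, 1] ->
  pd (Some i) (al j) t x - pd (Some j) (al i) t x = s i j t x.

(* The solution of [i_X w = - al]. *)
Definition moser_field t x : V := \row_j - \sum_i al i t x * invmx (w t x) i j.

Let X (j : 'I_m) t x : R := moser_field t x 0 j.

Lemma smooth_moser_field j : smooth_on setT (fun t x => moser_field t x 0 j).
Proof.
move=> k; have H : ck setT k (fun t x => - \sum_i al i t x * invmx (w t x) i j).
  apply: ckN; first exact: openT.
  apply: ck_sum; first exact: openT.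
  move=> i _; apply: ckM; [exact: openT|exact: smooth_al|exact: smooth_inverse].
by apply: ck_ext openT _ H => t x _ _; rewrite mxE.
Qed.

Lemma moser_fieldP j t x : t \in `[0, 1] -> \sum_i X i t x * W i j t x = - al j t x.
Proof.
move=> tI; pose a : V := \row_i al i t x.
have E : moser_field t x = - (a *m invmx (w t x)).
  by apply/rowP => k; rewrite !mxE; congr (- _); apply: eq_bigr => i _; rewrite mxE.
transitivity ((moser_field t x *m w t x) 0 j); first by rewrite mxE.
by rewrite E mulNmx mxE mulmxKV ?unit_components // mxE.
Qed.

Lemma moser_field_growth (C C0 r0 : R) : 0 <= C -> 0 < C0 -> 1 < r0 ->
  (forall t x M k, t \in `[0, 1] -> 2 <= enorm x -> sphere_bound s t x M ->
     `|al k t x| <= C * (enorm x * M)) ->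
  (forall r t : R, r0 <= r -> t \in `[0, 1] ->
     sphere_norm r (fun x => invmx (w t x)) * sphere_norm r (path_dot w t) <= C0 * ln r) ->
  exists2 A : R, 0 <= A & forall t x, t \in `[0, 1] -> enorm (moser_field t x) <= A * growth (enorm x).
Proof.
move=> c0 C00 r01 alC hyp; pose r1 := Num.max 2 r0.
have [B B0 XB] := @jcont_bound R m _ X r1 (fun j t x => smooth_jcont (smooth_moser_field j) I).
pose A := m%:R * (B + m%:R * (C * C0)).
have A0 : 0 <= A by rewrite mulr_ge0 // addr_ge0 // mulr_ge0 // mulr_ge0 // ltW.
have E0 x := enorm_ge0 x.
have l0 x : 0 <= ln (1 + enorm x ^+ 2) by rewrite ln_ge0 // lerDl sqr_ge0.
have g1 x : 1 <= growth (enorm x).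
  by rewrite /growth -[leLHS]mulr1; apply: ler_pM; rewrite // lerDl.
exists A => // t x tI; have [xr|xr] := leP (enorm x) r1.
  apply: le_trans (enorm_le B0 _) _.
    by move=> j; apply: XB => //; apply: le_trans xr; exact: norm_le_enorm.
  rewrite -[leLHS]mulr1; apply: ler_pM => //; first exact: mulr_ge0.
  by rewrite ler_wpM2l // lerDl mulr_ge0 // mulr_ge0 // ltW.
have x2 : 2 <= enorm x by apply: ltW; apply: le_lt_trans xr; rewrite le_max lexx.
have xr0 : r0 <= enorm x by apply: ltW; apply: le_lt_trans xr; rewrite le_max lexx orbT.
have x0 : 0 < enorm x by lra.
set N := sphere_norm (enorm x) (fun x => invmx (w t x)).
set M := sphere_norm (enorm x) (path_dot w t).
have MB : sphere_bound s t x M.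
  move=> y i j yx; rewrite -path_dotE // /M -yx.
  apply: (@sphere_coord_le (path_dot w)) => // i' j' t' x'.
  apply: (@jcont_ext _ _ setT (s i' j')) => //; first exact: openT.
    by move=> t'' x'' tI'' _; rewrite path_dotE.
  exact: smooth_jcont (smooth_dot i' j') I.
have NB i j : `|invmx (w t x) i j| <= N.
  apply: (@sphere_coord_le (fun t x => invmx (w t x))) => // i' j' t' x'.
  exact: smooth_jcont (smooth_inverse i' j') I.
have lr : ln (enorm x) <= ln (1 + enorm x ^+ 2).
  rewrite ler_ln ?posrE // ?ltr_pwDl ?sqr_ge0 //.
  have : enorm x * 1 <= enorm x * enorm x by rewrite ler_wpM2l //; lra.
  by rewrite expr2; lra.
have XL j : `|moser_field t x 0 j| <= m%:R * (C * C0) * growth (enorm x).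
  rewrite mxE normrN; apply: le_trans (ler_norm_sum _ _ _) _.
  have -> : m%:R * (C * C0) * growth (enorm x) = \sum_(i < m) C * C0 * growth (enorm x).
    by rewrite sumr_const card_ord -mulrA mulr_natl.
  apply: ler_sum => i _; rewrite normrM.
  apply: (@le_trans _ _ (C * (enorm x * M) * N)).
    by apply: ler_pM => //; exact: alC.
  have -> : C * (enorm x * M) * N = C * enorm x * (N * M) by ring.
  apply: (@le_trans _ _ (C * enorm x * (C0 * ln (enorm x)))).
    by rewrite ler_wpM2l ?mulr_ge0 //; exact: hyp.
  have -> : C * enorm x * (C0 * ln (enorm x)) = C * C0 * (enorm x * ln (enorm x)) by ring.
  rewrite ler_wpM2l //; first by rewrite mulr_ge0 // ltW.
  by rewrite /growth; apply: ler_pM; rewrite ?ln_ge0 // ?lerDr //; lra.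
have g0 : 0 <= m%:R * (C * C0) * growth (enorm x).
  by rewrite mulr_ge0 ?(le_trans ler01 (g1 x)) // mulr_ge0 // mulr_ge0 // ltW.
apply: le_trans (enorm_le g0 XL) _; rewrite /A -[leRHS]mulrA ler_wpM2l //.
by rewrite ler_wpM2r ?(le_trans ler01 (g1 x)) // lerDr.
Qed.

Section Flow.
Variable phi : R -> V -> V.
Hypothesis fphi : flow moser_field phi.

Let P i t x : R := phi t x 0 i.

Let smooth_P i : smooth_on setT (P i).
Proof. by move=> k; exact: flow_ck smooth_moser_field fphi i. Qed.

Let rowP_phi t x : \row_j P j t x = phi t x.
Proof. by apply/rowP => j; rewrite mxE. Qed.

(* The components of [d (phi t) x u]. *)
Definition push (u : V) (i : 'I_m) t x : R := \sum_k u 0 k * pd (Some k) (P i) t x.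

Lemma smooth_push u i : smooth_on setT (push u i).
Proof.
move=> k; apply: ck_sum; first exact: openT.
move=> l _; apply: ckZ; first exact: openT.
exact: smooth_pd (Some l) (smooth_P i) k.
Qed.

Lemma push_diff u i t x : t \in `[0, 1] -> ('d (phi t) x u) 0 i = push u i t x.
Proof.
move=> tI; have k1 j : ck setT 1 (fun t x => phi t x 0 j) by exact: smooth_P.
rewrite -deriveE; last exact: (ck_differentiable_row openT k1 tI I).
exact: (derive_row u i openT k1 tI I).
Qed.

Lemma pd_time_P i t x : t \in `[0, 1] -> is_pd None (P i) t x (X i t (phi t x)).
Proof. by move=> tI; apply: is_pd_time; exact: flow_solves fphi x i t tI. Qed.

Lemma is_pd_along F t x : smooth_on setT F -> t \in `[0, 1] ->
  is_pd None (fun t x => F t (phi t x)) t x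
    (pd None F t (phi t x) + \sum_l X l t (phi t x) * pd (Some l) F t (phi t x)).
Proof.
move=> sF tI.
have := is_pd_chain openT (sF 1%N) tI I (fun l => pd_time_P l x tI).
rewrite rowP_phi mul1r.
by under eq_fun do under eq_fun do rewrite rowP_phi.
Qed.

(** This is the linear variational equation: the time derivative is exchanged with the spatial one,
    and then the equation of the flow is differentiated by the chain rule. *)
Lemma is_pd_push u i t x : t \in `[0, 1] ->
  is_pd None (push u i) t x (\sum_l push u l t x * pd (Some l) (X i) t (phi t x)).
Proof.
move=> tI.
have D k : pd None (pd (Some k) (P i)) t x = \sum_l pd (Some k) (P l) t x * pd (Some l) (X i) t (phi t x).
  rewrite (@pdC R m setT (P i) None (Some k) t x openT (smooth_P i 2) tI I).
  apply: pdE => //.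
  have := is_pd_chain openT (smooth_moser_field i 1) tI I
    (fun l => @smooth_is_pd R m setT (P l) (Some k) t x (smooth_P l) tI I).
  rewrite /= mul0r add0r rowP_phi.
  apply: is_pd_ext openT I tI _ => t' x' t'I _.
  by rewrite (pdE t'I (pd_time_P i x' t'I)) rowP_phi.
have -> : \sum_l push u l t x * pd (Some l) (X i) t (phi t x) =
    \sum_k (0 * pd (Some k) (P i) t x + u 0 k * pd None (pd (Some k) (P i)) t x).
  rewrite /push; under eq_bigr do rewrite mulr_suml.
  rewrite exchange_big; apply: eq_bigr => k _ /=; rewrite D mul0r add0r mulr_sumr.
  by apply: eq_bigr => l _; rewrite mulrA.
apply: is_pd_sum => k _; apply: is_pdM; first exact: is_pd_cst.
exact: smooth_is_pd (smooth_pd (Some k) (smooth_P i)) tI I.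
Qed.

Definition pulled u v t x : R :=
  \sum_i \sum_j push u i t x * push v j t x * W i j t (phi t x).

(** Differentiating the product gives two terms from the pushed vectors and one from w along the
    trajectory; their sum is the expression of [moser_identity] at the point phi t x. *)
Lemma is_pd_pulled u v t x : t \in `[0, 1] -> is_pd None (pulled u v) t x 0.
Proof.
move=> tI; set y := phi t x.
have dX l i : is_pd (Some l) (X i) t y (pd (Some l) (X i) t y).
  exact: smooth_is_pd (smooth_moser_field i) tI I.
have dW d i j : is_pd d (W i j) t y (pd d (W i j) t y).
  exact: smooth_is_pd (smooth_components i j) tI I.
have H : \sum_i \sum_j
  (((\sum_l push u l t x * pd (Some l) (X i) t y) * push v j t x
      + push u i t x * (\sum_l push v l t x * pd (Some l) (X j) t y)) * W i j t y
   + push u i t x * push v j t x * (s i j t y + \sum_l X l t y * pd (Some l) (W i j) t y)) = 0.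
  apply: (@moser_identity R m _ _ _ _ _ (fun l i => pd (Some l) (X i) t y)
    (fun l j => pd (Some l) (al j) t y) (fun l i j => pd (Some l) (W i j) t y)).
  - by move=> i j; exact: components_anti.
  - by move=> l i j; exact: pd_components_anti.
  - by move=> i j k; exact: components_closed.
  (* Both sides are the derivative along x_l of one function, since i_X w = - al holds identically
     in x. *)
  - move=> l j; apply: (is_pd_unique (d := Some l) (F := fun t x => - al j t x) tI).
      have H := is_pd_sum (index_enum _) (P := xpredT) (fun i _ => is_pdM (dX l i) (dW (Some l) i j)).
      by apply: is_pd_ext openT I tI _ H => t' x' t'I _; exact: moser_fieldP.
    exact: is_pdN (smooth_is_pd (Some l) (smooth_al j) tI I).
  - by move=> p q; exact: dal.
rewrite -H; apply: is_pd_sum => i _; apply: is_pd_sum => j _; apply: is_pdM.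
  by apply: is_pdM; exact: is_pd_push.
exact: (is_pd_along x (smooth_components i j) tI).
Qed.

Lemma smooth_pulled u v : smooth_on setT (pulled u v).
Proof.
move=> k; have oT := @openT V.
apply: ck_sum => // i _; apply: ck_sum => // j _; apply: ckM => //.
  by apply: ckM => //; exact: smooth_push.
have H : ck setT k (fun t x => W i j t (\row_l P l t x)).
  by apply: (ck_chain (U := setT) openT openT (smooth_components i j k)) => // l; exact: smooth_P.
by apply: ck_ext oT _ H => t x _ _; rewrite rowP_phi.
Qed.

Lemma pulled_cst u v t x : t \in `[0, 1] -> pulled u v t x = pulled u v 0 x.
Proof.
move=> tI; have I0 : (0 : R) \in `[0, 1] by rewrite in_itv /= lexx ler01.
have [|||u' _] := @pd_mvt R m None (pulled u v) (fun _ _ => 0) 0 x t I0.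
- by rewrite /admissible /= add0r.
- by move=> r _; exact: smooth_jcont (smooth_pulled u v) I.
- move=> r rI; apply: is_pd_pulled; apply: move_time => //.
  by apply: admissible_scale => //; rewrite /admissible /= add0r.
by rewrite /at_pair /= add0r mulr0 => /eqP; rewrite subr_eq0 => /eqP.
Qed.

Lemma form2E t x (a b : V) : form2 (w t) x a b = \sum_i \sum_j a 0 i * b 0 j * W i j t x.
Proof.
rewrite /form2 /pairing mxE exchange_big; apply: eq_bigr => j _.
rewrite !mxE mulr_suml; apply: eq_bigr => i _; rewrite /W; ring.
Qed.

Lemma push0 u i x : push u i 0 x = u 0 i.
Proof.
have I0 : (0 : R) \in `[0, 1] by rewrite in_itv /= lexx ler01.
have D k : pd (Some k) (P i) 0 x = (k == i)%:R.
  apply: pdE => //; have := is_pd_coord (Some k) i 0 x.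
  rewrite (inj_eq Some_inj) => -[q [cq hq]]; exists q; split; first exact: cq.
  by move=> h ah; have := hq h ah; rewrite /at_pair /= /P !(flow0 fphi).
rewrite /push (bigD1 i) //= D eqxx mulr1 big1 ?addr0 // => k /negPf ki.
by rewrite D ki mulr0.
Qed.

Lemma moser_pullback t : t \in `[0, 1] -> pullback_eq (phi t) (w t) (w 0).
Proof.
move=> tI x u v; rewrite !form2E.
transitivity (pulled u v t x).
  by apply: eq_bigr => i _; apply: eq_bigr => j _; rewrite !push_diff.
rewrite pulled_cst //; apply: eq_bigr => i _; apply: eq_bigr => j _.
by rewrite !push0 (flow0 fphi).
Qed.

End Flow.

End Field.

End Moser.

Theorem corollary1p4 (R : realType) (n : nat) (hn : (4 <= 2 * n)%N)
  (w : R -> 'rV[R]_(2 * n) -> 'M[R]_(2 * n)) (hw : symplectic_isotopy w) :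
  (exists C : R, exists r0 : R, [/\ 0 < C, 1 < r0 &
     forall r t : R, r0 <= r -> t \in `[0, 1] ->
       sphere_norm r (fun x => invmx (w t x)) * sphere_norm r (path_dot w t)
         <= C * ln r]) ->
  strong_isotopy w.
Proof.
move=> [C0 [r0 [C00 r01 hyp]]].
(* The dimension hypothesis enters here: it supplies four distinct coordinate directions, one for
   the poles, one for the base point and two in which orthogonal vectors are found. *)
have lt4 k : (k < 4)%N -> (k < 2 * n)%N by move=> k4; exact: leq_trans hn.
pose i0 := Ordinal (lt4 0 isT); pose i1 := Ordinal (lt4 1 isT).
pose i2 := Ordinal (lt4 2 isT); pose i3 := Ordinal (lt4 3 isT).
have distinct : uniq [:: i0; i1; i2; i3] by [].
have [al [sal dal [C c0 alC]]] :=
  spherical_primitive distinct (smooth_dot hw) (dot_anti hw) (dot_closed hw).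
have [A A0 gX] := moser_field_growth hw sal c0 C00 r01 alC hyp.
have sX := smooth_moser_field hw sal.
have [phi fphi] := flow_exists A0 (fun i => sX i 1%N) gX.
have sphi : smooth_path phi by move=> k; apply: ck_Ck_path => j; exact: flow_ck sX fphi j.
split => //; exists phi; split => // t tI; last exact: (moser_pullback hw sal dal fphi tI).
split; first by move=> k; exact: Ck_path_Ck tI (sphi k).
have [theta [stheta K1 K2]] := flow_inverse A0 sX fphi gX tI.
exists (theta 1); split => // k; apply: Ck_path_Ck (stheta k).
by rewrite in_itv /= ler01 lexx.
Qed.
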